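(* Let $\mathcal{H}$ be an irreducible $\overline{\mathbb{Q}_\ell}$-hypergeometric sheaf on $\mathbb{G}_m/\overline{\mathbb{F}_p}$, $p\neq\ell$, of type $(D,m)$ with $D>m$, which is definable on $\mathbb{G}_m/\mathbb{F}_q$ for some finite extension $\mathbb{F}_q/\mathbb{F}_p$. Let $G_{\mathrm{geom}}$ be its geometric monodromy group, and denote by $G_{P(\infty)}$ the Zariski closure inside $G_{\mathrm{geom}}$ of the normal subgroup generated by all $G_{\mathrm{geom}}$-conjugates of the image of the wild inertia group $P(\infty)$. Then $G_{\mathrm{geom}}/G_{P(\infty)}$ is a finite cyclic group of order prime to $p$.
   Context: Hypergeometric sheaf of type $(D,m)$, $D>m\ge0$: Katz's $\mathcal{H}yp_\psi(\chi_1,\ldots,\chi_D;\rho_1,\ldots,\rho_m)$ for multiplicative characters of a finite field $\mathbb{F}_q^\times\subset\overline{\mathbb{F}_p}$ and a nontrivial additive character $\psi$ of $\mathbb{F}_p$; it is lisse of rank $D$ on $\mathbb{G}_m$, tame at $0$, and at $\infty$ is the sum of a tame part of rank $m$ and a totally wild part of rank $D-m$ with all breaks $1/(D-m)$. The geometric monodromy group $G_{\mathrm{geom}}$ is the Zariski closure of the image of $\pi_1(\mathbb{G}_m/\overline{\mathbb{F}_p})$. $P(\infty)$ is the wild inertia subgroup (the pro-$p$ Sylow) of the inertia group $I(\infty)$ at $\infty$. *)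

(* Defs.v *)
(* Plain MathComp, with multinomials for polynomial functions and the set
   notations of mathcomp.classical.

   Lisse sheaves are treated as representations.  Fix an algebraic closure
   Omega of k(t), where k is an algebraic closure of F_p.  The group pi_1(G_m/k)
   is the quotient of Aut(Omega/k(t)) by the closed normal subgroup generated by
   the inertia groups at the places above the points of k^*, and likewise for
   pi_1(G_m/F_q) and F_q(t).  (Restriction to the separable closure of k(t) in
   Omega is an isomorphism of topological groups, so that Omega may replace it.)
   A lisse sheaf is a continuous linear representation of such a group. *)
From HB Require Import structures.
From mathcomp Require Import all_boot all_order all_fingroup all_algebra all_solvable.
From mathcomp Require Import classical_sets mpoly.

Set Implicit Arguments.
Unset Strict Implicit.
Unset Printing Implicit Defensive.

Import Order.TTheory GRing.Theory Num.Theory.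
Local Open Scope ring_scope.
Local Open Scope classical_set_scope.

Definition is_algebraic_closure (F : fieldType) (L : closedFieldType)
    (i : {rmorphism F -> L}) : Prop :=
  forall x : L, algebraicOver i x.

Section EllAdicNumbers.

(* A rational-valued valuation, given by its values on nonzero elements; its
   value at 0 is irrelevant. *)
Definition is_valuation (K : fieldType) (v : K -> rat) : Prop :=
  (forall x y, x != 0 -> y != 0 -> v (x * y) = v x + v y) /\
  (forall x y, x != 0 -> y != 0 -> x + y != 0 ->
     Order.min (v x) (v y) <= v (x + y)).

Definition val_ge (K : fieldType) (v : K -> rat) (N : nat) (x : K) : Prop :=
  x = 0 \/ N%:R <= v x.

Definition val_complete (K : fieldType) (v : K -> rat) : Prop :=
  forall u : nat -> K,
    (forall N, exists n0, forall n n',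
       (n0 <= n)%N -> (n0 <= n')%N -> val_ge v N (u n - u n')) ->
    exists x, forall N, exists n0, forall n,
       (n0 <= n)%N -> val_ge v N (u n - x).

(* (Q, v) is the completion of the rational numbers for the ell-adic valuation:
   a nonarchimedean valuation with v ell = 1 is ell-adic on the rationals. *)
Definition is_Q_ell (ell : nat) (Q : fieldType) (v : Q -> rat) : Prop :=
  [/\ [pchar Q] =i pred0,
      is_valuation v,
      v ell%:R = 1,
      val_complete v
    & forall (x : Q) (N : nat), exists r : rat, val_ge v N (x - ratr r)].

(* E, with the valuation w, is an algebraic closure of Q_ell with the valuation
   extending the ell-adic one. *)
Definition is_Q_ell_bar (ell : nat) (Q : fieldType) (v : Q -> rat)
    (E : closedFieldType) (w : E -> rat) (i : {rmorphism Q -> E}) : Prop :=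
  [/\ is_Q_ell ell v, is_algebraic_closure i, is_valuation w
    & forall x, x != 0 -> w (i x) = v x].

End EllAdicNumbers.

Section FundamentalGroup.

Variables (p : nat) (k Omega : closedFieldType).
Variable iota : {rmorphism {fraction {poly k}} -> Omega}.

Definition const (c : k) : Omega := iota (tofrac c%:P).
Definition coord : Omega := iota (tofrac 'X).

(* The subfield of k with q elements, when q is a power of the characteristic. *)
Definition Fq (q : nat) : set k := [set c | c ^+ q = c].

(* Aut(Omega/k0(t)), for a subfield k0 of k. *)
Definition Gal (k0 : set k) : set {rmorphism Omega -> Omega} :=
  [set s | [/\ bijective s, s coord = coord
             & forall c, k0 c -> s (const c) = const c]].

Definition subgroup (G : set {rmorphism Omega -> Omega}) : Prop :=
  [/\ forall s, G s -> bijective s,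
      G idfun,
      forall s t, G s -> G t -> G (s \o t)
    & forall s, G s -> exists2 t, G t & forall x, s (t x) = x].

Definition agree_on (S : seq Omega) (s t : Omega -> Omega) : Prop :=
  forall x, x \in S -> s x = t x.

Definition krull_closed (G : set {rmorphism Omega -> Omega}) : Prop :=
  forall s : {rmorphism Omega -> Omega}, bijective s ->
    (forall S, exists2 t, G t & agree_on S s t) -> G s.

(* A closed subgroup is pro-p when every element has p-power order modulo every
   open subgroup. *)
Definition pro_p (G : set {rmorphism Omega -> Omega}) : Prop :=
  forall s, G s -> forall S, exists n, agree_on S (iter (p ^ n)%N s) idfun.

Definition closed_pro_p_subgroup (P : set {rmorphism Omega -> Omega}) : Prop :=
  [/\ subgroup P, krull_closed P & pro_p P].

Definition pro_p_Sylow (G P : set {rmorphism Omega -> Omega}) : Prop :=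
  [/\ P `<=` G, closed_pro_p_subgroup P
    & forall P', P' `<=` G -> closed_pro_p_subgroup P' -> P `<=` P' -> P' `<=` P].

(* Points of the projective line over k: [Some a] is the point t = a and [None]
   is the point at infinity. *)
Definition uniformizer (a : option k) : Omega :=
  if a is Some c then coord - const c else coord^-1.

Definition valuation_ring (O : set Omega) : Prop :=
  [/\ O 1, forall x y, O x -> O y -> O (x - y),
      forall x y, O x -> O y -> O (x * y)
    & forall x, O x \/ O x^-1].

Definition max_ideal (O : set Omega) : set Omega :=
  [set x | O x /\ (x = 0 \/ ~ O x^-1)].

(* A place of Omega is given by its valuation ring.  Omega being algebraic over
   k(t), the places above a are the valuation rings containing k in whose maximal
   ideal the uniformizer at a lies. *)
Definition place_above (a : option k) (O : set Omega) : Prop :=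
  [/\ valuation_ring O, forall c, O (const c) & max_ideal O (uniformizer a)].

Definition stabilizes (s : {rmorphism Omega -> Omega}) (O : set Omega) : Prop :=
  forall x, O (s x) <-> O x.

Definition inertia (k0 : set k) (O : set Omega) :
    set {rmorphism Omega -> Omega} :=
  [set s | [/\ Gal k0 s, stabilizes s O
             & forall x, O x -> max_ideal O (s x - x)]].

Definition wild_inertia (O : set Omega) (P : set {rmorphism Omega -> Omega}) :
    Prop :=
  pro_p_Sylow (inertia setT O) P.

(* s induces on the residue field k of O the inverse of x |-> x ^ Q. *)
Definition geometric_frobenius (k0 : set k) (O : set Omega) (Q : nat) :
    set {rmorphism Omega -> Omega} :=
  [set s | [/\ Gal k0 s, stabilizes s O
             & forall x, O x -> max_ideal O (s x ^+ Q - x)]].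

End FundamentalGroup.

Section LisseSheaves.

Variables (p : nat) (k Omega : closedFieldType).
Variable iota : {rmorphism {fraction {poly k}} -> Omega}.
Variables (E : closedFieldType) (w : E -> rat).

(* The values of a representation matter only on the group at hand. *)
Definition representation D (G : set {rmorphism Omega -> Omega})
    (V : {rmorphism Omega -> Omega} -> 'M[E]_D) : Prop :=
  V idfun = 1%:M /\
  forall s t, G s -> G t -> V (s \o t) = V s *m V t.

Definition continuous_rep D (G : set {rmorphism Omega -> Omega})
    (V : {rmorphism Omega -> Omega} -> 'M[E]_D) : Prop :=
  forall N : nat, exists S : seq Omega, forall s, G s -> agree_on S s idfun ->
    forall i j, val_ge w N ((V s - 1%:M) i j).

(* A lisse sheaf on G_m over the subfield k0 of k. *)
Definition lisse_on_Gm D (k0 : set k)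
    (V : {rmorphism Omega -> Omega} -> 'M[E]_D) : Prop :=
  [/\ representation (Gal iota k0) V,
      continuous_rep (Gal iota k0) V
    & forall (a : k) O, a != 0 -> place_above iota (Some a) O ->
        forall s, inertia iota k0 O s -> V s = 1%:M].

Definition geom_isomorphic D
    (V W : {rmorphism Omega -> Omega} -> 'M[E]_D) : Prop :=
  exists2 g, g \in unitmx &
    forall s, Gal iota setT s -> g *m V s = W s *m g.

Definition definable_over D (q : nat)
    (V : {rmorphism Omega -> Omega} -> 'M[E]_D) : Prop :=
  exists2 A, lisse_on_Gm (Fq q) A & geom_isomorphic A V.

(* Matrices act on column vectors; a subspace is the row space of a matrix,
   whence the transpositions. *)
Definition stable D (G : set {rmorphism Omega -> Omega})
    (V : {rmorphism Omega -> Omega} -> 'M[E]_D) (U : 'M[E]_D) : Prop :=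
  forall s, G s -> stablemx U (V s)^T.

Definition irreducible_sheaf D
    (V : {rmorphism Omega -> Omega} -> 'M[E]_D) : Prop :=
  (0 < D)%N /\
  forall U : 'M[E]_D, stable (Gal iota setT) V U ->
    \rank U = 0%N \/ \rank U = D.

Definition tame_at_zero D
    (V : {rmorphism Omega -> Omega} -> 'M[E]_D) : Prop :=
  forall O P, place_above iota (Some 0) O -> wild_inertia p iota O P ->
    forall s, P s -> V s = 1%:M.

(* The restriction to I(oo) is the sum of a tame part T of rank m and a totally
   wild part W, i.e. one without nonzero P(oo)-invariants. *)
Definition tame_rank_at_infinity D (m : nat)
    (V : {rmorphism Omega -> Omega} -> 'M[E]_D) : Prop :=
  forall O P, place_above iota None O -> wild_inertia p iota O P ->
  exists T W : 'M[E]_D,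
    [/\ [/\ stable (inertia iota setT O) V T, stable (inertia iota setT O) V W,
            (T :&: W)%MS = 0 & (T + W :=: 1%:M)%MS],
        \rank T = m,
        forall s, P s -> T *m (V s)^T = T
      & forall u : 'rV[E]_D, (u <= W)%MS ->
          (forall s, P s -> u *m (V s)^T = u) -> u = 0].

End LisseSheaves.

Section Hypergeometric.

Variables (p : nat) (k Omega : closedFieldType).
Variable iota : {rmorphism {fraction {poly k}} -> Omega}.
Variables (E : closedFieldType) (w : E -> rat).

(* Characters are functions on k of which only the restriction to the relevant
   finite subfield matters. *)
Definition mult_character (q : nat) (chi : k -> E) : Prop :=
  chi 1 = 1 /\
  forall x y, Fq q x -> Fq q y -> x != 0 -> y != 0 ->
    chi (x * y) = chi x * chi y.

Definition nontrivial_add_character (psi : k -> E) : Prop :=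
  [/\ psi 0 = 1,
      forall x y, Fq p x -> Fq p y -> psi (x + y) = psi x * psi y
    & exists2 x, Fq p x & psi x != 1].

(* Norm from F_(q^r) to F_q, and trace from F_(p^n) to F_p, inside k. *)
Definition norm_to (q r : nat) (x : k) : k := \prod_(s < r) x ^+ (q ^ s).
Definition trace_to (n : nat) (x : k) : k := \sum_(s < n) x ^+ (p ^ s).

(* The trace of Hyp_psi(chi_1, .., chi_D; rho_1, .., rho_m) at the unit a of
   L, where #|L| = q^r and q = p^f: with sign (-1)^(D+m-1), the sum over the
   pairs of tuples x, y of units of L, with prod x = a prod y, of
   prod_i chi_i(N x_i) prod_j rho_j(N y_j)^-1 psi(Tr(sum x - sum y)). *)
Definition hypergeometric_sum D m (f r : nat) (psi : k -> E)
    (chi : 'I_D -> k -> E) (rho : 'I_m -> k -> E)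
    (L : finFieldType) (emb : {rmorphism L -> k}) (a : L) : E :=
  (-1) ^+ (D + m).-1 *
  \sum_(xy : {ffun 'I_D -> L} * {ffun 'I_m -> L} |
          [&& [forall i, xy.1 i != 0], [forall j, xy.2 j != 0] &
              \prod_i xy.1 i == a * \prod_j xy.2 j])
    (\prod_i chi i (norm_to (p ^ f) r (emb (xy.1 i)))) *
    (\prod_j (rho j (norm_to (p ^ f) r (emb (xy.2 j))))^-1) *
    psi (trace_to (f * r) (emb (\sum_i xy.1 i - \sum_j xy.2 j))).

(* The sheaf A on G_m over F_q, q = p^f, has the trace function (for geometric
   Frobenius elements) of Katz's Hyp_psi(chi; rho). *)
Definition hypergeometric_trace D m (f : nat) (psi : k -> E)
    (chi : 'I_D -> k -> E) (rho : 'I_m -> k -> E)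
    (A : {rmorphism Omega -> Omega} -> 'M[E]_D) : Prop :=
  forall (r : nat) (L : finFieldType) (emb : {rmorphism L -> k}) (a : L) O s,
    (0 < r)%N -> #|L| = ((p ^ f) ^ r)%N -> a != 0 ->
    place_above iota (Some (emb a)) O ->
    geometric_frobenius iota (Fq (p ^ f)) O #|L| s ->
    \tr (A s) = hypergeometric_sum f r psi chi rho emb a.

(* H is, on G_m over k, the sheaf Hyp_psi(chi; rho) of type (D, m) attached to
   characters of some finite subfield of k.  In place of the construction by
   multiplicative convolution, the sheaf is specified by its trace function over
   all finite extensions, which determines it up to isomorphism when it is
   geometrically irreducible, together with the tame and wild parts of its local
   monodromy, known from Katz (Exponential Sums and Differential Equations, 8.4.2);
   the breaks 1/(D - m) of the wild part are not restated. *)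
Definition hypergeometric D (m : nat)
    (H : {rmorphism Omega -> Omega} -> 'M[E]_D) : Prop :=
  exists (f : nat) (psi : k -> E) (chi : 'I_D -> k -> E) (rho : 'I_m -> k -> E)
         (A : {rmorphism Omega -> Omega} -> 'M[E]_D),
    [/\ [/\ (0 < f)%N, nontrivial_add_character psi,
            forall i, mult_character (p ^ f) (chi i)
          & forall j, mult_character (p ^ f) (rho j)],
        lisse_on_Gm iota w (Fq (p ^ f)) A,
        hypergeometric_trace f psi chi rho A,
        tame_at_zero p iota A /\ tame_rank_at_infinity p iota m A
      & geom_isomorphic iota A H].

End Hypergeometric.

Section MonodromyGroups.

Variables (E : closedFieldType) (D : nat).

(* Closure in GL_D: functions regular on GL_D are polynomials in the entries
   divided by a power of the determinant. *)
Definition zariski_closure (S : set 'M[E]_D) : set 'M[E]_D :=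
  [set g | g \in unitmx /\
     forall F : {mpoly E[D * D]},
       (forall h, S h -> F.@[mxvec h 0] = 0) -> F.@[mxvec g 0] = 0].

Definition matrix_subgroup (G : set 'M[E]_D) : Prop :=
  [/\ forall g, G g -> g \in unitmx,
      G 1%:M,
      forall g h, G g -> G h -> G (g *m h)
    & forall g, G g -> G (invmx g)].

(* The subgroup generated by the G-conjugates of the elements of S. *)
Definition normal_closure (G S : set 'M[E]_D) : set 'M[E]_D :=
  [set h | forall K, matrix_subgroup K ->
     (forall g s, G g -> S s -> K (g *m s *m invmx g)) -> K h].

Variables (k Omega : closedFieldType).
Variable iota : {rmorphism {fraction {poly k}} -> Omega}.
Variable V : {rmorphism Omega -> Omega} -> 'M[E]_D.

Definition G_geom : set 'M[E]_D := zariski_closure (V @` Gal iota setT).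

(* The closure, inside G_geom, of the normal subgroup generated by the image of
   the group P. *)
Definition G_P (P : set {rmorphism Omega -> Omega}) : set 'M[E]_D :=
  G_geom `&` zariski_closure (normal_closure G_geom (V @` P)).

End MonodromyGroups.

(* The quotient of G by its subgroup N is isomorphic to the finite group gT.  For
   a closed normal subgroup N of a linear algebraic group G over an algebraically
   closed field of characteristic 0, G / N is determined by G(E) / N(E) when the
   latter is finite. *)
Definition quotient_isomorphic (E : closedFieldType) D (G N : set 'M[E]_D)
    (gT : finGroupType) : Prop :=
  N `<=` G /\
  exists phi : 'M[E]_D -> gT,
    [/\ forall g h, G g -> G h -> phi (g *m h) = (phi g * phi h)%g,
        forall z, exists2 g, G g & phi g = z
      & forall g, G g -> (phi g = 1%g <-> N g)].

(* Main.v *)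
(* Let N be the closed normal subgroup of the statement and K its preimage in
   Aut(Omega/k(t)).  K contains the inertia groups at the points of k^*, the wild
   inertia at 0, because H is tame there, and the wild inertia at infinity.  As the
   projective line is simply connected, every element of Omega fixed by K is fixed
   by the automorphisms fixing t^(1/r), for some r prime to p.  In particular K
   contains the commutators.

   A Frobenius acts on the tame inertia at 0 by s |-> s^q.  Hence the eigenvalues of
   H(s) are roots of unity and H(s)^n0 is unipotent for n0 = q^(D!) - 1.  Let nu be
   its logarithm.  The trace form is nondegenerate on the span of the conjugates of
   nu (Cartan's criterion and irreducibility), so nu is a combination of differences
   x nu x^-1 - nu; these are tangent to commutators, which lie in N.  Thus s^n0 lies
   in K, and K contains the automorphisms fixing t^(1/n0).  The quotient is therefore
   a quotient of the group of n0-th roots of unity. *)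
Require Import Defs.
From HB Require Import structures.
From mathcomp Require Import all_boot all_order all_fingroup all_algebra all_solvable.
From mathcomp Require Import separable.
From mathcomp Require Import boolp classical_sets filter mpoly zify.
Set Implicit Arguments.
Unset Strict Implicit.
Unset Printing Implicit Defensive.
Import Order.TTheory GRing.Theory Num.Theory.
Local Open Scope ring_scope.
Local Open Scope classical_set_scope.

(** * Linear algebra: trace forms and unipotent elements *)

(** Lie algebras of closed groups are never formed. In characteristic 0 a polynomial curve is
    determined by its values at the natural numbers, and for unipotent u the powers u^j lie on such
    a curve, with velocity log u at 0. Tangency to commutators refers to velocities of these curves,
    and the closed subgroup N enters only through its ideal, which is shown to be stable under the
    left-invariant derivation given by nu. Because Omega is an algebraic and not only a separable
    closure, fixed fields contain all p-power roots; an invariant element is a rational function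
    only after some power p^a, and this power recurs throughout. Simple connectedness of the line is
    obtained without a genus formula: an unramified covering has dual families for the trace form on
    each of the two charts, and a residue pairing shows that one of the families at infinity is
    constant modulo t^-1. In n0 the factorial arises because a section of z |-> z^q permutes at most
    D eigenvalues, and its cycle lengths divide D!. As n0 + 1 is a power of p, n0 is prime to p,
    which gives the claim on the order of the quotient. *)

Section LinearSubspaces.

Variables (K : fieldType) (vT : vectType K).

(** Among the finite families satisfying [P], one whose span has maximal dimension works: any
    further vector would enlarge it. *)
Lemma span_of_prop (P : vT -> Prop) :
  exists X : seq vT, (forall x, x \in X -> P x) /\ forall x, P x -> x \in <<X>>%VS.
Proof.
pose Q d := `[< exists X : seq vT, (forall x, x \in X -> P x) /\ \dim <<X>>%VS = d >].
have Q0 : exists d, Q d.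
  by exists 0%N; apply/asboolP; exists [::]; split => //; rewrite span_nil dimv0.
have Qle d : Q d -> (d <= \dim {:vT})%N.
  by move=> /asboolP[X [_ <-]]; rewrite dimvS// subvf.
case: (ex_maxnP Q0 Qle) => d /asboolP[X [XP dX]] dmax.
exists X; split => // x Px; apply: contraT => xX.
have : Q (\dim <<x :: X>>%VS).
  apply/asboolP; exists (x :: X); split => // y; rewrite inE => /orP[/eqP->//|]; exact: XP.
move=> /dmax; rewrite -dX => le.
have: (<<X>> == <<x :: X>>)%VS by rewrite eqEdim le andbT span_cons addvSr.
move=> /eqP e; by rewrite e memv_span ?mem_head in xX.
Qed.

Lemma vspace_of_prop (P : vT -> Prop) :
  P 0 -> (forall a x y, P x -> P y -> P (a *: x + y)) ->
  exists U : {vspace vT}, forall x, x \in U <-> P x.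
Proof.
move=> P0 PD; have [X [XP PX]] := span_of_prop P.
exists <<X>>%VS => x; split; last exact: PX.
move=> /(@coord_span _ _ _ (in_tuple X)) ->.
have Ps a y : P y -> P (a *: y) by move=> Py; rewrite -[_ *: _]addr0; apply: PD.
apply: (big_ind P) => //; first by move=> u v Pu Pv; rewrite -[u]scale1r; apply: PD.
by move=> i _; apply: Ps; apply: XP; apply: mem_nth.
Qed.

Lemma separating_form (U : {vspace vT}) (v : vT) : v \notin U ->
  exists f : {linear vT -> K^o}, (forall u, u \in U -> f u = 0) /\ f v = 1.
Proof.
move=> vU; pose X := cons_tuple v (vbasis U).
have Xf : free X by rewrite free_cons (span_basis (vbasisP U)) vU (basis_free (vbasisP U)).
have cE (i j : 'I_(\dim U).+1) : coord X i X`_j = (j == i)%:R by rewrite coord_free.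
exists (coord X ord0 : {linear vT -> K^o}); split; last exact: (cE ord0 ord0).
move=> u uU; rewrite (coord_vbasis uU) linear_sum big1// => i _.
by rewrite linearZ /= (cE ord0 (lift ord0 i)) mulr0n scaler0.
Qed.

End LinearSubspaces.

(** The subspace is a mere predicate and the form is returned by its coefficients: these are
    rational numbers in [rational_form], and coefficients of polynomials in [laurent_duality]. *)
Lemma row_form_separation (K : fieldType) n (P : 'rV[K]_n -> Prop) (v : 'rV[K]_n) :
  P 0 -> (forall a x y, P x -> P y -> P (a *: x + y)) -> ~ P v ->
  exists f : 'I_n -> K, (forall u, P u -> \sum_i u 0 i * f i = 0) /\ \sum_i v 0 i * f i = 1.
Proof.
move=> P0 PD Pv; have [U UP] := vspace_of_prop P0 PD.
have vU : v \notin U by apply/negP => /UP.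
have [f [f0 f1]] := separating_form vU.
have fE (u : 'rV[K]_n) : f u = \sum_i u 0 i * f (delta_mx 0 i) :> K.
  rewrite {1}[u]row_sum_delta linear_sum; apply: eq_bigr => i _.
  by rewrite linearZ.
exists (fun i => f (delta_mx 0 i)); split; last by rewrite -fE.
by move=> u /UP /f0; rewrite fE.
Qed.

Section CoprimePowers.

Variable E : fieldType.
Implicit Types (s : seq E) (q : {poly E}).

Lemma coprimep_prod_XsubC_exp s N (l : E) : l \notin s ->
  coprimep (('X - l%:P) ^+ N) (\prod_(m <- s) ('X - m%:P) ^+ N).
Proof.
move=> ls; apply: coprimep_expl; rewrite coprimep_sym coprimep_XsubC.
apply/rootPf; rewrite horner_prod; apply: contraNF ls.
rewrite prodf_seq_eq0 => /hasP[m ms]; rewrite /= horner_exp !hornerE expf_eq0 subr_eq0.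
by case/andP => _ /eqP->.
Qed.

Lemma prod_XsubC_exp_dvdp s N q : uniq s ->
  (forall m, m \in s -> ('X - m%:P) ^+ N %| q) -> \prod_(m <- s) ('X - m%:P) ^+ N %| q.
Proof.
elim: s => [|l s IH] /=; first by rewrite big_nil dvd1p.
case/andP=> ls us H; rewrite big_cons Gauss_dvdp ?coprimep_prod_XsubC_exp//.
rewrite H ?mem_head//= IH// => m ms; apply: H; by rewrite inE ms orbT.
Qed.

(** Chinese remainder theorem, from a Bezout relation between (X - l)^N and the product over the
    other points of [s]. *)
Lemma crt_XsubC_exp s N : uniq s ->
  exists e : E -> {poly E}, forall l, l \in s ->
    ('X - l%:P) ^+ N %| e l - 1 /\
    forall m, m \in s -> m != l -> ('X - m%:P) ^+ N %| e l.
Proof.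
move=> us; suff H l : {p : {poly E} | l \in s -> ('X - l%:P) ^+ N %| p - 1 /\
    forall m, m \in s -> m != l -> ('X - m%:P) ^+ N %| p}.
  by exists (fun l => sval (H l)) => l; exact: (svalP (H l)).
apply: cid; have [ls|_] := boolP (l \in s); last by exists 0.
pose s' := [seq m <- s | m != l].
have /coprimep_prod_XsubC_exp - /(_ N) : l \notin s' by rewrite mem_filter eqxx.
move=> /Bezout_eq1_coprimepP[[u v] /= uv].
exists (v * \prod_(m <- s') ('X - m%:P) ^+ N) => _; split.
  rewrite (_ : _ - 1 = - u * ('X - l%:P) ^+ N) ?dvdp_mull//.
  by apply/eqP; rewrite subr_eq mulNr -[X in _ + X]uv addKr.
move=> m ms ml; apply: dvdp_mull; rewrite (big_rem m) ?dvdp_mulr//=.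
by rewrite mem_filter ml ms.
Qed.

End CoprimePowers.

(** In the rank factorization of [A], idempotency forces [row_base A *m col_base A] to be an
    identity matrix, of size the rank. *)
Lemma mxtrace_idempotent (F : fieldType) n (A : 'M[F]_n) :
  A *m A = A -> \tr A = (\rank A)%:R.
Proof.
move=> AA; rewrite -[in LHS](mulmx_base A) mxtrace_mulC.
suff -> : row_base A *m col_base A = 1%:M by rewrite mxtrace1.
have /row_full_inj inj1 := col_base_full A; have /row_free_inj inj2 := row_base_free A.
apply: inj1; apply: inj2; rewrite mulmx1 mulmx_base.
by rewrite mulmxA mulmx_base -mulmxA mulmx_base AA.
Qed.

(** * Generalized eigenspaces and traces *)

Section SpectralProjections.

Variables (E : closedFieldType) (n : nat).
Implicit Types (A B : 'M[E]_n.+1).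

Lemma eigenvalue_poly (A : 'M[E]_n.+1) (v : 'rV_n.+1) l (q : {poly E}) :
  v *m A = l *: v -> v *m horner_mx A q = q.[l] *: v.
Proof.
move=> vA; elim/poly_ind: q => [|q c IH]; first by rewrite rmorph0 mulmx0 horner0 scale0r.
rewrite rmorphD rmorphM /= horner_mx_X horner_mx_C hornerMXaddC mulmxDr mulmxA IH.
by rewrite -scalemxAl vA mul_mx_scalar scalerA scalerDl.
Qed.

(** The projections onto the generalized eigenspaces, as polynomials in [A] furnished by the Chinese
    remainder theorem. *)
Lemma spectral_projections A : exists (s : seq E) (e : E -> {poly E}),
  [/\ uniq s, (forall l, (l \in s) = eigenvalue A l),
      \sum_(l <- s) horner_mx A (e l) = 1,
      forall l, l \in s -> (A - l%:M) ^+ n.+1 * horner_mx A (e l) = 0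
    & forall l, l \in s -> horner_mx A (e l) * horner_mx A (e l) = horner_mx A (e l)
      /\ horner_mx A (e l) != 0].
Proof.
have [r rE] := closed_field_poly_normal (char_poly A).
rewrite (monicP (char_poly_monic A)) scale1r in rE.
pose s := undup r; have us : uniq s := undup_uniq r.
have sE l : (l \in s) = eigenvalue A l.
  by rewrite mem_undup eigenvalue_root_char rE root_prod_XsubC.
have [e eP] := crt_XsubC_exp n.+1 us.
pose p := \prod_(m <- s) ('X - m%:P) ^+ n.+1.
have sr : size r = n.+1.
  by apply/succn_inj; rewrite -(size_prod_XsubC _ id) -rE size_char_poly.
(* The exponent [n.+1] bounds every multiplicity in the characteristic polynomial, which therefore
   divides [p]; Cayley-Hamilton applies. *)
have pA q : p %| q -> horner_mx A q = 0.
  move=> pq; have: char_poly A %| q.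
    apply: dvdp_trans pq; rewrite rE -big_undup_iterop_count /p -/s.
    elim: (s) => [|m t IH]; first by rewrite !big_nil dvdpp.
    rewrite !big_cons dvdp_mul// Monoid.iteropE -/(GRing.exp _ _).
    have -> : iter (count_mem m r) ( *%R ('X - m%:P)) 1 = ('X - m%:P) ^+ count_mem m r.
      by elim: (count_mem m r) => // k; rewrite exprS => <-.
    by rewrite dvdp_exp2l// -sr count_size.
  by move=> /dvdpP[q' ->]; rewrite rmorphM /= Cayley_Hamilton mulr0.
have pdvd q : (forall m, m \in s -> ('X - m%:P) ^+ n.+1 %| q) -> p %| q.
  exact: prod_XsubC_exp_dvdp.
exists s, e; split => //.
- apply/eqP; rewrite -subr_eq0; apply/eqP.
  have -> : 1 = horner_mx A 1 by rewrite rmorph1.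
  rewrite -rmorph_sum -rmorphB; apply: pA; apply: pdvd => m ms.
  rewrite (big_rem m)//= addrAC dvdp_add//; first by have [] := eP m ms.
  rewrite big_seq_cond; apply: (big_ind (fun x => ('X - m%:P) ^+ n.+1 %| x)) => [|x y|l]; [exact: dvdp0|exact: dvdp_add|].
  rewrite andbT (rem_filter _ us) mem_filter /= => /andP[lm ls].
  have [_ H] := eP l ls; apply: H => //; by rewrite eq_sym.
- move=> l ls; have -> : A - l%:M = horner_mx A ('X - l%:P).
    by rewrite rmorphB /= horner_mx_X horner_mx_C.
  rewrite -rmorphXn -rmorphM; apply: pA; apply: pdvd => m ms.
  have [->|ml] := eqVneq m l; first by rewrite dvdp_mulr.
  by rewrite dvdp_mull//; have [_] := eP l ls; apply.
move=> l ls; split.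
  apply/eqP; rewrite -subr_eq0 -rmorphM -rmorphB; apply/eqP; apply: pA; apply: pdvd => m ms.
  have -> : e l * e l - e l = (e l - 1) * e l by rewrite mulrBl mul1r.
  have [->|ml] := eqVneq m l; first by rewrite dvdp_mulr//; have [] := eP l ls.
  by rewrite dvdp_mull//; have [_] := eP l ls; apply.
(* An eigenvector for [l] is multiplied by the value of [e l] at [l], which is 1; so the projection
   is not zero. *)
have : eigenvalue A l by rewrite -sE.
move=> /eigenvalueP[v vA v0]; apply: contra_neq v0 => e0.
have := eigenvalue_poly (e l) vA; rewrite e0 mulmx0.
have -> : (e l).[l] = 1.
  have [] := eP l ls; rewrite exprS => /dvdpP[q /(congr1 (horner^~ l))].
  by rewrite !hornerM hornerXsubC subrr mul0r mulr0 hornerD hornerN hornerC => /eqP; rewrite subr_eq0 => /eqP.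
by rewrite scale1r.
Qed.

Lemma eigenvalue_nilpotent A k l : A ^+ k = 0 -> eigenvalue A l -> l = 0.
Proof.
move=> Ak /eigenvalueP[v vA v0].
have := eigenvalue_poly 'X^k vA.
rewrite rmorphXn /= horner_mx_X Ak mulmx0 hornerXn => /esym/eqP.
by rewrite scaler_eq0 (negPf v0) orbF expf_eq0 => /andP[_ /eqP].
Qed.

Lemma nilpotent_eigenvalue A : (forall l, eigenvalue A l -> l = 0) -> A ^+ n.+1 = 0.
Proof.
move=> A0; have [s [e [us sE e1 eA _]]] := spectral_projections A.
rewrite -[LHS]mulr1 -e1 mulr_sumr big_seq big1// => l ls.
have l0 : l = 0 by apply: A0; rewrite -sE.
by have := eA l ls; rewrite l0 raddf0 subr0.
Qed.

Lemma mxtrace_nilpotent A k : A ^+ k = 0 -> \tr A = 0.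
Proof.
move=> Ak; apply/eqP; rewrite -oppr_eq0 -char_poly_trace//=.
have [r rE] := closed_field_poly_normal (char_poly A).
rewrite (monicP (char_poly_monic A)) scale1r in rE.
have r0 z : z \in r -> z = 0.
  by move=> zr; apply: eigenvalue_nilpotent Ak _; rewrite eigenvalue_root_char rE root_prod_XsubC.
have sr : size r = n.+1.
  by apply/succn_inj; rewrite -(size_prod_XsubC _ id) -rE size_char_poly.
rewrite rE; have -> : \prod_(z <- r) ('X - z%:P) = 'X^(size r).
  elim: (r) r0 => [|z t IH] r0; first by rewrite big_nil expr0.
  rewrite big_cons IH => [|y yt]; last by apply: r0; rewrite inE yt orbT.
  by rewrite (r0 z (mem_head _ _)) subr0 exprS.
by rewrite coefXn sr ltn_eqF.
Qed.

(** On the component at [l] the matrix A - l is nilpotent, so only the scalar [l] contributes to the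
    trace. *)
Lemma trace_spectral_component A l (q : {poly E}) :
    (A - l%:M) ^+ n.+1 * horner_mx A q = 0 -> horner_mx A q * horner_mx A q = horner_mx A q ->
  \tr (A * horner_mx A q) = l * (\rank (horner_mx A q))%:R.
Proof.
move=> Aq qq; have AC : GRing.comm A (horner_mx A q) by apply: comm_mx_horner; exact: comm_mx_refl.
have : \tr ((A - l%:M) * horner_mx A q) = 0.
  apply: (@mxtrace_nilpotent _ n.+1).
  rewrite exprMn_comm; first by rewrite (exprS (horner_mx _ _)) mulrA Aq mul0r.
  by apply: commr_sym; apply: commrB; [exact: commr_sym|exact: comm_mx_scalar].
rewrite mulrBl raddfB /= -mulmxE mul_scalar_mx mxtraceZ (mxtrace_idempotent qq).
by move=> /eqP; rewrite subr_eq0 => /eqP.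
Qed.

Hypothesis E0 : [pchar E] =i pred0.

Lemma natr_pchar0 k : (k%:R == 0 :> E) = (k == 0%N).
Proof. exact: (pcharf0P E).1 E0 k. Qed.

(** By linearity tr (A q(A)) = 0 for every polynomial q. When q(A) is the projection at an
    eigenvalue [l], this trace is [l] times a positive rank. *)
Lemma trace_nilpotent A : (forall k, \tr (A ^+ k.+1) = 0) -> A ^+ n.+1 = 0.
Proof.
move=> A0; apply: nilpotent_eigenvalue => l lA.
have trq (q : {poly E}) : \tr (A * horner_mx A q) = 0.
  rewrite -[q]coefK poly_def rmorph_sum mulr_sumr raddf_sum big1// => i _.
  by rewrite -mul_polyC rmorphM /= horner_mx_C rmorphXn /= horner_mx_X -mulmxE mul_scalar_mx
    -scalemxAr mulmxE -exprS mxtraceZ A0 mulr0.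
have [s [e [us sE e1 eA eI]]] := spectral_projections A.
have ls : l \in s by rewrite sE.
have [ee e0] := eI l ls.
have := trace_spectral_component (eA l ls) ee; rewrite trq => /esym/eqP.
by rewrite mulf_eq0 natr_pchar0 mxrank_eq0 (negPf e0) orbF => /eqP.
Qed.

End SpectralProjections.

(** * Rational linear forms on finitely many scalars *)

Section RationalForms.

Variables (E : fieldType) (E0 : [pchar E] =i pred0).

Let intr_eq0 (z : int) : (z%:~R == 0 :> E) = (z == 0).
Proof.
have E1 := (pcharf0P E).1 E0; case: z => m; first exact: E1.
by rewrite NegzE mulrNz oppr_eq0 E1.
Qed.

Lemma ratr_pchar0_lin (a x y : rat) : ratr (a * x + y) = ratr a * ratr x + ratr y :> E.
Proof.
have rearr (R : fieldType) (b y' z c d e : R) :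
    (b * y' + z) * (c * d * e) = b * c * (y' * d) * e + z * e * (c * d).
  by rewrite mulrDl; congr (_ + _); [rewrite mulrA mulrACA|rewrite mulrCA mulrC].
have d0 (z : rat) : (denq z)%:~R != 0 :> E by rewrite intr_eq0 denq_neq0.
have ratE (z : rat) (u v : int) : v != 0 -> z * v%:~R = u%:~R -> ratr z * v%:~R = u%:~R :> E.
  move=> v0 H; have : numq z * v = u * denq z.
    by apply: (@intr_inj rat); rewrite !rmorphM /= -H numqE mulrAC.
  move=> /(congr1 (fun w : int => w%:~R : E)); rewrite /ratr !rmorphM /= => H'.
  by rewrite mulrAC H' mulfK.
pose v := denq a * denq x * denq y.
have v0 : v != 0 by rewrite !mulf_neq0 ?denq_neq0.
pose u := numq a * numq x * denq y + numq y * (denq a * denq x).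
apply: (mulIf (_ : v%:~R != 0)); first by rewrite intr_eq0.
rewrite (ratE _ u) // /u /v !(rmorphM, rmorphD) /=; last first.
  by rewrite !numqE rearr.
by rewrite /ratr rearr !divfK.
Qed.

(** The rational relations among the [l i] form a subspace of row vectors that misses the [i0]-th
    basis vector; a form separating the two is a Q-linear form on the Q-span of the [l i]. *)
Lemma rational_form r (l : 'I_r -> E) (i0 : 'I_r) : l i0 != 0 ->
  exists f : 'I_r -> rat, f i0 != 0 /\
    forall c : 'I_r -> rat, \sum_i ratr (c i) * l i = 0 -> \sum_i c i * f i = 0.
Proof.
move=> l0; pose P (u : 'rV[rat]_r) := \sum_i ratr (u 0 i) * l i = 0.
have ratr0 : ratr 0 = 0 :> E by rewrite /ratr mul0r.
have [||| f [f0 f1]] := @row_form_separation rat r P (delta_mx 0 i0).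
- by rewrite /P big1// => i _; rewrite mxE ratr0 mul0r.
- move=> a x y Px Py; rewrite /P.
  transitivity (ratr a * (\sum_i ratr (x 0 i) * l i) + \sum_i ratr (y 0 i) * l i).
    rewrite mulr_sumr -big_split; apply: eq_bigr => i _ /=.
    by rewrite !mxE ratr_pchar0_lin mulrDl mulrA.
  by rewrite Px Py mulr0 addr0.
- rewrite /P (bigD1 i0)//= big1 ?addr0 => [|i ii0]; last first.
    by rewrite mxE (negPf ii0) andbF ratr0 mul0r.
  by rewrite mxE !eqxx /ratr divr1 mul1r; apply/eqP.
exists f; split.
  move: f1; rewrite (bigD1 i0)//= big1 ?addr0 => [|i ii0]; last first.
    by rewrite mxE (negPf ii0) andbF mul0r.
  by rewrite mxE !eqxx mul1r => ->; rewrite oner_neq0.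
move=> c cl; have := f0 (\row_i c i); rewrite /P.
have -> : \sum_i ratr ((\row_i c i) 0 i) * l i = 0 :> E.
  by rewrite -[RHS]cl; apply: eq_bigr => i _; rewrite mxE.
move=> /(_ erefl) H; rewrite -[RHS]H; apply: eq_bigr => i _; by rewrite mxE.
Qed.

Lemma ratr_pchar0D (x y : rat) : ratr (x + y) = ratr x + ratr y :> E.
Proof. by rewrite -{1}[x]mul1r ratr_pchar0_lin {1}/ratr divr1 mul1r. Qed.

Lemma ratr_pchar0N (x : rat) : ratr (- x) = - ratr x :> E.
Proof.
apply/eqP; rewrite -addr_eq0 -ratr_pchar0D addNr; apply/eqP; exact: mul0r.
Qed.

Lemma ratr_pchar0_natM m (x : rat) : ratr (m%:R * x) = m%:R * ratr x :> E.
Proof.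
elim: m => [|m IH]; first by rewrite !mul0r; exact: mul0r.
by rewrite -addn1 !natrD !mulrDl ratr_pchar0D IH !mul1r.
Qed.

(** The last clause makes f l - f l' a function of l - l' alone. In Cartan's criterion the scalars
    are eigenvalues of x, and their differences are the eigenvalues of ad x. *)
Lemma rational_form_seq (s : seq E) (l0 : E) : uniq s -> l0 \in s -> l0 != 0 ->
  exists f : E -> rat, [/\ f l0 != 0,
    forall c : E -> rat, \sum_(l <- s) ratr (c l) * l = 0 -> \sum_(l <- s) c l * f l = 0
  & forall l l' m m', l \in s -> l' \in s -> m \in s -> m' \in s ->
      l - l' = m - m' -> f l - f l' = f m - f m'].
Proof.
move=> us l0s l00.
pose i0 : 'I_(size s) := Ordinal (eq_ind_r is_true l0s (index_mem l0 s)).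
have [|f [fi0 fP]] := @rational_form (size s) (fun i => s`_i) i0; first by rewrite /= nth_index.
pose g l := if insub (index l s) is Some i then f i else 0.
have gi (i : 'I_(size s)) : g s`_i = f i by rewrite /g index_uniq// valK.
have gP (c : E -> rat) :
    \sum_(l <- s) ratr (c l) * l = 0 :> E -> \sum_(l <- s) c l * g l = 0.
  rewrite !(big_nth (0 : E)) !big_mkord => /fP H; rewrite -[RHS]H.
  by apply: eq_bigr => i _; rewrite gi.
have g0 : g l0 = f i0 by rewrite -gi /= nth_index.
exists g; split => //; first by rewrite g0.
move=> l l' m m' ls l's ms m's e; apply/eqP; rewrite -subr_eq0; apply/eqP.
have sumE (R : fieldType) (z : E) (h : E -> R) : z \in s -> \sum_(y <- s) (y == z)%:R * h y = h z.
  move=> zs; rewrite (bigD1_seq z)//= eqxx mul1r big1 ?addr0// => y /negPf->.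
  by rewrite mul0r.
pose c y : rat := (y == l)%:R - (y == l')%:R - ((y == m)%:R - (y == m')%:R).
have e1 : \sum_(y <- s) ratr (c y) * y = 0 :> E.
  transitivity (\sum_(y <- s) ((y == l)%:R * y - (y == l')%:R * y
                               - ((y == m)%:R * y - (y == m')%:R * y))).
    apply: eq_bigr => y _.
    by rewrite /c !(ratr_pchar0D, ratr_pchar0N) !ratr_nat !mulrDl !mulNr mulrDl mulNr.
  by rewrite !sumrB !(sumE E _ id)// e subrr.
have e2 : \sum_(y <- s) c y * g y = g l - g l' - (g m - g m').
  transitivity (\sum_(y <- s) ((y == l)%:R * g y - (y == l')%:R * g y
                               - ((y == m)%:R * g y - (y == m')%:R * g y))).
    by apply: eq_bigr => y _; rewrite /c !mulrBl.
  by rewrite !sumrB !(sumE rat _ g).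
by rewrite -e2; exact: gP.
Qed.

End RationalForms.

Section StableComponents.

Variables (E : fieldType) (V : vectType E) (T : {linear V -> V}) (R : {vspace V}).
Hypothesis RT : forall b, b \in R -> T b \in R.

Let sh m (c : V) := T c - m *: c.

Let shC m l c : sh m (sh l c) = sh l (sh m c).
Proof.
have TB x y : T (x - y) = T x - T y by rewrite linearB.
have TZ a y : T (a *: y) = a *: T y by rewrite linearZ.
have swap (x y z w : V) : x - y - (z - w) = x - z - (y - w).
  by rewrite !opprB [w - z]addrC addrACA [- y + w]addrC.
by rewrite /sh !TB !TZ !scalerBr !scalerA [l * m]mulrC swap.
Qed.

Let iter_shC k m l c : iter k (sh m) (sh l c) = sh l (iter k (sh m) c).
Proof. by elim: k => //= k ->. Qed.

Let sh0 l : sh l 0 = 0.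
Proof. by rewrite /sh linear0 scaler0 subr0. Qed.

Let shR l c : c \in R -> sh l c \in R.
Proof. by move=> cR; rewrite rpredB ?RT ?rpredZ. Qed.

(** Uses (m - l) c = (T - l) c - (T - m) c, the last term being covered by induction on the
    nilpotency order [k]. *)
Let sh_inv k m l c : iter k (sh m) c = 0 -> m != l -> sh l c \in R -> c \in R.
Proof.
move=> + ml; elim: k c => [|k IH] c; first by move=> /= ->; rewrite sh0.
rewrite iterSr => kc lc.
have mc : sh m c \in R by apply: IH; rewrite // shC shR.
have : (m - l) *: c \in R.
  suff -> : (m - l) *: c = sh l c - sh m c by rewrite rpredB.
  by rewrite /sh opprB [RHS]addrC addrA subrK scalerBl.
by rewrite rpredZeq subr_eq0 (negPf ml).
Qed.

Let iter_sh_inv N k m l c : iter N (sh m) c = 0 -> m != l -> iter k (sh l) c \in R -> c \in R.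
Proof.
move=> + ml; elim: k c => // k IH c Nc; rewrite iterSr => /IH lc.
by apply: (sh_inv Nc ml); apply: lc; rewrite iter_shC Nc sh0.
Qed.

(** Applying (T - l)^N to the sum kills the component at l, and by induction the images of the other
    components lie in R. On a component at m != l, the operator T - l can be undone modulo R. *)
Lemma stable_spectral_component (s : seq E) N (b : E -> V) : uniq s ->
    (forall m, m \in s -> iter N (fun c => T c - m *: c) (b m) = 0) ->
  \sum_(m <- s) b m \in R -> forall m, m \in s -> b m \in R.
Proof.
rewrite -/sh; elim: s b => // l s IH b /= /andP[ls us] bN.
have shsum k (t : seq E) (d : E -> V) :
    iter k (sh l) (\sum_(m <- t) d m) = \sum_(m <- t) iter k (sh l) (d m).
  elim: k d => // k IHk d; rewrite iterSr -(eq_bigr _ (fun i _ => esym (iterSr _ _ _))) -IHk.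
  by rewrite /sh linear_sum scaler_sumr -sumrB.
have iter0 k : iter k (sh l) 0 = 0 by elim: k => //= k ->.
have iterR k c : c \in R -> iter k (sh l) c \in R by move=> cR; elim: k => //= k /shR.
move=> sR; have bs m : m \in s -> b m \in R.
  move=> ms; have ml : m != l by apply: contraNneq ls => <-.
  have mls : m \in l :: s by rewrite inE ms orbT.
  apply: (iter_sh_inv (bN m mls) ml (k := N)).
  apply: (IH (fun m => iter N (sh l) (b m))) => // [m' ms'|].
    rewrite -/sh; have m'ls : m' \in l :: s by rewrite inE ms' orbT.
    have C k c : iter N (sh m') (iter k (sh l) c) = iter k (sh l) (iter N (sh m') c).
      by elim: k => //= k IHk; rewrite iter_shC IHk.
    by rewrite C bN// iter0.
  have iterD c d : iter N (sh l) (c + d) = iter N (sh l) c + iter N (sh l) d.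
    elim: (N) => //= k ->; by rewrite /sh linearD scalerDr opprD addrACA.
  by have := iterR N _ sR; rewrite big_cons iterD bN ?mem_head// add0r shsum.
move=> m; rewrite inE => /orP[/eqP->|/bs//].
rewrite big_cons in sR; rewrite -(addrK (\sum_(m <- s) b m) (b l)) rpredB//.
by rewrite big_seq rpred_sum.
Qed.

End StableComponents.

(** * Cartan's criterion *)

Section Cartan.

Variables (E : closedFieldType) (E0 : [pchar E] =i pred0) (n : nat).
Implicit Types (A B : 'M[E]_n.+1).

Definition lie (A B : 'M[E]_n.+1) : 'M[E]_n.+1 := A * B - B * A.

(** Left multiplication by [p] and right multiplication by [q] commute, so the N-fold iterate
    expands into terms p^i b q^j with i + j = N. *)
Lemma iter_sub_nilpotent N (p q b : 'M[E]_n.+1) :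
  (forall i j, (N <= i + j)%N -> p ^+ i * b * q ^+ j = 0) ->
  iter N (fun c => p * c - c * q) b = 0.
Proof.
elim: N b => [|N IH] b H; first by have := H 0%N 0%N isT; rewrite !expr0 mul1r mulr1.
rewrite iterSr; apply: IH => i j ij; rewrite mulrBr mulrBl !mulrA -exprSr H ?addSn// sub0r.
by rewrite -(mulrA (p ^+ i * b)) -exprS H ?addnS// oppr0.
Qed.

(** Let l0 be a nonzero eigenvalue and f a rational form on the eigenvalues with f(l0) != 0. The
    replica y = sum f(l) pi_l acts on the component of ad x at l - l' by the scalar f(l) - f(l'), so
    ad y preserves R. Then 0 = tr (x y) = sum rank(pi_l) f(l) l, and applying f gives a vanishing
    sum of weighted squares whose term at l0 is positive. *)
Lemma cartan_nilpotent (R : {vspace 'M[E]_n.+1}) (x : 'M[E]_n.+1) :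
    (forall b, b \in R -> lie x b \in R) ->
    (forall y, (forall b, b \in R -> lie y b \in R) -> \tr (x * y) = 0) ->
  x ^+ n.+1 = 0.
Proof.
move=> xR xtr; apply: nilpotent_eigenvalue => l0 l0x; apply/eqP/contraT => l00.
have [s [e [us sE e1 eA eI]]] := spectral_projections x.
pose pi l := horner_mx x (e l).
have l0s : l0 \in s by rewrite sE.
have [f [f0 fP fD]] := rational_form_seq E0 us l0s l00.
pose y := \sum_(l <- s) (ratr (f l) : E) *: pi l.
have yR b : b \in R -> lie y b \in R.
  move=> bR.
  pose T c := lie x c.
  have Tlin : linear T by move=> a c d; rewrite /T /lie mulrDr mulrDl -scalerAr -scalerAl
    scalerBr opprD addrACA.
  pose TL : {linear 'M[E]_n.+1 -> 'M[E]_n.+1} := HB.pack T (GRing.isLinear.Build _ _ _ _ T Tlin).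
  pose ds := undup [seq l - l' | l <- s, l' <- s].
  (* [bm m] is the component of [b] on which ad x has the single eigenvalue [m]. *)
  pose bm m := \sum_(l <- s) \sum_(l' <- s | l - l' == m) pi l * b * pi l'.
  have sumds (g : E -> E) : \sum_(l <- s) \sum_(l' <- s) g (l - l') *: (pi l * b * pi l') =
      \sum_(m <- ds) g m *: bm m.
    transitivity (\sum_(m <- ds) \sum_(l <- s) \sum_(l' <- s | l - l' == m)
        g (l - l') *: (pi l * b * pi l')).
      rewrite [RHS]exchange_big; apply: eq_big_seq => l ls.
      rewrite [RHS](exchange_big_dep predT)//=; apply: eq_big_seq => l' l's.
      rewrite big_mkcond (bigD1_seq (l - l')) ?undup_uniq//=; last first.
        by rewrite mem_undup; apply/allpairsP; exists (l, l').
      by rewrite eqxx big1 ?addr0// => m /negPf; rewrite eq_sym => ->.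
    apply: eq_bigr => m _; rewrite scaler_sumr; apply: eq_bigr => l _.
    by rewrite scaler_sumr; apply: eq_bigr => l' /eqP->.
  have bmR m : m \in ds -> bm m \in R.
    (* With the exponent 2(n+1), in each term (x - l)^i b (x - l')^j one of i and j is at least n+1
       and the corresponding power kills its projection. *)
    apply: (@stable_spectral_component _ _ TL R xR ds (n.+1 + n.+1) bm (undup_uniq _)).
      move=> {}m _; rewrite /bm.
      have itD k (c d : 'M[E]_n.+1) : iter k (fun c => TL c - m *: c) (c + d) =
          iter k (fun c => TL c - m *: c) c + iter k (fun c => TL c - m *: c) d.
        elim: k => //= k ->; by rewrite -[T]/(TL : _ -> _) linearD scalerDr opprD addrACA.
      have it0 k : iter k (fun c => TL c - m *: c) 0 = 0.
        elim: k => //= k ->; by rewrite -[T]/(TL : _ -> _) linear0 scaler0 subr0.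
      rewrite (big_morph _ (itD _) (it0 _)) big_seq big1// => l ls.
      rewrite (big_morph _ (itD _) (it0 _)) big_seq_cond big1// => l' /andP[l's /eqP lm].
      rewrite (@eq_iter _ _ (fun c => (x - l%:M) * c - c * (x - l'%:M))) => [|c]; last first.
        rewrite /= /T /lie mulrBl mulrBr -lm -!mulmxE mul_scalar_mx mul_mx_scalar scalerBl.
        by rewrite !opprB [l' *: c - _]addrC addrACA [- _ + l' *: c]addrC.
      apply: iter_sub_nilpotent => i j ij.
      have xC l1 q : GRing.comm (x - l1%:M) (horner_mx x q).
        apply: commr_sym; apply: commrB; last exact: comm_mx_scalar.
        by apply: commr_sym; apply: comm_mx_horner; exact: comm_mx_refl.
      have [ni|nj] : (n.+1 <= i \/ n.+1 <= j)%N by lia.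
        by rewrite -(subnK ni) exprD -!mulrA (mulrA (_ ^+ n.+1)) eA// !(mul0r, mulr0).
      rewrite -(subnKC nj) exprD -!mulrA (mulrA (pi l')).
      rewrite (_ : pi l' * _ = 0) ?(mul0r, mulr0)// -[RHS](eA l' l's).
      by apply/esym; apply: commr_sym; apply: commrX; apply: commr_sym.
    rewrite (_ : \sum_(m <- ds) bm m = b)//.
    transitivity (\sum_(m <- ds) 1 *: bm m); first by apply: eq_bigr => z _; rewrite scale1r.
    rewrite -(sumds (fun=> 1)) -[RHS]mul1r -[RHS]mulr1 -e1 mulr_suml mulr_suml.
    apply: eq_bigr => l _; rewrite mulr_sumr; apply: eq_bigr => l' _; exact: scale1r.
  (* [g m] is the eigenvalue of ad y on [bm m]; it is well defined by [fD]. *)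
  have [g gE] : exists g : E -> E, forall l l', l \in s -> l' \in s ->
      g (l - l') = ratr (f l) - ratr (f l').
    have H m : {a : E | forall l l', l \in s -> l' \in s -> l - l' = m ->
        a = ratr (f l) - ratr (f l')}.
      apply: cid; have [[l [l' [ls l's lm]]]|no] :=
          pselect (exists l l', [/\ l \in s, l' \in s & l - l' = m]).
        exists (ratr (f l) - ratr (f l')) => l1 l1' l1s l1's; rewrite -lm => e'.
        by rewrite -!ratr_pchar0N// -!ratr_pchar0D//; congr ratr; apply: fD.
      by exists 0 => l l' ls l's lm; case: no; exists l, l'.
    by exists (fun m => sval (H m)) => l l' ls l's; exact: (svalP (H (l - l'))).
  suff -> : lie y b = \sum_(m <- ds) g m *: bm m.
    by rewrite big_seq rpred_sum// => m ms; rewrite rpredZ// bmR.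
  rewrite -sumds; transitivity (\sum_(l <- s) \sum_(l' <- s)
      (ratr (f l) *: (pi l * b * pi l') - ratr (f l') *: (pi l * b * pi l'))); last first.
    apply: eq_big_seq => l ls; apply: eq_big_seq => l' l's.
    by rewrite gE// scalerBl.
  under eq_bigr do rewrite sumrB.
  rewrite sumrB /lie; congr (_ - _).
    rewrite -[y * b]mulr1 -e1 /y !mulr_suml; apply: eq_bigr => l _.
    by rewrite mulr_sumr; apply: eq_bigr => l' _; rewrite -!scalerAl.
  rewrite exchange_big -[b * y]mul1r -e1 /y !mulr_sumr; apply: eq_bigr => l _.
  by rewrite mulr_suml; apply: eq_bigr => l' _; rewrite -!scalerAr mulrA.
have := xtr y yR; rewrite /y mulr_sumr raddf_sum /=.
have trE l : l \in s -> \tr (x * (ratr (f l) *: pi l)) = 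
    ratr ((\rank (pi l))%:R * f l) * l.
  move=> ls; have [pp _] := eI l ls.
  rewrite -scalerAr mxtraceZ (trace_spectral_component (eA l ls) pp) ratr_pchar0_natM//.
  by rewrite mulrA mulrC mulrA.
rewrite (eq_big_seq _ trE) => /fP; rewrite (bigD1_seq l0)//= => /eqP.
have ge0 l : 0 <= (\rank (pi l))%:R * f l * f l :> rat.
  by rewrite -mulrA mulr_ge0 ?ler0n// -expr2 sqr_ge0.
rewrite paddr_eq0 ?sumr_ge0// => /andP[+ _].
rewrite !mulf_eq0 (negPf f0) !orbF pnatr_eq0 mxrank_eq0.
by have [_ /negPf->] := eI l0 l0s.
Qed.

End Cartan.

Arguments lie {E n} A B.

(** * Engel's theorem *)

Section Engel.

Variables (E : closedFieldType) (n : nat).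
Implicit Types (T R : {vspace 'M[E]_n.+1}) (t b c x : 'M[E]_n.+1) (w : seq 'M[E]_n.+1).

(** The associative algebra without unit generated by [T] is nilpotent of exponent [m]. This form of
    simultaneous triangularity passes to [T + <[x]>] by counting letters. *)
Definition words_vanish T m :=
  forall w, size w = m -> {subset w <= T} -> \prod_(t <- w) t = 0.

Lemma lieC x b : lie x b = - lie b x.
Proof. by rewrite /lie opprB. Qed.

Lemma lieDZl a x y b : lie (x + a *: y) b = lie x b + a *: lie y b.
Proof. by rewrite /lie mulrDl mulrDr -scalerAl -scalerAr scalerBr opprD addrACA. Qed.

Lemma lieDZr a x y b : lie b (x + a *: y) = lie b x + a *: lie b y.
Proof. by rewrite lieC lieDZl !(lieC _ b) scalerN opprD !opprK. Qed.

Lemma liexx x : lie x x = 0.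
Proof. exact: subrr. Qed.

(** Iterated brackets expand into products w1 b w2 in which the letters of [w] are shared out
    between the two sides. *)
Lemma foldr_lie_words_vanish T N w b :
    (forall w1 w2, {subset w1 <= T} -> {subset w2 <= T} -> (N <= size w1 + size w2)%N ->
      \prod_(t <- w1) t * b * \prod_(t <- w2) t = 0) ->
  size w = N -> {subset w <= T} -> foldr lie b w = 0.
Proof.
elim: N w b => [|N IH] w b H.
  move=> /size0nil -> _; have := H [::] [::]; rewrite !big_nil mul1r mulr1; exact.
case/lastP: w => // w t; rewrite size_rcons => -[sw] wT; rewrite foldr_rcons.
have tT : t \in T by apply: wT; rewrite mem_rcons mem_head.
apply: IH => // [w1 w2 w1T w2T le|t' t'w]; last by apply: wT; rewrite mem_rcons inE t'w orbT.
rewrite /lie mulrBr mulrBl.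
have := H (rcons w1 t) w2; rewrite -cats1 big_cat big_seq1 /= !mulrA => ->//; first last.
- by rewrite size_cat /=; lia.
- by move=> y; rewrite mem_cat inE => /orP[/w1T//|/eqP->].
have := H w1 (t :: w2); rewrite big_cons !mulrA => ->//; first by rewrite subr0.
- by move=> y; rewrite inE => /orP[/eqP->//|/w2T].
- by rewrite /=; lia.
Qed.

Section OneStep.

Variables (T : {vspace 'M[E]_n.+1}) (x : 'M[E]_n.+1).
Hypothesis xT : forall t, t \in T -> lie t x \in T.

(** The columns of [c] lie in the j-th step of the filtration by kernels of words in [T]. Elements
    of [T] lower the step and [x] preserves it. *)
Let D j c := forall w, size w = j -> {subset w <= T} -> \prod_(t <- w) t * c = 0.

Let D_lin j a c d : D j c -> D j d -> D j (a *: c + d).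
Proof. by move=> Dc Dd w sw wT; rewrite mulrDr -scalerAr Dc// Dd// scaler0 addr0. Qed.

Let D_T j t c : t \in T -> D j.+1 c -> D j (t * c).
Proof.
move=> tT Dc w sw wT; have := Dc (rcons w t); rewrite -cats1 big_cat big_seq1 /= -mulrA; apply.
  by rewrite size_cat addn1 sw.
by move=> y; rewrite mem_cat inE => /orP[/wT//|/eqP->].
Qed.

Let DS j c : D j c -> D j.+1 c.
Proof.
move=> Dc [//|t w] [sw] wT; rewrite big_cons -mulrA Dc ?mulr0// => y yw.
by apply: wT; rewrite inE yw orbT.
Qed.

(** A letter t is moved past x by t x = x t + [t, x], where [t, x] is again in [T]. *)
Let D_x j c : D j c -> D j (x * c).
Proof.
elim: j c => [|j IH] c Dc w.
  by move=> /size0nil-> _; have := Dc [::] erefl; rewrite !big_nil !mul1r => ->; rewrite ?mulr0.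
case/lastP: w => // w t; rewrite size_rcons => -[sw] wT.
have tT : t \in T by apply: wT; rewrite mem_rcons mem_head.
have wT' : {subset w <= T} by move=> y yw; apply: wT; rewrite mem_rcons inE yw orbT.
rewrite -cats1 big_cat big_seq1 /= -mulrA (_ : t * (x * c) = x * (t * c) + lie t x * c).
  rewrite mulrDr (IH (t * c))//; last exact: D_T.
  have := D_T (xT tT) Dc; move=> /(_ w sw wT') ->; by rewrite addr0.
by rewrite /lie mulrBl !mulrA addrC subrK.
Qed.

(** Each letter is t + b x with t in [T] lowering the step; modulo step j only the pure power of x
    survives. *)
Let D_word j w c : {subset w <= (T + <[x]>)%VS} -> D j.+1 c ->
  exists a, D j (\prod_(t <- w) t * c - a *: (x ^+ size w * c)).
Proof.
move=> wT Dc; elim: w wT => [|s w IH] wT.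
  exists 1; rewrite big_nil !mul1r scale1r subrr => w _ _; exact: mulr0.
have [a Da] : exists a, D j (\prod_(t <- w) t * c - a *: (x ^+ size w * c)).
  by apply: IH => y yw; apply: wT; rewrite inE yw orbT.
have /memv_addP[t tT [_ /vlineP[b ->] sE]] := wT s (mem_head _ _).
have Dx k : D j.+1 (x ^+ k * c).
  by elim: k => [|k IHk]; rewrite ?expr0 ?mul1r// exprS -mulrA; apply: D_x.
exists (b * a); set X := x ^+ size w * c in Da *.
have [d dE Dd] : exists2 d, \prod_(t <- w) t * c = d + a *: X & D j d.
  by exists (\prod_(t <- w) t * c - a *: X); rewrite ?subrK.
rewrite big_cons -mulrA dE sE /= exprS -mulrA -/X.
rewrite (_ : _ - _ = a *: (t * X) + (1 *: (t * d) + (b *: (x * d) + 0))).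
  apply: D_lin; first by apply: D_T => //; apply: Dx.
  apply: D_lin; first by apply: D_T => //; apply: DS.
  apply: D_lin; first exact: D_x.
  by move=> w' _ _; rewrite mulr0.
rewrite scale1r addr0 mulrDl !mulrDr -!scalerAl -!scalerAr scalerA.
by rewrite !addrA addrK; congr (_ + _); rewrite addrC.
Qed.

(** A block of n+1 letters acts as a multiple of x^(n+1) = 0 modulo the next step, so it lowers the
    filtration by one; there are m steps. *)
Lemma words_vanish_add_line m : words_vanish T m -> x ^+ n.+1 = 0 ->
  words_vanish (T + <[x]>) (n.+1 * m).
Proof.
move=> Tm x0; suff H j c w : D j c -> size w = (n.+1 * j)%N ->
    {subset w <= (T + <[x]>)%VS} -> \prod_(t <- w) t * c = 0.
  move=> w sw wT; have := H m 1 w; rewrite !mulr1; apply => //.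
  by move=> w' sw' w'T; rewrite mulr1 Tm.
elim: j c w => [|j IH] c w Dc.
  rewrite muln0 => /size0nil-> _; have := Dc [::] erefl; rewrite !big_nil; exact.
rewrite mulnS addnC => sw wT.
rewrite -(cat_take_drop (n.+1 * j) w) big_cat /= -mulrA.
apply: IH; last by move=> y /mem_take/wT.
  have [y /mem_drop/wT//|a] := D_word (w := drop (n.+1 * j) w) _ Dc.
  by rewrite size_drop sw addKn x0 mul0r scaler0 subr0.
by rewrite size_take sw; case: ltnP => //; lia.
Qed.

End OneStep.

(** Take a subalgebra T of R with vanishing words and of maximal dimension. If T != R, repeated
    brackets with T send an element outside T to 0, so on the way there is an x outside T with
    [T, x] inside T; then T + <x> is a larger such subalgebra. *)
Lemma engel_words_vanish R : (forall a b, a \in R -> b \in R -> lie a b \in R) ->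
  (forall a, a \in R -> a ^+ n.+1 = 0) -> exists m, words_vanish R m.
Proof.
move=> RR Rnil.
pose Q d := `[< exists T, [/\ (T <= R)%VS, forall a b, a \in T -> b \in T -> lie a b \in T,
  exists m, words_vanish T m & \dim T = d] >].
have Q0 : exists d, Q d.
  exists 0%N; apply/asboolP; exists 0%VS; split; rewrite ?sub0v ?dimv0//.
    by move=> a b; rewrite !memv0 => /eqP-> /eqP->; rewrite /lie mulr0 subrr.
  exists 1%N => -[//|t [|//]] _ tT; rewrite big_seq1; apply/eqP.
  by rewrite -memv0; apply: tT; rewrite mem_head.
have Qle d : Q d -> (d <= \dim R)%N by move=> /asboolP[T [TR _ _ <-]]; apply: dimvS.
case: (ex_maxnP Q0 Qle) => d /asboolP[T [TR TT [m Tm] dT]] dmax.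
have [RT|/subvPn[x0 x0R x0T]] := boolP (R <= T)%VS.
  by exists m => w sw wR; apply: Tm => // t /wR; exact: (subvP RT).
exfalso.
have [x [xR xT xTT]] : exists x, [/\ x \in R, x \notin T & forall t, t \in T -> lie t x \in T].
  apply: contrapT => no.
  have H x : x \in R -> x \notin T -> exists2 t, t \in T & lie t x \notin T.
    move=> xR xT; apply: contrapT => no2; apply: no; exists x; split => // t tT.
    by apply/contraT => lT; case: no2; exists t.
  have W k : exists w, [/\ size w = k, {subset w <= T}, foldr lie x0 w \in R & foldr lie x0 w \notin T].
    elim: k => [|k [w [sw wT wR wnT]]]; first by exists [::].
    have [t tT tw] := H _ wR wnT; exists (t :: w); split => //=; first by rewrite sw.
      by move=> y; rewrite inE => /orP[/eqP->//|/wT].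
    by apply: RR => //; exact: (subvP TR).
  (* Length 2m: in every product w1 x0 w2 of the expansion one side has at least [m] letters. *)
  have [w [sw wT _]] := W (m + m)%N.
  rewrite (foldr_lie_words_vanish (T := T) _ sw wT) ?mem0v// => w1 w2 w1T w2T le.
  have vanish w' : {subset w' <= T} -> (m <= size w')%N -> \prod_(t <- w') t = 0.
    move=> w'T mw; rewrite -(cat_take_drop m w') big_cat /= Tm ?mul0r//.
      by rewrite size_take; case: ltnP => //; lia.
    by move=> y /mem_take/w'T.
  have [le1|le2] : (m <= size w1 \/ m <= size w2)%N by lia.
    by rewrite vanish// !mul0r.
  by rewrite (vanish w2)// mulr0.
have : Q (\dim (T + <[x]>)%VS).
  apply/asboolP; exists (T + <[x]>)%VS; split => //.
  - by rewrite subv_add TR -memvE.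
  - move=> _ _ /memv_addP[t tT [_ /vlineP[a ->] ->]] /memv_addP[s sT [_ /vlineP[b ->] ->]].
    have -> : lie (t + a *: x) (s + b *: x) = lie t s + b *: lie t x - a *: lie s x.
      by rewrite lieDZl !lieDZr liexx scaler0 addr0 [lie x s]lieC scalerN.
    apply: (subvP (addvSl _ _)); apply: rpredB; last by apply: rpredZ; exact: xTT.
    by apply: rpredD; [exact: TT|apply: rpredZ; exact: xTT].
  - by exists (n.+1 * m)%N; apply: words_vanish_add_line => //; apply: Rnil.
move=> /dmax; rewrite -dT leqNgt => /negP; apply.
rewrite (ltn_leqif (dimv_leqif_sup (addvSl T <[x]>))).
by rewrite subv_add subvv -memvE.
Qed.

(** Any nonzero column of a nonzero word of maximal length is killed by all of [R]. *)
Lemma engel_kernel R : (forall a b, a \in R -> b \in R -> lie a b \in R) ->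
    (forall a, a \in R -> a ^+ n.+1 = 0) ->
  exists2 v : 'cV[E]_n.+1, v != 0 & forall t, t \in R -> t *m v = 0.
Proof.
move=> RR Rnil; have [m0 Rm0] := engel_words_vanish RR Rnil.
have ex : exists m, `[< words_vanish R m >] by exists m0; apply/asboolP.
case: (ex_minnP ex) => -[|m] /asboolP Rm mmin.
  have /eqP := Rm [::] erefl (fun y => ltac:(by [])); by rewrite big_nil oner_eq0.
have : ~ words_vanish R m by move=> /asboolP/mmin; rewrite ltnn.
move=> /existsNP[w /not_implyP[sw /not_implyP[wR p0]]].
have [j pj] : exists j, col j (\prod_(t <- w) t) != 0.
  apply: contrapT => /forallNP H; apply: p0; apply/matrixP => i j.
  have /negP := H j; rewrite negbK => /eqP/matrixP/(_ i 0); by rewrite !mxE.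
exists (col j (\prod_(t <- w) t)) => // t tR.
rewrite colE mulmxA (_ : t *m _ = 0) ?mul0mx//.
have := Rm (t :: w); rewrite big_cons; apply; first by rewrite /= sw.
by move=> y; rewrite inE => /orP[/eqP->//|/wR].
Qed.

End Engel.

(** * The trace form on a Lie algebra stable under an irreducible group *)

Section TraceForm.

Variables (E : closedFieldType) (E0 : [pchar E] =i pred0) (n : nat).
Implicit Types (t b c x y : 'M[E]_n.+1).

(** Invariant subspaces are predicates on columns, so that kernels and eigenspaces can be plugged in
    directly. *)
Definition irreducible_set (G : set 'M[E]_n.+1) :=
  forall P : 'cV[E]_n.+1 -> Prop, P 0 -> (forall a u v, P u -> P v -> P (a *: u + v)) ->
    (forall g v, G g -> P v -> P (g *m v)) -> (exists2 v, v != 0 & P v) -> forall v, P v.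

Variable G : set 'M[E]_n.+1.
Hypotheses (G_group : matrix_subgroup G) (G_irr : irreducible_set G).

Definition conj_stable (R : {vspace 'M[E]_n.+1}) :=
  forall g t, G g -> t \in R -> g * t * g^-1 \in R.

Let Gunit g : G g -> g \is a GRing.unit.
Proof. by case: G_group => H _ _ _ /H. Qed.

Let GV g : G g -> G g^-1.
Proof. by case: G_group => _ _ _; apply. Qed.

Lemma lie_conj g x y : G g -> g * lie x y * g^-1 = lie (g * x * g^-1) (g * y * g^-1).
Proof.
move=> /Gunit gU; have K (z w : 'M[E]_n.+1) : g * z * g^-1 * (g * w * g^-1) = g * (z * w) * g^-1.
  by rewrite !mulrA divrK.
by rewrite /lie !K mulrBr mulrBl.
Qed.

(** The common kernel of [R] is nonzero by Engel and stable under [G], hence is the whole space. *)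
Lemma nilpotent_conj_stable_eq0 (R : {vspace 'M[E]_n.+1}) : (forall a b, a \in R -> b \in R -> lie a b \in R) ->
  (forall a, a \in R -> a ^+ n.+1 = 0) -> conj_stable R -> forall t, t \in R -> t = 0.
Proof.
move=> RR Rnil GR t tR; have [v v0 Rv] := engel_kernel RR Rnil.
have H : forall u : 'cV[E]_n.+1, forall t, t \in R -> t *m u = 0.
  apply: (G_irr (P := fun u => forall t, t \in R -> t *m u = 0)).
  - by move=> ? _; rewrite mulmx0.
  - by move=> a u w Pu Pw s sR; rewrite mulmxDr -scalemxAr Pu// Pw// scaler0 addr0.
  - move=> g u Gg Pu s sR.
    have -> : s *m (g *m u) = g *m ((g^-1 * s * g^-1^-1) *m u).
      have e : g * (g^-1 * s * g) = s * g by rewrite -mulrA mulVKr// Gunit.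
      by rewrite invrK mulmxA (_ : s *m g = g *m (g^-1 * s * g)) -?mulmxA//; exact: (esym e).
    by rewrite Pu ?mulmx0//; apply: GR => //; exact: GV.
  - by exists v.
apply/matrixP => i j; have /matrixP/(_ i 0) := H (delta_mx j 0) t tR.
by rewrite -colE !mxE.
Qed.

Variable L : {vspace 'M[E]_n.+1}.
Hypothesis L_nil : exists2 X, L = <<X>>%VS & forall t, t \in X -> t ^+ n.+1 = 0.
Hypothesis L_lie : forall a b, a \in L -> b \in L -> lie a b \in L.
Hypothesis L_conj : conj_stable L.

Let trlie x y z : \tr (lie x y * z) = \tr (x * lie y z).
Proof.
rewrite /lie mulrBl mulrBr !raddfB /= !mulrA; congr (_ - _).
by rewrite -[y * x * z]mulrA; apply: mxtrace_mulC.
Qed.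

Let lie0 x y : x * y = y * x -> lie x y = 0.
Proof. by rewrite /lie => ->; rewrite subrr. Qed.

Lemma trace_span (X : seq 'M[E]_n.+1) y : (forall x, x \in X -> \tr (x * y) = 0) ->
  forall x, x \in <<X>>%VS -> \tr (x * y) = 0.
Proof.
move=> H x /(@coord_span _ _ _ (in_tuple X)) ->.
rewrite mulr_suml raddf_sum big1// => i _ /=.
by rewrite -scalerAl mxtraceZ H ?mulr0// mem_nth.
Qed.

(** Let R be the radical. The span of [R, R] is nilpotent by Cartan's criterion, so [R, R] = 0. As R
    is now commutative, tr ([a, b] u^k) = tr (a [b, u^k]) = 0 for u in the span of [L, R], so [L, R]
    = 0. Finally R commutes with the nilpotent generators of L, whence all tr u^k with k > 0 vanish
    on R. Each time [nilpotent_conj_stable_eq0] turns nilpotency into vanishing. *)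
Theorem trace_form_nondegenerate y : y \in L -> (forall z, z \in L -> \tr (y * z) = 0) -> y = 0.
Proof.
have [X LX Xnil] := L_nil.
have [|| R RP] := @vspace_of_prop _ _ (fun y => y \in L /\ forall z, z \in L -> \tr (y * z) = 0).
- by split; rewrite ?mem0v// => z _; rewrite mul0r mxtrace0.
- move=> a u v [uL u0] [vL v0]; split; first by rewrite rpredD ?rpredZ.
  by move=> z zL; rewrite mulrDl -scalerAl raddfD /= mxtraceZ u0// v0// mulr0 addr0.
move=> yL y0; have {yL y0} yR : y \in R by apply/RP.
have RL : forall t, t \in R -> t \in L by move=> t /RP[].
have LR a b : a \in L -> b \in R -> lie b a \in R.
  move=> aL bR; apply/RP; split; first by apply: L_lie => //; exact: RL.
  by move=> z zL; rewrite trlie; move/RP: bR => [_]; apply; apply: L_lie.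
have LR' a b : a \in L -> b \in R -> lie a b \in R by move=> aL bR; rewrite lieC rpredN LR.
have GR : conj_stable R.
  move=> g t Gg /RP[tL t0]; apply/RP; split; first exact: L_conj.
  move=> z zL; rewrite -!mulrA (_ : \tr (g * _) = \tr (t * (g^-1 * z * g))); last first.
    by rewrite (mxtrace_mulC g) mulmxE !mulrA.
  rewrite t0//.
  by rewrite -{2}[g]invrK; apply: L_conj => //; exact: GV.
have stab (Z : seq 'M[E]_n.+1) : (forall g z, G g -> z \in Z -> g * z * g^-1 \in <<Z>>%VS) ->
    conj_stable <<Z>>%VS.
  move=> H g t Gg /(@coord_span _ _ _ (in_tuple Z)) ->.
  rewrite mulr_sumr mulr_suml rpred_sum// => i _.
  by rewrite -scalerAr -scalerAl rpredZ// H// mem_nth.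
have R_comm a b : a \in R -> b \in R -> lie a b = 0.
  move=> aR bR.
  have [Z [ZP PZ]] := span_of_prop (fun t => exists a b, [/\ a \in R, b \in R & t = lie a b]).
  have ZR t : t \in <<Z>>%VS -> t \in R.
    by apply: (subvP _ t); apply/span_subvP => z /ZP[u [v [uR vR ->]]]; apply: LR; rewrite ?RL.
  apply: (@nilpotent_conj_stable_eq0 <<Z>>%VS).
  - by move=> u v /ZR uR /ZR vR; apply: PZ; exists u, v.
  - move=> u uZ; apply: (cartan_nilpotent E0 (R := R)).
      by move=> v vR; apply: LR => //; [apply: RL|apply: ZR].
    move=> w wR; move: u uZ; apply: trace_span => u /ZP[u1 [u2 [u1R u2R ->]]].
    rewrite trlie lieC mulrN raddfN /=; move/RP: u1R => [_ ->]; first by rewrite oppr0.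
    by apply: RL; apply: wR.
  - apply: stab => g z Gg /ZP[u [v [uR vR ->]]]; rewrite lie_conj//.
    by apply: PZ; exists (g * u * g^-1), (g * v * g^-1); split; rewrite ?GR.
  - by apply: PZ; exists a, b.
have LR0 a b : a \in L -> b \in R -> lie a b = 0.
  move=> aL bR.
  have [Z [ZP PZ]] := span_of_prop (fun t => exists a b, [/\ a \in L, b \in R & t = lie a b]).
  have ZR t : t \in <<Z>>%VS -> t \in R.
    by apply: (subvP _ t); apply/span_subvP => z /ZP[u [v [uR vR ->]]]; apply: LR'.
  apply: (@nilpotent_conj_stable_eq0 <<Z>>%VS).
  - by move=> u v /ZR uR /ZR vR; rewrite R_comm ?mem0v.
  - move=> u uZ; apply: trace_nilpotent => // k; rewrite exprS.
    have uR := ZR u uZ.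
    move: {1 2}u uZ; apply: trace_span => _ /ZP[u1 [u2 [u1L u2R ->]]].
    rewrite trlie (lie0 (y := u ^+ k)) ?mulr0 ?mxtrace0//.
    apply: commrX; apply/eqP; rewrite -subr_eq0; apply/eqP; exact: R_comm.
  - apply: stab => g z Gg /ZP[u [v [uR vR ->]]]; rewrite lie_conj//.
    by apply: PZ; exists (g * u * g^-1), (g * v * g^-1); split; rewrite ?GR ?L_conj.
  - by apply: PZ; exists a, b.
apply: (nilpotent_conj_stable_eq0 (R := R)) => //.
- by move=> a b aR bR; rewrite R_comm ?mem0v.
- move=> u uR; apply: trace_nilpotent => // k; rewrite exprS.
  have uL := RL u uR; rewrite LX in uL; move: {1 2}u uL; apply: trace_span => z zX.
  have zL : z \in L by rewrite LX memv_span.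
  apply: (@mxtrace_nilpotent _ _ _ n.+1); rewrite exprMn_comm ?(Xnil z) ?mul0r//.
  apply: commrX; apply/eqP; rewrite -subr_eq0; apply/eqP; exact: LR0.
Qed.

End TraceForm.

(** * Unipotent one-parameter curves and the logarithm *)

Section PolynomialCurves.

Variables (E : closedFieldType) (E0 : [pchar E] =i pred0) (n : nat).
Implicit Types (C : 'M[{poly E}]_n.+1) (s : E) (u t x y : 'M[E]_n.+1).

Definition evmx s C : 'M[E]_n.+1 := map_mx (horner_eval s) C.
Definition cstmx u : 'M[{poly E}]_n.+1 := map_mx polyC u.
Definition dermx C : 'M[{poly E}]_n.+1 := map_mx (@deriv E) C.

Lemma evmxM s C C' : evmx s (C * C') = evmx s C * evmx s C'.
Proof. exact: map_mxM. Qed.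

Lemma evmx_cst s u : evmx s (cstmx u) = u.
Proof. by apply/matrixP => i j; rewrite !mxE /= /horner_eval hornerC. Qed.

Lemma dermxM C C' : dermx (C * C') = dermx C * C' + C * dermx C'.
Proof.
apply/matrixP => i j; rewrite !mxE raddf_sum -big_split; apply: eq_bigr => k _ /=.
by rewrite derivM !mxE.
Qed.

Lemma dermx_cst u : dermx (cstmx u) = 0.
Proof. by apply/matrixP => i j; rewrite !mxE derivC. Qed.

(** In characteristic 0 the naturals are infinitely many points; they are the parameters at which
    the curves are known to lie in a group or a subspace. *)
Lemma poly_eq0_nat (p : {poly E}) : (forall j : nat, p.[j%:R] = 0) -> p = 0.
Proof.
move=> p0; apply: (@roots_geq_poly_eq0 _ p [seq j%:R | j <- iota 0 (size p)]).
- by apply/allP => _ /mapP[j _ ->]; apply/rootP.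
- rewrite map_inj_in_uniq ?iota_uniq// => i j _ _ /eqP; rewrite -subr_eq0.
  wlog ij : i j / (i <= j)%N => [H|].
    by case: (leqP i j) => [/H//|/ltnW/H {}H]; rewrite -oppr_eq0 opprB => /H.
  by rewrite -oppr_eq0 opprB -natrB// natr_pchar0// subn_eq0 => ji; apply/eqP; rewrite eqn_leq ij.
- by rewrite size_map size_iota.
Qed.

Lemma mx_eq_nat C C' : (forall j : nat, evmx j%:R C = evmx j%:R C') -> C = C'.
Proof.
move=> CC; apply/matrixP => i j; apply/eqP; rewrite -subr_eq0; apply/eqP.
apply: poly_eq0_nat => k; have /matrixP/(_ i j) := CC k.
by rewrite !mxE /horner_eval hornerD hornerN => ->; rewrite subrr.
Qed.

(** A linear form vanishing on [L] pulls back along the curve to a polynomial having all naturals as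
    roots. *)
Lemma vspace_derivative (L : {vspace 'M[E]_n.+1}) C :
  (forall j : nat, evmx j%:R C \in L) -> evmx 0 (dermx C) \in L.
Proof.
move=> CL; apply: contraT => /separating_form[f [f0 f1]].
pose p : {poly E} := \sum_i \sum_j (f (delta_mx i j) : E) *: C i j.
have fE (t : 'M[E]_n.+1) : f t = \sum_i \sum_j (f (delta_mx i j) : E) * t i j.
  rewrite {1}[t]matrix_sum_delta linear_sum; apply: eq_bigr => i _.
  by rewrite linear_sum; apply: eq_bigr => j _; rewrite linearZ /= mulrC.
have p0 : p = 0.
  apply: poly_eq0_nat => j; rewrite -[RHS](f0 _ (CL j)) fE horner_sum.
  apply: eq_bigr => i _; rewrite horner_sum; apply: eq_bigr => k _.
  by rewrite hornerZ mxE.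
have : p^`().[0] = 1.
  rewrite -f1 fE raddf_sum horner_sum; apply: eq_bigr => i _.
  rewrite raddf_sum horner_sum; apply: eq_bigr => k _ /=.
  by rewrite derivZ hornerZ !mxE.
by rewrite p0 derivC horner0 => /esym/eqP; rewrite oner_eq0.
Qed.

(** The binomial coefficient of [X] over [i], as a polynomial. *)
Let binp i : {poly E} := (i`!%:R)^-1 *: \prod_(m < i) ('X - m%:R%:P).

Let binpE i (j : nat) : (binp i).[j%:R] = 'C(j, i)%:R.
Proof.
have fi : i`!%:R != 0 :> E by rewrite natr_pchar0// -lt0n fact_gt0.
apply: (mulfI fi); rewrite hornerZ mulVKf// -natrM mulnC bin_ffact horner_prod.
elim: i {fi} => [|i IH]; first by rewrite big_ord0 ffactn0.
rewrite big_ord_recr /= IH hornerXsubC ffactnSr natrM.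
case: (leqP i j) => ij; first by rewrite natrB.
by rewrite ffact_small// !mul0r.
Qed.

(** The curve is u^s = sum_i binomial(s, i) (u - 1)^i, a finite sum because u - 1 is nilpotent; its
    velocity at 0 is log u. The differential equation is u^(j+h) = u^j u^h differentiated in h at
    0. *)
Lemma unipotent_curve u : (u - 1) ^+ n.+1 = 0 -> exists C,
  [/\ forall j : nat, evmx j%:R C = u ^+ j,
      dermx C = C * cstmx (evmx 0 (dermx C)) & evmx 0 (dermx C) ^+ n.+1 = 0].
Proof.
set v := u - 1 => v0.
pose C : 'M[{poly E}]_n.+1 := \sum_(i < n.+1) binp i *: cstmx (v ^+ i).
have evE s (F : nat -> {poly E}) : evmx s (\sum_(i < n.+1) F i *: cstmx (v ^+ i)) =
    \sum_(i < n.+1) (F i).[s] *: v ^+ i.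
  apply/matrixP => a b; rewrite mxE !summxE /horner_eval horner_sum.
  by apply: eq_bigr => i _; rewrite !mxE hornerM hornerC.
have evC j : evmx j%:R C = u ^+ j.
  rewrite evE -(subrK 1 u) -/v exprD1n.
  (* Both truncations agree with the sum up to j + n: terms beyond n vanish by nilpotency, those
     beyond j by the binomial coefficient. *)
  transitivity (\sum_(0 <= i < (j + n).+1) v ^+ i *+ 'C(j, i)).
    rewrite (@big_cat_nat _ _ _ n.+1)//=; last by lia.
    rewrite [X in _ + X]big_nat_cond [X in _ + X]big1 => [|i /andP[/andP[ni _] _]]; last first.
      by rewrite -(subnK ni) exprD v0 mulr0 mul0rn.
    by rewrite addr0 big_mkord; apply: eq_bigr => i _; rewrite binpE scaler_nat.
  rewrite (@big_cat_nat _ _ _ j.+1)//=; last by lia.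
  rewrite [X in _ + X]big_nat_cond [X in _ + X]big1 => [|i /andP[/andP[ni _] _]]; last first.
    by rewrite bin_small.
  by rewrite addr0 big_mkord.
have derC : dermx C = \sum_(i < n.+1) (binp i)^`() *: cstmx (v ^+ i).
  apply/matrixP => a b; rewrite mxE !summxE raddf_sum.
  by apply: eq_bigr => i _; rewrite !mxE /= derivM derivC mulr0 addr0.
exists C; split => //.
  apply: mx_eq_nat => j; rewrite evmxM evmx_cst evC.
  pose sh (p : {poly E}) := p \Po ('X + j%:R%:P).
  have e : map_mx sh C = cstmx (u ^+ j) * C.
    apply: mx_eq_nat => h; rewrite evmxM evmx_cst evC -exprD addnC -evC.
    apply/matrixP => a b; rewrite !mxE /horner_eval /sh horner_comp.
    by rewrite hornerD hornerX hornerC natrD.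
  have := congr1 (fun D => evmx 0 (dermx D)) e.
  rewrite dermxM dermx_cst mul0r add0r evmxM evmx_cst => <-.
  apply/matrixP => a b; rewrite !mxE /horner_eval /sh deriv_comp.
  by rewrite derivD derivX derivC addr0 mulr1 horner_comp hornerD hornerX hornerC add0r.
rewrite derC (evE 0 (fun i => (binp i)^`())); pose q : {poly E} := \sum_(i < n.+1) (binp i)^`().[0] *: 'X^i.
have -> : \sum_(i < n.+1) (binp i)^`().[0] *: v ^+ i = horner_mx v q.
  rewrite /q raddf_sum; apply: eq_bigr => i _ /=.
  by rewrite -mul_polyC rmorphM /= horner_mx_C rmorphXn /= horner_mx_X -mulmxE mul_scalar_mx.
(* The term i = 0 of the curve is constant, so the velocity is a multiple of [v], hence
   nilpotent. *)
have /dvdpP[q' ->] : 'X %| q.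
  rewrite -['X]subr0 -[0]/(0%:P) dvdp_XsubCl /root /q horner_sum big_ord_recl big1 => [|i _].
    have -> : binp (ord0 : 'I_n.+1) = 1%:P by rewrite /binp big_ord0 fact0 invr1 scale1r.
    by rewrite addr0 derivC horner0 scale0r horner0.
  by rewrite hornerZ hornerXn expr0n mulr0.
rewrite -rmorphXn exprMn rmorphM rmorphXn /= (rmorphXn (horner_mx v)) /= horner_mx_X.
by rewrite v0 mulr0.
Qed.

End PolynomialCurves.

Section LogInDifferences.

Variables (E : closedFieldType) (E0 : [pchar E] =i pred0) (n : nat).
Variable G : set 'M[E]_n.+1.
Hypotheses (G_group : matrix_subgroup G) (G_irr : irreducible_set G).
Variables (u : 'M[E]_n.+1) (C Ci : 'M[{poly E}]_n.+1).
Hypotheses (Gu : G u) (uC : forall j : nat, evmx j%:R C = u ^+ j)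
  (uCi : forall j : nat, evmx j%:R Ci = u^-1 ^+ j).

Local Notation N := (evmx 0 (dermx C)).
Hypothesis N_nil : N ^+ n.+1 = 0.

Let Gunit g : G g -> g \is a GRing.unit.
Proof. by case: G_group => H _ _ _ /H. Qed.

Let GV g : G g -> G g^-1.
Proof. by case: G_group => _ _ _; apply. Qed.

Let GM g h : G g -> G h -> G (g * h).
Proof. by case: G_group => _ _ H _; apply: H. Qed.

Let G1 : G 1.
Proof. by case: G_group. Qed.

Lemma inverse_curve_derivative : evmx 0 (dermx Ci) = - N.
Proof.
have CCi : C * Ci = cstmx 1.
  apply: mx_eq_nat => // j; rewrite evmxM evmx_cst uC uCi exprVn divrr//.
  by apply: unitrX; exact: Gunit.
have := congr1 (fun D => evmx 0 (dermx D)) CCi.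
rewrite dermx_cst dermxM (_ : evmx 0 (_ + _) = evmx 0 (dermx C * Ci) + evmx 0 (C * dermx Ci)); last first.
  by apply/matrixP => i j; rewrite !mxE /horner_eval hornerD.
rewrite !evmxM (uCi 0) (uC 0) !expr0 mulr1 mul1r.
have -> : evmx 0 (0 : 'M[{poly E}]_n.+1) = 0.
  by apply/matrixP => i j; rewrite !mxE /horner_eval horner0.
by rewrite addrC => /eqP; rewrite addr_eq0 => /eqP.
Qed.

Let conjX (g t : 'M[E]_n.+1) k : g \is a GRing.unit -> (g * t * g^-1) ^+ k = g * t ^+ k * g^-1.
Proof.
move=> gU; elim: k => [|k IH]; first by rewrite !expr0 mulr1 divrr.
by rewrite !exprS IH !mulrA divrK.
Qed.

(** Otherwise some form f is 1 at N and 0 on M, hence 1 on all conjugates of N. On their span L the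
    trace form is nondegenerate, so f(y) = tr (z y) for some z in L; invariance of f makes z commute
    with G, Schur's lemma makes it scalar, and then f(N) = tr (z N) = 0 because N is nilpotent. *)
Lemma log_in_differences (M : {vspace 'M[E]_n.+1}) :
  (forall x, G x -> x * N * x^-1 - N \in M) -> N \in M.
Proof.
move=> GM'; apply: contraT => /separating_form[f [f0 f1]].
have fconj x : G x -> f (x * N * x^-1) = 1.
  by move=> /GM'/f0; rewrite raddfB /= f1 => /eqP; rewrite subr_eq0 => /eqP.
have [Y [YP PY]] := span_of_prop (fun t => exists2 x, G x & t = x * N * x^-1).
pose L := <<Y>>%VS.
have L_conj : conj_stable G L.
  move=> g t Gg /(@coord_span _ _ _ (in_tuple Y)) ->.
  rewrite mulr_sumr mulr_suml rpred_sum// => i _.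
  rewrite -scalerAr -scalerAl rpredZ// PY//.
  have /YP[x Gx ->] : Y`_i \in Y by apply: mem_nth.
  by exists (g * x); [exact: GM|rewrite invrM ?Gunit// !mulrA].
(* ad N is the velocity at 0 of the conjugations y |-> u^j y u^-j, which preserve [L]. The other
   generators of [L] follow by conjugation. *)
have NL y : y \in L -> lie N y \in L.
  move=> yL; have -> : lie N y = evmx 0 (dermx (C * cstmx y * Ci)).
    rewrite !dermxM dermx_cst mulr0 addr0.
    rewrite (_ : evmx 0 (_ + _) = evmx 0 (dermx C * cstmx y * Ci) + evmx 0 (C * cstmx y * dermx Ci)); last first.
      by apply/matrixP => i j; rewrite !mxE /horner_eval hornerD.
    rewrite !evmxM evmx_cst (uC 0) (uCi 0) !expr0 mulr1 mul1r inverse_curve_derivative.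
    by rewrite mulrN.
  apply: vspace_derivative => // j; rewrite !evmxM evmx_cst uC uCi exprVn.
  apply: L_conj => //; elim: (j) => [|k IH]; first by rewrite expr0.
  by rewrite exprS; apply: GM.
have L_lie a b : a \in L -> b \in L -> lie a b \in L.
  move=> + bL; move=> /(@coord_span _ _ _ (in_tuple Y)) ->.
  rewrite /lie mulr_suml mulr_sumr -sumrB rpred_sum// => i _.
  rewrite -scalerAr -scalerAl -scalerBr rpredZ// -/(lie _ _).
  have /YP[x Gx ->] : Y`_i \in Y by apply: mem_nth.
  have xU := Gunit Gx.
  have -> : b = x * (x^-1 * b * x^-1^-1) * x^-1.
    by rewrite invrK -!mulrA divrr// mulr1 mulVKr.
  by rewrite -(lie_conj G_group _ _ Gx); apply: (L_conj) => //; apply: NL; apply: (L_conj) => //; apply: GV.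
have L_nil : exists2 X, L = <<X>>%VS & forall t, t \in X -> t ^+ n.+1 = 0.
  exists Y => // t /YP[x Gx ->]; rewrite conjX ?Gunit// N_nil mulr0 mul0r//.
have nondeg := trace_form_nondegenerate E0 G_group G_irr L_nil L_lie L_conj.
pose b := vbasis L; pose d := \dim L.
have bL i : i \in 'I_d -> b`_i \in L by move=> _; apply: vbasis_mem; apply: mem_nth; rewrite size_tuple.
pose Gm : 'M[E]_d := \matrix_(i, j) \tr (b`_i * b`_j).
have trb (z : 'M[E]_n.+1) (g : 'M[E]_n.+1 -> E) : (forall a s t, g (a *: s + t) = a * g s + g t) ->
    (forall j : 'I_d, \tr (z * b`_j) = g b`_j) -> forall y, y \in L -> \tr (z * y) = g y.
  move=> glin H y /coord_vbasis ->.
  have gsum (F : 'I_d -> 'M[E]_n.+1) (cc : 'I_d -> E) :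
      g (\sum_i cc i *: F i) = \sum_i cc i * g (F i).
    have g0 : g 0 = 0.
      have /eqP := glin 1 0 0; rewrite scale1r addr0 mul1r -{1}[g 0]addr0.
      by rewrite (inj_eq (addrI _)) eq_sym => /eqP.
    by elim/big_rec2: _ => // i s t _ <-; rewrite glin.
  rewrite gsum mulr_sumr raddf_sum; apply: eq_bigr => i _ /=.
  by rewrite -scalerAr mxtraceZ H.
(* Nondegeneracy of the trace form is invertibility of its Gram matrix, from which a representative
   z of [f] is computed. *)
have GmU : Gm \in unitmx.
  rewrite -row_free_unit -kermx_eq0; apply/eqP/row_matrixP => i; rewrite row0.
  set r := row i _; have rG : r *m Gm = 0 by rewrite /r -row_mul mulmx_ker row0.
  pose z := \sum_j r 0 j *: b`_j.
  have z0 : z = 0.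
    apply: nondeg; first by rewrite rpred_sum// => j _; rewrite rpredZ ?bL.
    apply: (trb z (fun=> 0)) => [*|j]; first by rewrite mulr0 addr0.
    rewrite /z mulr_suml raddf_sum /=; have /matrixP/(_ 0 j) := rG.
    rewrite [RHS]mxE => H; rewrite -[RHS]H mxE; apply: eq_bigr => k _; by rewrite /= -scalerAl mxtraceZ [Gm _ _]mxE.
  apply/rowP => j; have := @freeP _ _ d b; move=> /elimT/(_ (basis_free (vbasisP L))).
  by move=> /(_ (r 0)) /(_ z0) /(_ j) ->; rewrite mxE.
pose r := (\row_j (f b`_j : E)) *m invmx Gm.
pose z := \sum_j r 0 j *: b`_j.
have zL : z \in L by rewrite rpred_sum// => j _; rewrite rpredZ ?bL.
have zf y : y \in L -> \tr (z * y) = f y.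
  apply: (trb z (fun y => f y : E)) => [a s t|j]; first by rewrite raddfD /= linearZ.
  have /matrixP/(_ 0 j) : r *m Gm = \row_j (f b`_j : E) by rewrite mulmxKV.
  rewrite [RHS]mxE => H; rewrite -[RHS]H mxE /z mulr_suml raddf_sum; apply: eq_bigr => k _ /=.
  by rewrite -scalerAl mxtraceZ [Gm _ _]mxE.
have NinL : N \in L by apply: PY; exists 1; rewrite ?mul1r ?invr1 ?mulr1.
(* z and x z x^-1 both have trace pairing 1 with every generator of [L]. *)
have zG x : G x -> x * z = z * x.
  move=> Gx; have xU := Gunit Gx.
  suff : x * z * x^-1 - z = 0 by move=> /eqP; rewrite subr_eq0 => /eqP H; rewrite -[in RHS]H divrK.
  apply: nondeg; first by rewrite rpredB// L_conj.
  suff H y : y \in Y -> \tr ((x * z * x^-1 - z) * y) = 0.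
    move=> y yL; rewrite -mulmxE mxtrace_mulC; move: y yL; apply: trace_span => y yY.
    by rewrite -mulmxE mxtrace_mulC H.
  move=> /YP[g Gg ->]; rewrite mulrBl raddfB /= zf; last by apply: PY; exists g.
  rewrite fconj// -!mulrA -mulmxE mxtrace_mulC mulmxE.
  have -> : z * (x^-1 * (g * (N * g^-1))) * x = z * ((x^-1 * g) * N * (x^-1 * g)^-1).
    by rewrite (invrM _ (Gunit Gg)) ?unitrV// invrK !mulrA.
  have Gxg : G (x^-1 * g) by apply: GM => //; exact: GV.
  rewrite zf ?fconj ?subrr//; by apply: PY; exists (x^-1 * g).
have [l lz] : exists l, eigenvalue z^T l.
  have /closed_rootP[l lr] : size (char_poly z^T) != 1%N by rewrite size_char_poly.
  by exists l; rewrite eigenvalue_root_char.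
have /eigenvalueP[v0 v0z v00] := lz.
have zl : forall v : 'cV[E]_n.+1, z *m v = l *: v.
  apply: (G_irr (P := fun v => z *m v = l *: v)).
  - by rewrite mulmx0 scaler0.
  - by move=> a s t Ps Pt; rewrite mulmxDr -scalemxAr Ps Pt scalerDr !scalerA mulrC.
  - by move=> g v Gg Pv; rewrite mulmxA -[z *m g]/(z * g) -zG// -mulmxE -mulmxA Pv -scalemxAr.
  - exists v0^T; first by rewrite trmx_eq0.
    by have := congr1 trmx v0z; rewrite trmx_mul trmxK linearZ.
have := zf N NinL; rewrite f1 (_ : z = l%:M); last first.
  apply/matrixP => i j; have /matrixP/(_ i 0) := zl (delta_mx j 0).
  by rewrite -colE !mxE => ->; rewrite eqxx andbT mulr_natr.
rewrite -mulmxE mul_scalar_mx mxtraceZ (mxtrace_nilpotent N_nil) mulr0 => /esym/eqP.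
by rewrite oner_eq0.
Qed.

End LogInDifferences.

Lemma mpoly_ring_ind (R : comNzRingType) m (P : {mpoly R[m]} -> Prop) :
    (forall c, P c%:MP) -> (forall i, P 'X_i) -> (forall p q, P p -> P q -> P (p + q)) ->
  (forall p q, P p -> P q -> P (p * q)) -> forall p, P p.
Proof.
move=> PC PX PD PM; elim/mpolyind => [|c k p _ _ Pp]; first exact: (PC 0).
apply: PD => //; rewrite -mul_mpolyC; apply: (PM) => //; rewrite mpolyXE_id.
have P1 : P 1 by exact: (PC 1).
by apply: (big_ind P P1 PM) => i _; elim: (k i) => [|j IH]; rewrite ?expr0// exprS; apply: PM.
Qed.

Section CurveEvaluation.

Variables (E : closedFieldType) (E0 : [pchar E] =i pred0) (n : nat).
Implicit Types (C : 'M[{poly E}]_n.+1) (F : {mpoly E[n.+1 * n.+1]}).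

Definition curve_eval C F : {poly E} := mmap (@polyC E) (fun i => mxvec C 0 i) F.

Lemma mxvec_map (R S : Type) (f : R -> S) m1 m2 (A : 'M[R]_(m1, m2)) i :
  mxvec (map_mx f A) 0 i = f (mxvec A 0 i).
Proof. by case/mxvec_indexP: i => a b; rewrite !mxvecE mxE. Qed.

Lemma horner_curve_eval C F s : (curve_eval C F).[s] = F.@[fun i => mxvec (evmx s C) 0 i].
Proof.
rewrite /curve_eval; elim/mpoly_ring_ind: F => [c|i|p q Hp Hq|p q Hp Hq].
- by rewrite mmapC hornerC mevalC.
- by rewrite mmapX mmap1U mevalXU mxvec_map.
- by rewrite mmapD mevalD hornerD Hp Hq.
- by rewrite rmorphM hornerM mevalM Hp Hq.
Qed.

Lemma deriv_curve_eval C F :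
  (curve_eval C F)^`() = \sum_i curve_eval C F^`M(i) * mxvec (dermx C) 0 i.
Proof.
rewrite /curve_eval; elim/mpoly_ring_ind: F => [c|i|p q Hp Hq|p q Hp Hq].
- rewrite mmapC derivC big1// => i _; by rewrite mderivC mmap0 mul0r.
- rewrite mmapX mmap1U (bigD1 i)//= big1 => [|j ji].
    rewrite addr0 mderivX mnm1E eqxx scale1r (_ : (U_(i) - U_(i))%MM = 0%MM); last first.
      by apply/mnmP => j; rewrite mnmBE subnn mnm0E.
    rewrite mmapX mmap11 mul1r.
    by rewrite /dermx mxvec_map.
  by rewrite mderivX mnm1E eq_sym (negPf ji) scale0r mmap0 mul0r.
- by rewrite mmapD derivD Hp Hq -big_split; apply: eq_bigr => i _; rewrite mderivD mmapD mulrDl.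
- rewrite rmorphM derivM Hp Hq mulr_suml mulr_sumr -big_split; apply: eq_bigr => i _.
  rewrite mderivM mmapD !rmorphM mulrDl /=; congr (_ + _); first by rewrite mulrAC.
  by rewrite mulrA.
Qed.

End CurveEvaluation.

(** * Unipotent elements of a closed subgroup containing enough commutators *)

Section UnipotentInNormal.

Variables (E : closedFieldType) (E0 : [pchar E] =i pred0) (n : nat).
Variable G : set 'M[E]_n.+1.
Hypotheses (G_group : matrix_subgroup G) (G_irr : irreducible_set G).
Variable N : set 'M[E]_n.+1.
Hypotheses (N1 : N 1) (NM : forall g h, N g -> N h -> N (g * h)).
Hypothesis N_closed : forall g, g \in unitmx ->
  (forall F : {mpoly E[n.+1 * n.+1]}, (forall h, N h -> F.@[mxvec h 0] = 0) -> F.@[mxvec g 0] = 0) ->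
  N g.

(** The ideal of N is stable under the derivation along h |-> h nu: nu is a combination of the x nu
    x^-1 - nu, and h x u^j x^-1 u^-j runs on a curve in N through h with velocity h (x nu x^-1 -
    nu). As C' = C nu, the derivatives at 0 of F along C are values at 1 of iterated derivations of
    F, which lie in the ideal. So F vanishes along C, in particular at u. *)
Lemma unipotent_in_closed_normal (u : 'M[E]_n.+1) : G u -> (u - 1) ^+ n.+1 = 0 ->
  (forall x (j : nat), G x -> N (x * u ^+ j * x^-1 * u^-1 ^+ j)) -> N u.
Proof.
move=> Gu u0 comm.
have Gunit g : G g -> g \is a GRing.unit by case: G_group => H _ _ _ /H.
have uU := Gunit _ Gu.
have [C [uC dC N_nil]] := unipotent_curve E0 u0.
have ui0 : (u^-1 - 1) ^+ n.+1 = 0.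
  have -> : u^-1 - 1 = - u^-1 * (u - 1) by rewrite mulrBr mulr1 mulNr mulVr// opprK addrC.
  rewrite exprMn_comm ?u0 ?mulr0//.
  apply: commrB; last exact: commr1.
  by apply/commr_sym/commrN; apply: commrV.
have [Ci [uCi _ _]] := unipotent_curve E0 ui0.
pose nu := evmx 0 (dermx C).
have [X [XP PX]] := span_of_prop (fun t => exists2 x, G x & t = x * nu * x^-1 - nu).
have nuX : nu \in <<X>>%VS.
  by apply: (log_in_differences E0 G_group G_irr Gu uC uCi N_nil) => x Gx; apply: PX; exists x.
pose I F := forall h, N h -> F.@[mxvec h 0] = 0 :> E.
(* [l i] is the i-th coordinate of h nu, so that [DF] is the left-invariant vector field of nu. *)
pose l (i : 'I_(n.+1 * n.+1)) : {mpoly E[n.+1 * n.+1]} :=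
  \sum_k (lin_mx (mulmxr nu) : 'M[E]_(n.+1 * n.+1)) k i *: 'X_k.
have lE (h : 'M[E]_n.+1) i : (l i).@[mxvec h 0] = mxvec (h * nu) 0 i.
  rewrite -[h * nu]/(mulmxr nu h) -mul_vec_lin mxE raddf_sum; apply: eq_bigr => k _ /=.
  by rewrite mevalZ mevalXU mulrC.
pose DF F := \sum_i F^`M(i) * l i.
have DFE F (h : 'M[E]_n.+1) : (DF F).@[mxvec h 0] = \sum_i F^`M(i).@[mxvec h 0] * mxvec (h * nu) 0 i.
  by rewrite raddf_sum; apply: eq_bigr => i _; rewrite /= mevalM lE.
have DI F : I F -> I (DF F).
  move=> IF h Nh; rewrite DFE.
  pose g (t : 'M[E]_n.+1) := \sum_i F^`M(i).@[mxvec h 0] * mxvec (h * t) 0 i.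
  rewrite -/(g nu).
  have glin a s t : g (a *: s + t) = a * g s + g t.
    rewrite /g mulr_sumr -big_split; apply: eq_bigr => i _ /=.
    by rewrite mulrDr -scalerAr linearP /= !mxE mulrDr mulrCA.
  have gX t : t \in X -> g t = 0.
    move=> /XP[x Gx ->].
    pose K := cstmx (h * x) * C * cstmx x^-1 * Ci.
    have KN j : evmx j%:R K = h * (x * u ^+ j * x^-1 * u^-1 ^+ j).
      by rewrite !evmxM !evmx_cst uC uCi !mulrA.
    have FK : curve_eval K F = 0.
      apply: poly_eq0_nat => // j; rewrite horner_curve_eval KN.
      by apply: IF; apply: NM => //; apply: comm.
    have := deriv_curve_eval K F; rewrite FK derivC => /(congr1 (horner^~ 0)).
    rewrite horner0 horner_sum => /esym H; rewrite -[RHS]H /g.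
    have K0 : evmx 0 K = h by have := KN 0%N; rewrite !expr0 !mulr1 divrr ?mulr1// Gunit.
    have dK : evmx 0 (dermx K) = h * (x * nu * x^-1 - nu).
      have evD (A B : 'M[{poly E}]_n.+1) : evmx 0 (A + B) = evmx 0 A + evmx 0 B.
        by apply/matrixP => i j; rewrite !mxE /horner_eval hornerD.
      rewrite /K !dermxM !dermx_cst !(mulr0, mul0r, addr0, add0r) evD !evmxM !evmx_cst.
      rewrite (uC 0) (uCi 0) !expr0 !mulr1 (inverse_curve_derivative E0 G_group Gu uC uCi).
      by rewrite mulrN (mulrK (Gunit x Gx)) mulrBr !mulrA.
    apply: eq_bigr => i _; rewrite hornerM horner_curve_eval K0; congr (_ * _).
    by rewrite -dK mxvec_map.
  have : g nu = 0; last by [].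
  move: nuX => /(@coord_span _ _ _ (in_tuple X)) ->.
  have g0 : g 0 = 0 by rewrite /g big1// => i _; rewrite mulr0 linear0 mxE mulr0.
  elim/big_rec: _ => // i s _ gs; rewrite glin gs gX ?mem_nth// mulr0 addr0//.
have curveDF F : (curve_eval C F)^`() = curve_eval C (DF F).
  rewrite deriv_curve_eval /curve_eval /DF raddf_sum; apply: eq_bigr => i _ /=.
  rewrite rmorphM; congr (_ * _).
  have e : mxvec (C * cstmx nu) = mxvec C *m lin_mx (mulmxr (cstmx nu)) by rewrite mul_vec_lin.
  rewrite /l raddf_sum dC e mxE.
  apply: eq_bigr => k _ /=; rewrite mmapZ mmapX mmap1U mulrC; congr (_ * _).
  rewrite -(@map_lin_mx _ _ (@polyC E) _ _ _ _ (mulmxr nu)) ?mxE// => v.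
  exact: map_mxM.
have curve0 F : I F -> curve_eval C F = 0.
  move=> IF; have H k : I (iter k DF F) by elim: k => //= k; apply: DI.
  apply/polyP => k; rewrite coef0; apply/eqP.
  have: ((curve_eval C F)^`(k)).[0] = 0.
    have -> : (curve_eval C F)^`(k) = curve_eval C (iter k DF F).
      by elim: k => // k IH; rewrite derivnS IH curveDF.
    by rewrite horner_curve_eval (uC 0) expr0; apply: H.
  rewrite horner_coef0 coef_derivn addn0 ffactnn -mulr_natr => /eqP.
  by rewrite mulf_eq0 natr_pchar0// -[k`! == _]negbK -lt0n fact_gt0 orbF.
apply: N_closed => // F IF.
have := horner_curve_eval C F 1; rewrite (curve0 F IF) horner0.
by rewrite (uC 1) expr1 => <-.
Qed.

End UnipotentInNormal.

Section QuasiUnipotent.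

Variables (E : closedFieldType) (n : nat).
Implicit Types (X f : 'M[E]_n.+1).

Lemma eigenvalue_of_prod X (s : seq E) (v : 'rV[E]_n.+1) :
  v != 0 -> v *m horner_mx X (\prod_(z <- s) ('X - z%:P)) = 0 -> exists2 z, z \in s & eigenvalue X z.
Proof.
elim: s v => [|z s IH] v v0; first by rewrite big_nil rmorph1 mulmx1 => v00; rewrite v00 eqxx in v0.
rewrite big_cons rmorphM /= -mulmxE mulmxA rmorphB /= horner_mx_X horner_mx_C.
have [vz _|vz /(IH _ vz)[y ys Xy]] := eqVneq (v *m (X - z%:M)) 0; last first.
  by exists y => //; rewrite inE ys orbT.
exists z; rewrite ?mem_head//; apply/eigenvalueP; exists v => //.
by move/eqP: vz; rewrite mulmxBr mul_mx_scalar subr_eq0 => /eqP.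
Qed.

Lemma exp_eigenvalue X M l : (0 < M)%N -> eigenvalue (X ^+ M) l ->
  exists2 z, eigenvalue X z & z ^+ M = l.
Proof.
move=> M0 /eigenvalueP[v vX v0].
have [r rE] := closed_field_poly_normal ('X^M - l%:P).
rewrite lead_coefXnsubC// scale1r in rE.
have [|z zr Xz] := @eigenvalue_of_prod X r v v0.
  by rewrite -rE rmorphB rmorphXn /= horner_mx_X horner_mx_C mulmxBr vX mul_mx_scalar subrr.
exists z => //; have : root ('X^M - l%:P) z by rewrite rE root_prod_XsubC.
by rewrite /root hornerD hornerN hornerXn hornerC subr_eq0 => /eqP.
Qed.

(** X and X^q have the same spectrum, so z |-> z^q maps it onto itself. A section [g] of this map
    permutes at most n+1 eigenvalues; its cycle lengths divide (n+1)!, so every eigenvalue satisfies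
    z^(q^(n+1)!) = z. *)
Lemma quasi_unipotent X f q : (1 < q)%N -> X \is a GRing.unit -> f \is a GRing.unit ->
  f * X * f^-1 = X ^+ q -> (X ^+ (q ^ (n.+1)`!).-1 - 1) ^+ n.+1 = 0.
Proof.
move=> q1 XU fU fX; have [s [e [us sE _ _ _]]] := spectral_projections X.
have ss : (size s <= n.+1)%N.
  rewrite -ltnS -(size_char_poly X); apply: max_poly_roots => //.
    by rewrite -size_poly_eq0 size_char_poly.
  by apply/allP => l; rewrite sE eigenvalue_root_char.
have conj l : eigenvalue (X ^+ q) l = eigenvalue X l.
  have unz (v : 'rV[E]_n.+1) (g : 'M[E]_n.+1) : g \is a GRing.unit -> v != 0 -> v *m g != 0.
    move=> gU; apply: contra_neq => vg.
    by have := congr1 (fun w => w *m invmx g) vg; rewrite mulmxK// mul0mx.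
  rewrite -fX; have Yf : f * X * f^-1 *m f = f *m X by rewrite mulmxE divrK.
  have fY : f^-1 *m (f * X * f^-1) = X *m f^-1 by rewrite mulmxE !mulrA mulVr// mul1r.
  move: (f * X * f^-1) Yf fY => Y Yf fY.
  apply/idP/idP => /eigenvalueP[v vX v0]; apply/eigenvalueP.
    exists (v *m f); last exact: unz.
    have := congr1 (fun w => w *m f) vX; rewrite -scalemxAl => <-.
    by rewrite -!mulmxA Yf.
  exists (v *m f^-1); last by apply: unz; rewrite ?unitrV.
  rewrite -mulmxA fY.
  by rewrite mulmxA vX -scalemxAl.
have surj (l : seq_sub s) : {z : seq_sub s | ssval z ^+ q = ssval l}.
  apply: cid; have := ssvalP l; rewrite sE -conj => /(exp_eigenvalue (ltnW q1))[z].
  by rewrite -sE => zs zl; exists (SeqSub zs).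
pose g l := sval (surj l).
have gq l : ssval (g l) ^+ q = ssval l := svalP (surj l).
have ginj : injective g by move=> a b gab; apply: val_inj; rewrite /= -gq gab gq.
have gN l : iter (n.+1)`! g l = l.
  have : (fingraph.order g l %| (n.+1)`!)%N.
    by rewrite dvdn_fact// fingraph.order_gt0 (leq_trans (max_card _))// card_seq_sub.
  move=> /dvdnP[k ->]; elim: k => // k IH.
  by rewrite mulSn iterD IH iter_order.
have gqk k l : ssval (iter k g l) ^+ (q ^ k) = ssval l.
  by elim: k l => [|k IH] l; rewrite ?expr1// expnS exprM /= gq.
have l1 l : eigenvalue X l -> l ^+ (q ^ (n.+1)`!).-1 = 1.
  move=> Xl; have ls : l \in s by rewrite sE.
  have := gqk (n.+1)`! (SeqSub ls); rewrite gN /= -[in X in _ -> X](divr1 (_ ^+ _)).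
  have l0 : l != 0.
    apply: contraTneq Xl => ->; apply/eigenvalueP => -[v /eqP vX v0].
    move: vX v0; rewrite scale0r => /eqP vX.
    by have := congr1 (fun w => w *m invmx X) vX; rewrite mulmxK// mul0mx => ->; rewrite eqxx.
  rewrite -{1}(prednK (n := q ^ _)) ?expn_gt0 ?(ltnW q1)// exprS divr1 -{3}[l]mulr1.
  by move=> /(mulfI l0).
have M0 : (0 < (q ^ (n.+1)`!).-1)%N.
  by rewrite -subn1 subn_gt0 -(exp1n (n.+1)`!) ltn_exp2r// fact_gt0.
apply: nilpotent_eigenvalue => l /eigenvalueP[v vX v0].
have : eigenvalue (X ^+ (q ^ (n.+1)`!).-1) (l + 1).
  apply/eigenvalueP; exists v => //; move: vX; rewrite mulmxBr mulmx1 scalerDl scale1r => <-.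
  by rewrite subrK.
by move=> /(exp_eigenvalue M0)[z /l1 -> /esym/eqP]; rewrite -[X in _ == X]add0r (inj_eq (addIr _)) => /eqP.
Qed.

End QuasiUnipotent.

(** * Valuation rings, extension of automorphisms and compactness *)

(** Replacing each set by its union with [A0] makes the empty chain harmless. *)
Lemma Zorn_above (T : Type) (P : set (set T)) (A0 : set T) : P A0 ->
    (forall F : set (set T), F !=set0 -> F `<=` P -> (forall X, F X -> A0 `<=` X) ->
       total_on F subset -> P (\bigcup_(X in F) X)) ->
  exists M, [/\ P M, A0 `<=` M & forall B, M `<=` B -> P B -> B `<=` M].
Proof.
move=> PA0 Pchain; pose Q X := P (A0 `|` X).
have [F FQ Ftot|M [QM Mmax]] := @Zorn_bigcup T Q.
  have [F0|F0] := pselect (F !=set0); last first.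
    rewrite /Q (_ : _ `|` _ = A0)//; apply/seteqP; split=> x; last by left.
    by case=> // -[X FX]; case: F0; exists X.
  pose F' := [set A0 `|` X | X in F].
  rewrite /Q (_ : _ `|` _ = \bigcup_(X in F') X).
    apply: Pchain.
    - by case: F0 => X FX; exists (A0 `|` X), X.
    - by move=> _ [X FX <-]; exact: FQ.
    - by move=> _ [X FX <-] x; left.
    - move=> _ _ [X FX <-] [Y FY <-].
      by case: (Ftot X Y FX FY) => XY; [left|right] => x [?|/XY ?]; by [left|right].
  apply/seteqP; split=> x.
    case=> [A0x|[X FX Xx]]; last by exists (A0 `|` X); [exists X|right].
    by case: F0 => X FX; exists (A0 `|` X); [exists X|left].
  by move=> [_ [X FX <-]] [|Xx]; [left|right; exists X].
exists (A0 `|` M); split=> // B MB PB x Bx; apply: contrapT => nx.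
apply: (Mmax B); last by rewrite /Q (_ : A0 `|` B = B)//; apply/setUidr => y A0y; apply: MB; left.
split; first by move=> y My; apply: MB; right.
by move=> BM; apply: nx; right; apply: BM.
Qed.

(** * Chevalley's theorem on the existence of valuation rings *)

Section Chevalley.

Variable Omega : closedFieldType.
Implicit Types (A I O : set Omega) (x y : Omega).

Definition subring_set A :=
  [/\ A 1, forall x y, A x -> A y -> A (x - y) & forall x y, A x -> A y -> A (x * y)].

Definition extended_ideal I A : set Omega := [set x |
  exists s : seq (Omega * Omega), (forall ab, ab \in s -> I ab.1 /\ A ab.2) /\
    x = \sum_(ab <- s) ab.1 * ab.2].

Section SubringTheory.

Variables (A : set Omega) (A_ring : subring_set A).

Lemma subring0 : A 0.
Proof. by case: A_ring => A1 AB _; rewrite -(subrr 1); apply: AB. Qed.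

Lemma subringN x : A x -> A (- x).
Proof. by case: A_ring => A1 AB _ Ax; rewrite -sub0r; apply: AB => //; exact: subring0. Qed.

Lemma subringD x y : A x -> A y -> A (x + y).
Proof. by case: A_ring => A1 AB _ Ax Ay; rewrite -(opprK y); apply: AB => //; exact: subringN. Qed.

Lemma subring1 : A 1. Proof. by case: A_ring. Qed.
Lemma subringB x y : A x -> A y -> A (x - y). Proof. by case: A_ring => _ H _; apply: H. Qed.
Lemma subringM x y : A x -> A y -> A (x * y). Proof. by case: A_ring => _ _; apply. Qed.

Lemma subringX x k : A x -> A (x ^+ k).
Proof.
move=> Ax; elim: k => [|k IH]; first by rewrite expr0; exact: subring1.
by rewrite exprS; apply: subringM.
Qed.

Lemma subring_sum (T : eqType) (r : seq T) (F : T -> Omega) :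
  (forall i, i \in r -> A (F i)) -> A (\sum_(i <- r) F i).
Proof.
elim: r => [|i r IH] H; first by rewrite big_nil; exact: subring0.
rewrite big_cons; apply: subringD; first by apply: H; rewrite mem_head.
by apply: IH => j jr; apply: H; rewrite inE jr orbT.
Qed.

Lemma subring_prod (T : eqType) (r : seq T) (F : T -> Omega) :
  (forall i, i \in r -> A (F i)) -> A (\prod_(i <- r) F i).
Proof.
elim: r => [|i r IH] H; first by rewrite big_nil; exact: subring1.
rewrite big_cons; apply: subringM; first by apply: H; rewrite mem_head.
by apply: IH => j jr; apply: H; rewrite inE jr orbT.
Qed.

Variable I : set Omega.

Lemma extended_idealD x y :
  extended_ideal I A x -> extended_ideal I A y -> extended_ideal I A (x + y).
Proof.
move=> [s [sP ->]] [t [tP ->]]; exists (s ++ t); rewrite big_cat; split => // ab.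
by rewrite mem_cat => /orP[/sP|/tP].
Qed.

Lemma extended_idealM x y : extended_ideal I A x -> A y -> extended_ideal I A (x * y).
Proof.
move=> [s [sP ->]] Ay; exists [seq (ab.1, ab.2 * y) | ab <- s]; split.
  by move=> _ /mapP[ab /sP[? ?] ->]; split => //; apply: subringM.
by rewrite big_map mulr_suml; apply: eq_bigr => ab _ /=; rewrite mulrA.
Qed.

Lemma extended_ideal0 : extended_ideal I A 0.
Proof. by exists [::]; rewrite big_nil. Qed.

Lemma extended_ideal_gen x : I x -> extended_ideal I A x.
Proof.
move=> Ix; exists [:: (x, 1)]; rewrite big_seq1 mulr1; split => // ab.
by rewrite inE => /eqP->; split => //; exact: subring1.
Qed.

End SubringTheory.

Lemma extended_ideal_sub I A : subring_set A -> I `<=` A -> extended_ideal I A `<=` A.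
Proof.
move=> Ar IA _ [s [sP ->]]; apply: subring_sum => // ab /sP[Ia Ab].
by apply: subringM => //; apply: IA.
Qed.

Definition adjoin A x : set Omega :=
  [set y | exists p : {poly Omega}, (forall i, A p`_i) /\ y = p.[x]].

Lemma adjoin_ring A x : subring_set A -> subring_set (adjoin A x).
Proof.
move=> Ar; split.
- exists 1; rewrite hornerC; split => // i; rewrite coef1.
  by case: eqP => _; [exact: subring1|exact: subring0].
- move=> _ _ [p [Ap ->]] [q [Aq ->]]; exists (p - q); rewrite hornerD hornerN; split => // i.
  by rewrite coefB; apply: subringB.
- move=> _ _ [p [Ap ->]] [q [Aq ->]]; exists (p * q); rewrite hornerM; split => // i.
  by rewrite coefM; apply: subring_sum => // j _; apply: subringM.
Qed.

Lemma sub_adjoin A x : subring_set A -> A `<=` adjoin A x.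
Proof.
move=> Ar y Ay; exists y%:P; rewrite hornerC; split => // i; rewrite coefC.
by case: eqP => _ //; exact: subring0.
Qed.

Lemma mem_adjoin A x : subring_set A -> adjoin A x x.
Proof.
move=> Ar; exists 'X; rewrite hornerX; split => // i; rewrite coefX.
by case: eqP => _; [exact: subring1|exact: subring0].
Qed.

Lemma extended_ideal_adjoin I A x y : subring_set A -> extended_ideal I (adjoin A x) y ->
  exists p : {poly Omega}, (forall i, extended_ideal I A p`_i) /\ y = p.[x].
Proof.
move=> Ar [s [sP ->]]; elim: s sP => [|[a b] s IH] sP.
  exists 0; rewrite big_nil horner0; split => // i; rewrite coef0; exact: extended_ideal0.
have [ab|p [pP pE]] := IH; first by move=> abs; apply: sP; rewrite inE abs orbT.
have [/= Ia [q [Aq qE]]] := sP (a, b) (mem_head _ _).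
exists (a *: q + p); rewrite big_cons hornerD hornerZ -pE -qE; split => // i.
rewrite coefD coefZ; apply: extended_idealD => //.
by apply: extended_idealM => //; exact: extended_ideal_gen.
Qed.

(** O is maximal among the subrings containing A in which I generates a proper ideal J. For x
    outside O, maximality gives 1 = p(x) with coefficients in J. If x and its inverse were both
    outside O, the two relations could be shortened against each other indefinitely. *)
Theorem chevalley_extension A I : subring_set A -> I `<=` A -> ~ extended_ideal I A 1 ->
  exists O, [/\ valuation_ring O, A `<=` O & I `<=` max_ideal O].
Proof.
move=> Ar IA IA1.
pose P := [set B : set Omega | subring_set B /\ ~ extended_ideal I B 1].
have [//|F [X0 FX0] FP FA Ftot|O [[Or O1] AO Omax]] := @Zorn_above _ P A.
  have cover (s : seq Omega) : (forall x, x \in s -> (\bigcup_(X in F) X) x) ->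
      exists2 X, F X & forall x, x \in s -> X x.
    elim: s => [|x s IH] H; first by exists X0.
    have [y ys|X FX sX] := IH; first by apply: H; rewrite inE ys orbT.
    have [Y FY Yx] := H x (mem_head _ _).
    have [XY|YX] := Ftot X Y FX FY; [exists Y|exists X] => // z; rewrite inE => /orP[/eqP->|zs] //.
    - by apply: XY; apply: sX.
    - exact: YX.
    - exact: sX.
  split; last first.
    move=> [s [sP s1]]; have [x|X FX Xs] := cover [seq ab.2 | ab <- s].
      by move=> /mapP[ab /sP[_ ?] ->].
    have [_ []] := FP X FX; exists s; split => // ab abs; split; first by have [] := sP _ abs.
    by apply: Xs; apply/mapP; exists ab.
  split; first by exists X0 => //; have [[]] := FP _ FX0.
  - move=> x y Ux Uy; have [z|X FX Xs] := cover [:: x; y].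
      by rewrite !inE => /orP[]/eqP->.
    exists X => //; have [Xr _] := FP X FX; apply: subringB => //; apply: Xs; rewrite !inE eqxx ?orbT//.
  - move=> x y Ux Uy; have [z|X FX Xs] := cover [:: x; y].
      by rewrite !inE => /orP[]/eqP->.
    exists X => //; have [Xr _] := FP X FX; apply: subringM => //; apply: Xs; rewrite !inE eqxx ?orbT//.
have IO : I `<=` O by move=> x /IA/AO.
pose J := extended_ideal I O.
have adj x : ~ O x -> exists p : {poly Omega}, (forall i, J p`_i) /\ 1 = p.[x].
  move=> nOx; apply: (extended_ideal_adjoin Or); apply: contrapT => n1.
  apply: nOx; apply: (Omax (adjoin O x)); first exact: sub_adjoin.
    by split => //; exact: adjoin_ring.
  exact: mem_adjoin.
(* A relation for the inverse of 1 - b, multiplied by a power of 1 - b, puts that power in J; since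
   b is in J, 1 would be in J too. *)
have unit1 b : J b -> O (1 - b)^-1.
  move=> Jb; apply: contrapT => /adj[p [Jp p1]].
  apply: (O1); have b1 : 1 - b != 0.
    by rewrite subr_eq0; apply: contra_notN (O1) => /eqP ->.
  have Ob : O (1 - b).
    by apply: subringB => //; [exact: subring1|exact: (extended_ideal_sub Or IO)].
  have Jy : J ((1 - b) ^+ (size p)).
    rewrite -[(1 - b) ^+ _]mulr1 [X in J (_ * X)]p1 horner_coef mulr_sumr.
    apply: (big_ind J); [exact: extended_ideal0|by move=> ? ?; exact: extended_idealD|].
    move=> i _; rewrite mulrCA exprVn -expfB//.
    by apply: extended_idealM; [by []|exact: Jp|exact: subringX].
  elim: (size p) Jy => // k IH; rewrite exprS mulrBl mul1r => H; apply: IH.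
  rewrite -(subrK (b * (1 - b) ^+ k) (_ ^+ k)); apply: extended_idealD => //.
  by apply: extended_idealM => //; apply: subringX.
have descent N x (f g : {poly Omega}) : (size f + size g <= N)%N -> x != 0 ->
    (forall i, J f`_i) -> (forall i, J g`_i) -> 1 = f.[x] -> 1 = g.[x^-1] -> False.
  elim: N x f g => [|N IH] x f g.
    rewrite leqn0 addn_eq0 size_poly_eq0 => /andP[/eqP-> _] _ _ _ /eqP.
    by rewrite horner0 oner_eq0.
  wlog gf : x f g / (size g <= size f)%N => [H|].
    have [le'|/ltnW fg] := leqP (size g) (size f); first exact: (H x f g).
    move=> le x0 Jf Jg f1 g1; apply: (H x^-1 g f fg) => //; rewrite ?invr_eq0 ?invrK//.
    by rewrite addnC.
  move=> le x0 Jf Jg f1 g1.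
  have [m sg] : exists m, size g = m.+1.
    case: (size g) (size_poly_eq0 g) => [/esym/eqP g0|m _]; last by exists m.
    by move/eqP: g1; rewrite g0 horner0 oner_eq0.
  have [n sf] : exists n, size f = n.+1 by case: (size f) gf => [|n]; rewrite sg//; exists n.
  have mn : (m <= n)%N by move: gf; rewrite sg sf.
  have [b Jb bE] : exists2 b, J b & b = g`_0 by exists g`_0.
  have b1 : 1 - b != 0 by rewrite subr_eq0; apply: contra_notN (O1) => /eqP ->.
  pose w := (1 - b)^-1; have Ow : O w := unit1 b Jb.
  have xn : x ^+ n = \sum_(j < m) w * g`_j.+1 * x ^+ (n - j.+1).
    have e : 1 - b = \sum_(j < m) g`_j.+1 * x^-1 ^+ j.+1.
      rewrite {1}g1 (@horner_coef_wide _ m.+1) ?sg// big_ord_recl expr0 mulr1 -bE addrAC subrr add0r.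
      by [].
    rewrite -[LHS]mul1r -(mulVf b1) -/w -mulrA e mulr_suml mulr_sumr.
    apply: eq_bigr => j _; rewrite -!mulrA; congr (_ * (_ * _)).
    by rewrite exprVn mulrC -exprB ?unitfE//; have := ltn_ord j; lia.
  (* The relation [g], divided by the unit 1 - g_0, expresses x^n by lower powers; substituted into
     the top term of [f], it shortens [f] and keeps its coefficients in J. *)
  pose f' := \poly_(i < n) f`_i + f`_n *: \sum_(j < m) (w * g`_j.+1) *: 'X^(n - j.+1).
  have sf' : (size f' <= n)%N.
    apply: leq_trans (size_polyD _ _) _; rewrite geq_max size_poly /=.
    apply: leq_trans (size_scale_leq _ _) _; apply: leq_trans (size_sum _ _ _) _.
    apply/bigmax_leqP => j _; apply: leq_trans (size_scale_leq _ _) _.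
    by rewrite size_polyXn; have := ltn_ord j; lia.
  apply: (IH x f' g) => //; first by rewrite sf in le; lia.
  - move=> i; rewrite coefD coef_poly coefZ coef_sum; apply: extended_idealD.
      by case: ifP => _; [exact: Jf|exact: extended_ideal0].
    apply: extended_idealM; [by []|exact: Jf|apply: subring_sum => // j _].
    rewrite coefZ coefXn; apply: subringM => //; last first.
      by case: eqP => _; [exact: subring1|exact: subring0].
    by apply: subringM => //; apply: (extended_ideal_sub Or IO); apply: Jg.
  rewrite hornerD hornerZ horner_sum horner_poly f1 (@horner_coef_wide _ n.+1) ?sf//.
  rewrite big_ord_recr /=; congr (_ + _ * _); rewrite xn; apply: eq_bigr => j _.
  by rewrite hornerZ hornerXn.
exists O; split => //.
  split; [exact: subring1|by move=> *; apply: subringB|by move=> *; apply: subringM|].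
  move=> x; have [->|x0] := eqVneq x 0; first by left; exact: subring0.
  have [?|nx] := pselect (O x); first by left.
  right; apply: contrapT => ny.
  have [f [Jf f1]] := adj _ nx; have [g [Jg g1]] := adj _ ny.
  exact: (descent _ x f g (leqnn _)).
move=> i Ii; split; first exact: IO.
have [->|i0] := eqVneq i 0; [by left|right => Oi; apply: (O1)].
by rewrite -(divff i0); apply: extended_idealM => //; apply: extended_ideal_gen.
Qed.

End Chevalley.

(** * Subfields, minimal polynomials and extension of automorphisms *)

Section SubfieldType.
Variables (F : fieldType) (S : divringClosed F).
Record subfield_of := Subfield { subfield_val :> F; _ : subfield_val \in S }.
HB.instance Definition _ := [isSub for subfield_val].
HB.instance Definition _ := [Choice of subfield_of by <:].
HB.instance Definition _ := [SubChoice_isSubIntegralDomain of subfield_of by <:].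
HB.instance Definition _ := [SubIntegralDomain_isSubField of subfield_of by <:].
End SubfieldType.

(** Gives access to divisibility of polynomials over a subfield known only as a set; membership is
    made boolean classically. *)
Lemma subfield_as_field (F : fieldType) (D : set F) : D 1 ->
    (forall x y, D x -> D y -> D (x - y)) -> (forall x y, D x -> D y -> D (x / y)) ->
  exists K : fieldType, exists i : {rmorphism K -> F}, forall x, D x <-> exists a, x = i a.
Proof.
move=> D1 DB DV; pose p (x : F) : bool := `[< D x >]; have Dc : divring_closed p.
  split=> [|x y /asboolP Dx /asboolP Dy|x y /asboolP Dx /asboolP Dy]; apply/asboolP => //.
    exact: DB.
  exact: DV.
pose S : divringClosed F := HB.pack p (GRing.isDivringClosed.Build F p Dc).
exists (subfield_of S), (\val : {rmorphism subfield_of S -> F}) => x; split.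
  by move=> Dx; have xS : x \in S by [apply/asboolP]; exists (Subfield xS).
by move=> [[a /= aS] ->]; apply/asboolP.
Qed.

Lemma rmorphism_of_fun (R S : nzRingType) (f : R -> S) :
    (forall x y, f (x - y) = f x - f y) -> f 1 = 1 -> (forall x y, f (x * y) = f x * f y) ->
  exists g : {rmorphism R -> S}, g =1 f.
Proof.
move=> fB f1 fM.
pose g : {rmorphism R -> S} := HB.pack f (GRing.isZmodMorphism.Build R S f fB)
  (GRing.isMonoidMorphism.Build R S f (f1, fM)).
by exists g.
Qed.

Section MinimalPolynomial.

Variables (K : fieldType) (L : fieldType) (i : {rmorphism K -> L}) (x : L).

(** Take p of least size. In the last clause the gcd of p and r has a root, so it is not constant;
    since p is irreducible, the gcd is p up to a scalar. Thus a root of a transported p satisfies no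
    relation that x does not. *)
Lemma minimal_polynomial : algebraicOver i x -> exists p : {poly K},
  [/\ (1 < size p)%N, root (map_poly i p) x,
      forall r, root (map_poly i r) x -> p %| r
    & forall (L' : fieldType) (f : {rmorphism K -> L'}) l r,
        root (map_poly f p) l -> root (map_poly f r) l -> p %| r].
Proof.
move=> [q q0 qx].
have ex : exists d, `[< exists q : {poly K}, [/\ q != 0, root (map_poly i q) x & size q = d] >].
  by exists (size q); apply/asboolP; exists q.
case: (ex_minnP ex) => d /asboolP[p [p0 px sp]] dmin.
have pdvd r : root (map_poly i r) x -> p %| r.
  move=> rx; rewrite /dvdp; apply: contraT => m0.
  have: (d <= size (r %% p)%R)%N.
    apply: dmin; apply/asboolP; exists (r %% p); split => //.
    move: rx; rewrite {1}(divp_eq r p) /root rmorphD rmorphM /= hornerD hornerM.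
    by rewrite (rootP px) mulr0 add0r.
  by rewrite -sp leqNgt ltn_modp p0.
have size_root (L' : fieldType) (f : {rmorphism K -> L'}) l r : r != 0 ->
    root (map_poly f r) l -> (1 < size r)%N.
  move=> r0 rl; rewrite ltnNge; apply/negP => /size1_polyC rE.
  move: rl r0; rewrite rE map_polyC rootC fmorph_eq0 polyC_eq0 => /eqP->.
  by rewrite eqxx.
exists p; split => //; first exact: size_root px.
move=> L' f l r pl rl; set g := gcdp p r.
have gl : root (map_poly f g) l by rewrite gcdp_map root_gcd pl.
have [h pE] : exists h, p = h * g by apply/dvdpP; exact: dvdp_gcdl.
have g0 : g != 0 by apply: contra_neq p0 => g0; rewrite pE g0 mulr0.
have h0 : h != 0 by apply: contra_neq p0 => h0; rewrite pE h0 mul0r.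
move: px; rewrite {1}pE rmorphM rootM => /orP[hx|gx]; last first.
  exact: dvdp_trans (pdvd _ gx) (dvdp_gcdr _ _).
have /dvdp_leq := pdvd _ hx; move=> /(_ h0).
rewrite {1}pE size_mul//; have := size_root _ _ _ _ g0 gl.
have : (0 < size h)%N by rewrite lt0n size_poly_eq0.
by move: (size h) (size g) => a b; lia.
Qed.

End MinimalPolynomial.

Section ExtendAutomorphism.

Variable Omega : closedFieldType.
Implicit Types (Gam : set (Omega * Omega)).

(** The graph of an isomorphism between two subrings, as a subring of the product; the last clause
    makes both projections injective. *)
Definition partial_isomorphism Gam :=
  [/\ Gam (1, 1), forall u v, Gam u -> Gam v -> Gam (u - v),
      forall u v, Gam u -> Gam v -> Gam (u * v)
    & forall a b, Gam (a, b) -> (a = 0 <-> b = 0)].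

Lemma partial_isomorphism_functional Gam a b b' :
  partial_isomorphism Gam -> Gam (a, b) -> Gam (a, b') -> b = b'.
Proof.
move=> [_ GB _ G0] Gb Gb'; have /G0[+ _] : Gam (a - a, b - b') by apply: (GB (a, b) (a, b')).
by rewrite subrr => /(_ erefl)/eqP; rewrite subr_eq0 => /eqP.
Qed.

(** A maximal extension has a field as domain, since fractions can be added, and this field is all
    of Omega, since x can be matched with a root of its transported minimal polynomial. Algebraicity
    on the target side gives surjectivity. *)
Theorem extend_automorphism Gam : partial_isomorphism Gam ->
    (forall x, exists q : {poly Omega}, [/\ q != 0, root q x & forall i, exists b, Gam (q`_i, b)]) ->
    (forall y, exists q : {poly Omega}, [/\ q != 0, root q y & forall i, exists a, Gam (a, q`_i)]) ->
  exists s : {rmorphism Omega -> Omega}, bijective s /\ forall a b, Gam (a, b) -> s a = b.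
Proof.
move=> GP alg1 alg2.
have [//|F [X0 FX0] FP FA Ftot|M [MP GM Mmax]] := @Zorn_above _ partial_isomorphism Gam.
  have two u v : (\bigcup_(X in F) X) u -> (\bigcup_(X in F) X) v -> exists2 X, F X & X u /\ X v.
    move=> [X FX Xu] [Y FY Yv]; have [XY|YX] := Ftot X Y FX FY.
      by exists Y => //; split => //; apply: XY.
    by exists X => //; split => //; apply: YX.
  split.
  - by exists X0 => //; have [] := FP _ FX0.
  - move=> u v /two H /H[X FX [Xu Xv]]; exists X => //; have [_ XB _ _] := FP _ FX; exact: XB.
  - move=> u v /two H /H[X FX [Xu Xv]]; exists X => //; have [_ _ XM _] := FP _ FX; exact: XM.
  - by move=> a b [X FX Xab]; have [_ _ _ X0'] := FP _ FX; apply: X0'.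
have [M11 MB MM M0] := MP.
have MX a b k : M (a, b) -> M (a ^+ k, b ^+ k).
  by move=> Mab; elim: k => [|k IH]; rewrite ?expr0// !exprS; apply: (MM (_, _) (_, _)).
have MV a b : M (a, b) -> M (a^-1, b^-1).
  move=> Mab; have [a0|a0] := eqVneq a 0.
    by move: Mab => /[dup] /M0[/(_ a0)->]; rewrite a0 invr0.
  have b0 : b != 0 by apply: contra_neq a0 => b0; apply/(M0 a b).
  (* The graph localized at the powers of (a, b). *)
  pose B := [set u : Omega * Omega | exists k x y, M (x, y) /\ u = (x / a ^+ k, y / b ^+ k)].
  have := Mmax B; apply; last first.
  - by exists 1%N, 1, 1; split => //; rewrite !expr1 !mul1r.
  - have Mab' k : M (a ^+ k, b ^+ k) by apply: MX.
    have frac_sub (x x' c : Omega) (c0 : c != 0) k k' :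
        x / c ^+ k - x' / c ^+ k' = (x * c ^+ k' - x' * c ^+ k) / c ^+ (k + k').
      by rewrite -mulNr addf_div ?expf_neq0// mulNr exprD.
    split.
    + by exists 0%N, 1, 1; split => //; rewrite !expr0 !divr1.
    + move=> _ _ [k [x [y [Mxy ->]]]] [k' [x' [y' [Mxy' ->]]]].
      exists (k + k')%N, (x * a ^+ k' - x' * a ^+ k), (y * b ^+ k' - y' * b ^+ k); split.
        by apply: (MB (_, _) (_, _)); apply: (MM (_, _) (_, _)) => //; exact: Mab'.
      by congr pair; apply: frac_sub.
    + move=> _ _ [k [x [y [Mxy ->]]]] [k' [x' [y' [Mxy' ->]]]].
      exists (k + k')%N, (x * x'), (y * y'); split; first exact: (MM (_, _) (_, _)).
      by rewrite !exprD; congr pair; rewrite mulf_div.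
    + move=> _ _ [k [x [y [Mxy [-> ->]]]]]; have [x0 y0] := M0 _ _ Mxy.
      split=> /eqP; rewrite mulf_eq0 invr_eq0 expf_eq0 (negPf a0, negPf b0) andbF orbF => /eqP.
        by move=> /x0->; rewrite mul0r.
      by move=> /y0->; rewrite mul0r.
  - by move=> [x y] Mxy; exists 0%N, x, y; rewrite !expr0 !divr1.
have fun1 a b b' := partial_isomorphism_functional MP (a := a) (b := b) (b' := b').
pose D : set Omega := [set a | exists b, M (a, b)].
have [|||K [i iD]] := @subfield_as_field Omega D.
- by exists 1.
- by move=> a a' [b Mb] [b' Mb']; exists (b - b'); apply: (MB (_, _) (_, _)).
- by move=> a a' [b Mb] [b' Mb']; exists (b / b'); apply: (MM (_, _) (_, _)) => //; apply: MV.
have [f0 f0M] : {f0 : K -> Omega & forall a, M (i a, f0 a)}.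
  apply: (@choice _ _ (fun (a : K) b => M (i a, b))) => a.
  by have [_ H] := iD (i a); apply: H; exists a.
have [f fE] : exists f : {rmorphism K -> Omega}, f =1 f0.
  apply: rmorphism_of_fun => [a b||a b].
  - by apply: fun1 (f0M _) _; rewrite rmorphB; apply: (MB (_, _) (_, _)).
  - by apply: fun1 (f0M _) _; rewrite rmorph1.
  - by apply: fun1 (f0M _) _; rewrite rmorphM; apply: (MM (_, _) (_, _)).
have fM a : M (i a, f a) by rewrite fE.
have total x : exists y, M (x, y).
  have [q [q0 qx qG]] := alg1 x.
  have [q' q'E] : {q' : nat -> K & forall j, i (q' j) = q`_j}.
    apply: (@choice _ _ (fun j a => i a = q`_j)) => j.
    have [b Gb] := qG j; have [H _] := iD q`_j.
    by have [|a ->] := H; [exists b; apply: GM|exists a].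
  pose qK := \poly_(j < size q) q' j.
  have qKE : map_poly i qK = q.
    apply/polyP => j; rewrite coef_map coef_poly; case: ltnP => [_|sj]; first exact: q'E.
    by rewrite nth_default //; exact: rmorph0.
  have [|p [sp px pdvd pdvd']] := @minimal_polynomial K Omega i x.
    by exists qK; rewrite ?qKE//; apply: contra_neq q0 => qK0; rewrite -qKE qK0 rmorph0.
  have /closed_rootP[l pl] : size (map_poly f p) != 1%N by rewrite size_map_poly neq_ltn sp orbT.
  (* The map sending x to l; the two divisibility clauses of the minimal polynomial make it well
     defined and injective. *)
  pose B := [set u : Omega * Omega | exists r : {poly K}, u = ((map_poly i r).[x], (map_poly f r).[l])].
  have MsubB : M `<=` B.
    move=> [a b] Mab; have [H _] := iD a; have [|a' aE] := H; first by exists b.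
    exists a'%:P; rewrite !map_polyC !hornerC; congr pair => //.
    by apply: fun1 Mab _; rewrite aE.
  exists l; apply: (Mmax B MsubB); last by exists 'X; rewrite !map_polyX !hornerX.
  split.
  - by apply: MsubB.
  - by move=> _ _ [r ->] [r' ->]; exists (r - r'); rewrite !rmorphB !hornerD !hornerN.
  - by move=> _ _ [r ->] [r' ->]; exists (r * r'); rewrite !rmorphM !hornerM.
  - move=> _ _ [r [-> ->]]; split=> /eqP.
      by move=> /pdvd/dvdpP[h ->]; rewrite rmorphM hornerM (rootP pl) mulr0.
    by move=> /(pdvd' _ _ _ _ pl)/dvdpP[h ->]; rewrite rmorphM hornerM (rootP px) mulr0.
have [s0 s0M] : {s0 : Omega -> Omega & forall a, M (a, s0 a)}.
  exact: (@choice _ _ (fun a b => M (a, b))).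
have [s sE] : exists s : {rmorphism Omega -> Omega}, s =1 s0.
  apply: rmorphism_of_fun => [a b||a b].
  - by apply: fun1 (s0M _) _; apply: (MB (_, _) (_, _)).
  - by apply: fun1 (s0M _) _.
  - by apply: fun1 (s0M _) _; apply: (MM (_, _) (_, _)).
have sM a : M (a, s a) by rewrite sE.
exists s; split; last by move=> a b /GM Mab; exact: fun1 (sM a) Mab.
have surj y : exists x, s x = y.
  have [q [q0 qy qG]] := alg2 y.
  have [q' q'E] : {q' : nat -> Omega & forall j, s (q' j) = q`_j}.
    apply: (@choice _ _ (fun j a => s a = q`_j)) => j.
    by have [a Ga] := qG j; exists a; apply: fun1 (sM a) (GM _ Ga).
  pose qK := \poly_(j < size q) q' j.
  have qKE : map_poly s qK = q.
    apply/polyP => j; rewrite coef_map coef_poly; case: ltnP => [_|sj]; first exact: q'E.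
    by rewrite nth_default //; exact: rmorph0.
  (* The preimage polynomial splits in Omega, so every root of [q] is the image of one of its
     roots. *)
  have [r rE] := closed_field_poly_normal qK.
  have qK0 : lead_coef qK != 0.
    by rewrite lead_coef_eq0; apply: contra_neq q0 => qK0; rewrite -qKE qK0 rmorph0.
  move: qy; rewrite -qKE rE map_polyZ rootZ ?fmorph_eq0// map_prod_XsubC.
  rewrite -(big_map s xpredT (fun z => 'X - z%:P)) root_prod_XsubC => /mapP[z _ ->].
  by exists z.
have [g gK] := choice surj.
by exists g => // x; apply: (fmorph_inj s); rewrite gK.
Qed.

End ExtendAutomorphism.

Lemma rmorphism_inverse (L : closedFieldType) (s : {rmorphism L -> L}) : bijective s ->
  exists u : {rmorphism L -> L}, [/\ bijective u, forall x, s (u x) = x & forall x, u (s x) = x].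
Proof.
move=> [g gs sg]; have [h hE] : exists h : {rmorphism L -> L}, h =1 g.
  apply: rmorphism_of_fun => [x y||x y]; apply: (fmorph_inj s).
  + by rewrite rmorphB /= !sg.
  + by rewrite sg rmorph1.
  + by rewrite rmorphM /= !sg.
exists h; split => [|x|x]; [|by rewrite hE sg|by rewrite hE gs].
by exists s => x; rewrite hE ?gs ?sg.
Qed.

Lemma closed_field_uniq_seq (k : closedFieldType) n : exists2 s : seq k, uniq s & size s = n.
Proof.
elim: n => [|n [s us ss]]; first by exists [::].
suff [a as_] : exists a, a \notin s by exists (a :: s) => /=; rewrite ?as_ ?ss.
have [s0|s0] := eqVneq s [::]; first by exists 0; rewrite s0.
have /closed_rootP[a ra] : size (\prod_(z <- s) ('X - z%:P) + 1) != 1%N.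
  rewrite size_polyDl size_prod_XsubC ?size_poly1; last by case: (s) s0.
  by case: (s) s0.
exists a; apply/negP; rewrite -root_prod_XsubC => /rootP pa.
by move: ra; rewrite /root hornerD pa add0r hornerC oner_eq0.
Qed.

(** Serves to choose a such that sum_i a^i x_i separates finitely many automorphisms or residues:
    finitely many nonzero polynomials must not vanish at a, and k is infinite. *)
Lemma generic_scalar (k L : closedFieldType) (c : {rmorphism k -> L}) (ps : seq {poly L}) :
  (forall p, p \in ps -> p != 0) -> exists a : k, forall p, p \in ps -> p.[c a] != 0.
Proof.
move=> ps0; pose P := \prod_(p <- ps) p.
have P0 : P != 0.
  by rewrite prodf_seq_neq0; apply/allP => p /ps0.
have [s us ss] := closed_field_uniq_seq k (size P).
have [a nPa] : exists a : k, P.[c a] != 0.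
  apply: contrapT => no; move/eqP: P0; apply.
  apply: (@roots_geq_poly_eq0 _ P (map c s)).
  - apply/allP => _ /mapP[a _ ->]; apply: contrapT => na; apply: no.
    by exists a; apply: contra_notN na => /eqP/rootP.
  - by rewrite map_inj_uniq//; exact: fmorph_inj.
  - by rewrite size_map ss.
exists a => p pps; apply: contraNneq nPa => pa.
by rewrite horner_prod; apply/eqP/eqP; rewrite prodf_seq_eq0; apply/hasP; exists p; rewrite ?pa /=.
Qed.

(** * Compactness and Galois correspondence for closed groups with finite orbits *)

Section AutomorphismGroups.

Variable Omega : closedFieldType.
Implicit Types (G K : set {rmorphism Omega -> Omega}) (s t : {rmorphism Omega -> Omega}).

Definition finite_orbits G := forall x : Omega, exists l : seq Omega, forall s, G s -> s x \in l.

Definition fixed_by G : set Omega := [set x | forall s, G s -> s x = x].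

Section Orbits.

Variables (G : set {rmorphism Omega -> Omega}).
Hypotheses (G_group : subgroup G) (G_fin : finite_orbits G).

Lemma subgroup_id : G idfun. Proof. by case: G_group. Qed.
Lemma subgroup_comp s t : G s -> G t -> G (s \o t). Proof. by case: G_group => _ _ H _; apply: H. Qed.
Lemma subgroup_inv s : G s -> exists t, [/\ G t, forall x, s (t x) = x & forall x, t (s x) = x].
Proof.
case: G_group => _ _ _ H Gs; have [t Gt st] := H _ Gs; exists t; split => // x.
by apply: (fmorph_inj s); rewrite st.
Qed.

Lemma orbit_seq (x : Omega) : exists l : seq Omega, uniq l /\ forall z, (z \in l) <-> exists2 s, G s & z = s x.
Proof.
have [l lP] := G_fin x; exists (undup [seq z <- l | `[< exists2 s, G s & z = s x >] ]).
split=> [|z]; first exact: undup_uniq.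
rewrite mem_undup mem_filter; split; first by case/andP => /asboolP.
by move=> [s Gs ->]; apply/andP; split; [apply/asboolP; exists s|exact: lP].
Qed.

Lemma orbit_poly_fixed (l : seq Omega) x : uniq l ->
    (forall z, (z \in l) <-> exists2 s, G s & z = s x) ->
  forall s, G s -> perm_eq (map s l) l.
Proof.
move=> ul lP s Gs; have ms : uniq (map s l) by rewrite map_inj_uniq//; exact: fmorph_inj.
apply: uniq_perm => // z; apply/idP/idP => [/mapP[y /lP[t Gt ->] ->]|].
  by apply/lP; exists (s \o t) => //; exact: subgroup_comp.
have [t [Gt st ts]] := subgroup_inv Gs.
move=> /lP[u Gu ->]; apply/mapP; exists (t (u x)); rewrite ?st//.
by apply/lP; exists (t \o u) => //; exact: subgroup_comp.
Qed.

Lemma orbit_vectors (S : seq Omega) : exists T : seq (seq Omega),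
  uniq T /\ forall v, (v \in T) <-> exists2 s, G s & v = map s S.
Proof.
have [T TP] : exists T : seq (seq Omega), forall s, G s -> map s S \in T.
  elim: S => [|x S [T TP]]; first by exists [:: [::] ] => s _; rewrite mem_head.
  have [l lP] := G_fin x; exists [seq y :: v | y <- l, v <- T] => s Gs.
  by apply/allpairsP; exists (s x, map s S); split; [exact: lP|exact: TP|].
exists (undup [seq v <- T | `[< exists2 s, G s & v = map s S >] ]).
split=> [|v]; first exact: undup_uniq.
rewrite mem_undup mem_filter; split; first by case/andP => /asboolP.
by move=> [s Gs ->]; apply/andP; split; [apply/asboolP; exists s|exact: TP].
Qed.

Lemma eq_map_agree (S : seq Omega) s t : map s S = map t S <-> agree_on S s t.
Proof.
split; last by move=> st; apply/eq_in_map.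
by move=> /eq_in_map.
Qed.

Section Compactness.

Hypothesis G_closed : krull_closed G.

Lemma ultra_pigeonhole (U : set_system (seq Omega)) (l : seq Omega) (P : Omega -> set (seq Omega)) :
  UltraFilter U -> U [set S | exists2 y, y \in l & P y S] -> exists2 y, y \in l & U (P y).
Proof.
move=> UU; elim: l => [|y l IH] H.
  by have [S [z]] : [set S | exists2 y, y \in [::] & P y S] !=set0 by exact: filter_ex H.
have [Uy|Uny] := in_ultra_setVsetC (P y) UU; first by exists y; rewrite ?mem_head.
have [|z zl Uz] := IH.
  apply: filterS (filterI H Uny) => S [[z]]; rewrite inE => /orP[/eqP-> //|zl Pz _].
  by exists z.
by exists z => //; rewrite inE zl orbT.
Qed.

(** Along an ultrafilter containing all families of large finite sets, the approximate solutions
    [f S] have a limit at each x because orbits are finite. The limit is a ring morphism, is onto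
    because the preimages of y also range over a finite orbit, and lies in G because G is closed. *)
Theorem compactness (R : Omega -> Omega -> Prop) :
    (forall S : seq Omega, exists2 s, G s & forall x, x \in S -> R x (s x)) ->
  exists2 s, G s & forall x, R x (s x).
Proof.
move=> H; have [f fP] : {f : seq Omega -> {rmorphism Omega -> Omega} &
    forall S, G (f S) /\ forall x, x \in S -> R x (f S x)}.
  apply: (@choice _ _ (fun S s => G s /\ forall x, x \in S -> R x (s x))) => S.
  by have [s] := H S; exists s.
pose F : set_system (seq Omega) := [set A | exists S0 : seq Omega, forall S : seq Omega, {subset S0 <= S} -> A S].
have FF : ProperFilter F.
  split.
    by move=> [S0 S0P]; exact: (S0P S0).
  split.
  - by exists [::].
  - move=> A B [S SA] [T TB]; exists (S ++ T) => X X1; split.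
      by apply: SA => x xS; apply: X1; rewrite mem_cat xS.
    by apply: TB => x xS; apply: X1; rewrite mem_cat xS orbT.
  - by move=> A B AB [S SA]; exists S => X /SA/AB.
have [U [UU FU]] := ultraFilterLemma FF.
have lim x : exists y, U [set S | f S x = y].
  have [l lP] := G_fin x.
  have [|y _ Uy] := @ultra_pigeonhole U l (fun y => [set S | f S x = y]) UU; last by exists y.
  by apply: filterS filterT => S _; exists (f S x) => //; apply: lP; have [] := fP S.
have [g gU] := choice lim.
have [s sE] : exists s : {rmorphism Omega -> Omega}, s =1 g.
  apply: rmorphism_of_fun => [x y||x y].
  - have [S [[S1 S2] S3]] := filter_ex (filterI (filterI (gU x) (gU y)) (gU (x - y))).
    by rewrite -S1 -S2 -S3 rmorphB.
  - by have [S S1] := filter_ex (gU 1); rewrite -S1 rmorph1.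
  - have [S [[S1 S2] S3]] := filter_ex (filterI (filterI (gU x) (gU y)) (gU (x * y))).
    by rewrite -S1 -S2 -S3 rmorphM.
have agree T : U [set S | agree_on T (f S) s].
  elim: T => [|x T IH]; first by apply: filterS filterT => S _ x.
  apply: filterS (filterI (gU x) IH) => S [S1 S2] y; rewrite inE => /orP[/eqP->|/S2//].
  by rewrite sE.
have surj y : exists x, s x = y.
  have [l lP] := G_fin y.
  have [|x _ Ux] := @ultra_pigeonhole U l (fun x => [set S | f S x = y]) UU.
    apply: filterS filterT => S _; have [GS _] := fP S.
    by have [t [Gt st ts]] := subgroup_inv GS; exists (t y); [exact: lP|exact: st].
  have [S [S1 S2]] := filter_ex (filterI Ux (gU x)); exists x.
  by rewrite sE -S2 S1.
have s_bij : bijective s.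
  have [h hs] := choice surj; exists h => // x; by apply: (fmorph_inj s); rewrite hs.
exists s => [|x].
  apply: G_closed => // T; have [S ST] := filter_ex (agree T).
  by exists (f S); [have [] := fP S|move=> x xT; rewrite ST].
have Ux : U [set S | x \in S] by apply: FU; exists [:: x] => S; apply; rewrite mem_head.
have [S [xS S1]] := filter_ex (filterI Ux (gU x)).
by rewrite sE -S1; have [_] := fP S; apply.
Qed.

End Compactness.

Variables (k : closedFieldType) (c : {rmorphism k -> Omega}).
Hypothesis G_const : forall s a, G s -> s (c a) = c a.

(** For a generic combination y of the elements of S, the orbit polynomial of y has coefficients
    fixed by G, hence by s. So s y = g y for some g in G, and genericity forces s and g to agree on
    S. No separability enters. *)
Theorem fixed_by_closed_subgroup s : krull_closed G -> bijective s -> (forall a, s (c a) = c a) ->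
  (forall x, fixed_by G x -> s x = x) -> G s.
Proof.
move=> G_closed sb sc sfix; apply: G_closed => // S.
have [T [_ TP]] := orbit_vectors S.
(* The value of [pol (map g S)] at [c a] is s y - g y. *)
pose pol (w : seq Omega) : {poly Omega} := \poly_(i < size S) (s S`_i - w`_i).
have [a aP] := @generic_scalar k Omega c [seq pol w | w <- [seq w <- T | pol w != 0] ]
  ltac:(by move=> p /mapP[w]; rewrite mem_filter => /andP[? _] ->).
pose y := \sum_(i < size S) c a ^+ i * S`_i.
have ty (t : {rmorphism Omega -> Omega}) : (forall b, t (c b) = c b) ->
    t y = \sum_(i < size S) c a ^+ i * t S`_i.
  by move=> tc; rewrite rmorph_sum; apply: eq_bigr => i _; rewrite rmorphM rmorphXn /= tc.
have [l [ul lP]] := orbit_seq y.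
pose P := \prod_(z <- l) ('X - z%:P).
have Pfix g : G g -> map_poly g P = P.
  move=> Gg; rewrite map_prod_XsubC -(big_map g xpredT (fun z => 'X - z%:P)).
  by apply: perm_big; exact: (orbit_poly_fixed ul lP).
have sP : map_poly s P = P.
  by apply/polyP => i; rewrite coef_map /= sfix// => g Gg; rewrite -coef_map Pfix.
have yl : y \in l by apply/lP; exists idfun => //; exact: subgroup_id.
have : s y \in l.
  rewrite -root_prod_XsubC -/P -sP map_prod_XsubC.
  by rewrite -(big_map s xpredT (fun z => 'X - z%:P)) root_prod_XsubC map_f.
move=> /lP[g Gg sg]; exists g => //.
have wT : map g S \in T by apply/TP; exists g.
have pw : pol (map g S) = 0.
  apply: contrapT => /eqP p0.
  have := aP (pol (map g S)); rewrite map_f ?mem_filter ?p0// => /(_ isT)/eqP; apply.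
  rewrite horner_poly -[RHS](subrr (s y)) {2}sg !ty//; last by move=> b; apply: G_const.
  rewrite -sumrB; apply: eq_bigr => i _.
  by rewrite (nth_map 0)// mulrBl ![_ * c a ^+ i]mulrC.
move=> x xS; have := congr1 (fun p : {poly Omega} => p`_(index x S)) pw.
rewrite coef_poly index_mem xS coef0 (nth_map 0) ?index_mem// nth_index// => /eqP.
by rewrite subr_eq0 => /eqP.
Qed.

End Orbits.

End AutomorphismGroups.

(** * Places of a function field of one variable *)

Section ValuationRings.

Variable Omega : closedFieldType.
Variables (O : set Omega) (O_val : valuation_ring O).
Local Notation m := (max_ideal O).

Lemma valuation_ring_subring : subring_set O.
Proof. by case: O_val. Qed.
Let Or := valuation_ring_subring.

Lemma valuation_ring_total x : O x \/ O x^-1. Proof. by case: O_val. Qed.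

Lemma max_ideal_sub x : m x -> O x. Proof. by case. Qed.

Lemma max_ideal0 : m 0. Proof. by split; [exact: subring0|left]. Qed.

Lemma max_ideal1 : ~ m 1.
Proof. by move=> [_ []]; [move/eqP; rewrite oner_eq0|rewrite invr1 => /(_ (subring1 Or))]. Qed.

Lemma max_idealMl x y : O x -> m y -> m (x * y).
Proof.
move=> Ox [Oy Hy]; split; first exact: subringM.
have [xy0|xy0] := eqVneq (x * y) 0; [by left|right => Oxy].
have [x0 y0] : x != 0 /\ y != 0 by apply/andP; move: xy0; rewrite mulf_eq0 negb_or.
case: Hy => [|Hy]; first by apply/eqP.
by apply: Hy; rewrite -(mulfK x0 y^-1) mulrAC -invfM mulrC; apply: subringM; rewrite // mulrC.
Qed.

Lemma max_idealMr x y : m x -> O y -> m (x * y).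
Proof. by rewrite mulrC => mx Oy; exact: max_idealMl. Qed.

Lemma max_idealV x : x != 0 -> ~ O x -> m x^-1.
Proof.
move=> x0 nx; split; last by right; rewrite invrK.
by case: (valuation_ring_total x).
Qed.

Lemma max_idealD x y : m x -> m y -> m (x + y).
Proof.
move=> mx my; have [->|x0] := eqVneq x 0; first by rewrite add0r.
have [->|y0] := eqVneq y 0; first by rewrite addr0.
wlog xy : x y mx my x0 y0 / O (x / y) => [H|].
  have [xy|xy] := valuation_ring_total (x / y); first exact: H.
  by rewrite addrC; apply: H => //; rewrite invfM invrK mulrC in xy.
rewrite -[X in X + _](divfK y0) -[X in _ + X]mul1r -mulrDl; apply: max_idealMl => //.
by apply: subringD => //; exact: subring1.
Qed.

Lemma max_idealN x : m x -> m (- x).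
Proof. by move=> mx; rewrite -mulN1r; apply: max_idealMl => //; apply: subringN => //; exact: subring1. Qed.

Lemma max_idealB x y : m x -> m y -> m (x - y).
Proof. by move=> mx my; apply: max_idealD => //; exact: max_idealN. Qed.

Lemma valuation_unit x : O x -> ~ m x -> x != 0 /\ O x^-1.
Proof.
move=> Ox nm; have x0 : x != 0 by apply/eqP => x0; apply: nm; rewrite x0; exact: max_ideal0.
by split => //; apply: contrapT => nV; apply: nm; split => //; right.
Qed.

Lemma max_ideal_unit x : O x^-1 -> x != 0 -> ~ m x.
Proof. by move=> Ox x0 [_ []] // => /eqP; apply/negP. Qed.

Lemma max_ideal_prime x y : O x -> O y -> m (x * y) -> m x \/ m y.
Proof.
move=> Ox Oy mxy; have [?|nx] := pselect (m x); [by left|right].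
by have [x0 Ox'] := valuation_unit Ox nx; rewrite -(mulKf x0 y); apply: max_idealMl.
Qed.

Lemma max_ideal_sum (T : eqType) (r : seq T) (F : T -> Omega) :
  (forall i, i \in r -> m (F i)) -> m (\sum_(i <- r) F i).
Proof.
elim: r => [|i r IH] H; first by rewrite big_nil; exact: max_ideal0.
rewrite big_cons; apply: max_idealD; first by apply: H; rewrite mem_head.
by apply: IH => j jr; apply: H; rewrite inE jr orbT.
Qed.

Lemma max_ideal_prod_prime (T : eqType) (r : seq T) (F : T -> Omega) :
  (forall i, i \in r -> O (F i)) -> m (\prod_(i <- r) F i) -> exists2 i, i \in r & m (F i).
Proof.
elim: r => [|i r IH] H; first by rewrite big_nil => /max_ideal1.
have Or' j : j \in r -> O (F j) by move=> jr; apply: H; rewrite inE jr orbT.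
rewrite big_cons => mp.
have [||mi|/(IH Or')[j jr mj]] := max_ideal_prime _ _ mp.
- by apply: H; rewrite mem_head.
- exact: subring_prod.
- by exists i; rewrite ?mem_head.
- by exists j; rewrite ?inE ?jr ?orbT.
Qed.

(** If w is not in O then its inverse is; divide the equation by the power of w just below the
    leading one. *)
Lemma valuation_lead_coef (p : {poly Omega}) w : (forall i, O p`_i) ->
  p != 0 -> root p w -> O (lead_coef p * w).
Proof.
move=> Op p0 pw; have [Ow|nw] := pselect (O w); first by apply: subringM => //; rewrite lead_coefE.
have Ow : O w^-1 by case: (valuation_ring_total w).
have w0 : w != 0 by apply: contra_notN nw => /eqP->; exact: subring0.
suff -> : lead_coef p * w = - \sum_(i < (size p).-1) p`_i * w^-1 ^+ ((size p).-2 - i).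
  apply: subringN => //; apply: subring_sum => // i _; apply: subringM => //; exact: subringX.
have l0 : lead_coef p != 0 by rewrite lead_coef_eq0.
have [n sp] : exists n, size p = n.+1.
  by case: (size p) (size_poly_eq0 p) => [|n _]; [rewrite (negPf p0)|exists n].
move: pw; rewrite /root horner_coef sp big_ord_recr /= addr_eq0 => /eqP pw.
have ln : p`_n = lead_coef p by rewrite lead_coefE sp.
case: n sp ln pw => [|n] sp ln pw.
  by move: pw; rewrite big_ord0 ln expr0 mulr1 => /esym/eqP; rewrite oppr_eq0 (negPf l0).
rewrite -ln; apply: (mulIf (expf_neq0 n w0)); rewrite mulNr -mulrA -exprS -[LHS]opprK -pw; congr (- _).
rewrite mulr_suml; apply: eq_bigr => i _ /=; rewrite -mulrA; congr (_ * _).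
have le : (i <= n)%N by rewrite -ltnS.
have -> : w ^+ n = w ^+ (n - i) * w ^+ i by rewrite -exprD subnK.
by rewrite exprVn mulrA mulVf ?mul1r// expf_neq0.
Qed.

Lemma valuation_integral (p : {poly Omega}) w : (forall i, O p`_i) -> O (lead_coef p)^-1 ->
  p != 0 -> root p w -> O w.
Proof.
move=> Op Ol p0 pw; have l0 : lead_coef p != 0 by rewrite lead_coef_eq0.
by rewrite -(mulKf l0 w); apply: subringM => //; apply: valuation_lead_coef.
Qed.

Lemma valuation_ring_preimage (s : {rmorphism Omega -> Omega}) :
  valuation_ring [set x | O (s x)].
Proof.
split => /=; first by rewrite rmorph1; exact: subring1.
- by move=> x y Ox Oy; rewrite rmorphB; exact: subringB.
- by move=> x y Ox Oy; rewrite rmorphM; exact: subringM.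
- by move=> x; rewrite fmorphV; exact: valuation_ring_total.
Qed.

Lemma max_ideal_preimage (s : {rmorphism Omega -> Omega}) x :
  max_ideal [set x | O (s x)] x <-> m (s x).
Proof.
rewrite /max_ideal /= fmorphV; split => -[Ox [x0|nx]]; split => //; [left|right|left|right] => //.
  by rewrite x0 rmorph0.
by apply/eqP; rewrite -(fmorph_eq0 s) x0.
Qed.

End ValuationRings.

(** * Transcendence bases with one element *)

Section Coordinates.

Variables (k Omega : closedFieldType) (c : {rmorphism k -> Omega}).
Implicit Types (t x y : Omega) (P : {poly k}) (Q : {poly {poly k}}).

Definition polyval t := horner_eval t \o map_poly c.
HB.instance Definition _ t := GRing.RMorphism.on (polyval t).

Lemma polyvalX t : polyval t 'X = t.
Proof. by rewrite /polyval /= /horner_eval map_polyX hornerX. Qed.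

Lemma polyvalC t a : polyval t a%:P = c a.
Proof. by rewrite /polyval /= /horner_eval map_polyC hornerC. Qed.

Lemma polyvalE t P : polyval t P = \sum_(i < size P) c P`_i * t ^+ i.
Proof.
rewrite /polyval /= /horner_eval horner_coef size_map_poly.
by apply: eq_bigr => i _; rewrite coef_map.
Qed.

Lemma polyval_wide t P n : (size P <= n)%N -> polyval t P = \sum_(i < n) c P`_i * t ^+ i.
Proof.
move=> sn; rewrite /polyval /= /horner_eval (@horner_coef_wide _ n) ?size_map_poly//.
by apply: eq_bigr => i _; rewrite coef_map.
Qed.

(** [t] is a transcendence basis of Omega over the constants. The notion is kept apart from [iota]
    because it is applied to t, to its inverse and to its roots. *)
Definition coordinate t :=
  (forall P, polyval t P = 0 -> P = 0) /\
  (forall x, exists2 Q : {poly {poly k}}, Q != 0 & root (map_poly (polyval t) Q) x).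

Section CoordinateTheory.

Variables (t : Omega) (t_coord : coordinate t).

Lemma coordinate_transcendental a : t != c a.
Proof.
apply/eqP => ta; have := t_coord.1 ('X - a%:P); rewrite rmorphB /= polyvalX polyvalC ta subrr.
by move=> /(_ erefl)/eqP; rewrite polyXsubC_eq0.
Qed.

Lemma coordinate_neq0 : t != 0.
Proof. by rewrite -(rmorph0 c); exact: coordinate_transcendental. Qed.

(** The reversed polynomial X^n P(1/X). *)
Definition revpoly n P := \poly_(i < n.+1) P`_(n - i).

Lemma polyval_rev n P u : u != 0 -> (size P <= n.+1)%N ->
  polyval u (revpoly n P) = u ^+ n * polyval u^-1 P.
Proof.
move=> u0 sP; rewrite (polyval_wide _ sP) (@polyval_wide _ _ n.+1) ?size_poly//.
rewrite (reindex_inj rev_ord_inj) /= mulr_sumr; apply: eq_bigr => i _.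
have le : (i <= n)%N by rewrite -ltnS.
rewrite subSS coef_poly ltnS leq_subr subKn// mulrCA; congr (_ * _).
by rewrite exprVn -exprB ?unitfE.
Qed.

Lemma revpoly_eq0 n P : (size P <= n.+1)%N -> revpoly n P = 0 -> P = 0.
Proof.
move=> sP r0; apply/polyP => i; rewrite coef0; case: (leqP i n) => ni; last first.
  by rewrite nth_default// (leq_trans sP).
by have := congr1 (fun p : {poly k} => p`_(n - i)) r0; rewrite coef_poly ltnS leq_subr subKn// coef0.
Qed.

Lemma coordinateV : coordinate t^-1.
Proof.
have t0 := coordinate_neq0; split.
  move=> P P0; apply: (@revpoly_eq0 (size P)); first exact: leqnSn.
  by apply: t_coord.1; rewrite polyval_rev// P0 mulr0.
move=> x; have [Q Q0 Qx] := t_coord.2 x.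
pose d := \max_(i < size Q) size (Q`_i)%R.
have dP i : (size (Q`_i)%R <= d.+1)%N.
  apply: leqW; case: (ltnP i (size Q)) => iQ; last by rewrite nth_default// size_poly0.
  exact: (leq_bigmax (Ordinal iQ)).
pose Q' := \poly_(i < size Q) revpoly d Q`_i.
exists Q'.
  apply: contra_neq Q0 => Q'0; apply/polyP => i; rewrite coef0.
  case: (ltnP i (size Q)) => iQ; last by rewrite nth_default.
  apply: (revpoly_eq0 (dP i)); have := congr1 (fun q : {poly {poly k}} => q`_i) Q'0.
  by rewrite coef_poly iQ coef0.
rewrite /root (@horner_coef_wide _ (size Q)); last first.
  by apply: leq_trans (size_poly _ _) (size_poly _ _).
apply/eqP; transitivity (t^-1 ^+ d * (map_poly (polyval t) Q).[x]); last by rewrite (rootP Qx) mulr0.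
rewrite (@horner_coef_wide _ (size Q)) ?size_poly// mulr_sumr; apply: eq_bigr => i _.
by rewrite !coef_map /= coef_poly ltn_ord polyval_rev ?invr_eq0// invrK mulrA.
Qed.

(** Divide a relation by t - b as long as all its coefficients vanish at b; the size of one nonzero
    coefficient decreases each time. *)
Lemma local_relation b x : exists2 Q : {poly {poly k}}, root (map_poly (polyval t) Q) x & exists j, (Q`_j).[b] != 0.
Proof.
have [Q Q0 Qx] := t_coord.2 x.
have [j Qj] : exists j, Q`_j != 0.
  exists (size Q).-1; by rewrite -lead_coefE lead_coef_eq0.
have [n sn] := ubnP (size (Q`_j)%R).
elim: n => // n IH in Q Q0 Qx Qj sn *.
have [[i Qi]|all0] := pselect (exists i, (Q`_i).[b] != 0); first by exists Q => //; exists i.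
have dvd i : Q`_i = Q`_i %/ ('X - b%:P) * ('X - b%:P).
  rewrite divpK// dvdp_XsubCl; apply: contrapT => /negP nr; apply: all0; exists i.
  exact: nr.
pose Q' := \poly_(i < size Q) (Q`_i %/ ('X - b%:P)).
have Q'E i : Q'`_i = Q`_i %/ ('X - b%:P).
  by rewrite coef_poly; case: ltnP => // iQ; rewrite nth_default ?div0p.
have Q'j : Q'`_j != 0 by rewrite Q'E; apply: contra_neq Qj => q0; rewrite dvd q0 mul0r.
apply: (IH Q') => //.
- by apply: contra_neq Q'j => ->; rewrite coef0.
- have e : map_poly (polyval t) Q = (t - c b)%:P * map_poly (polyval t) Q'.
    apply/polyP => i; rewrite coefCM !coef_map /= Q'E {1}dvd rmorphM /= mulrC.
    by rewrite rmorphB /= polyvalX polyvalC.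
  by move: Qx; rewrite e rootM rootC subr_eq0 (negPf (coordinate_transcendental b)).
- rewrite Q'E; move: sn; rewrite {1}dvd size_mul ?polyXsubC_eq0 -?Q'E// size_XsubC.
  by rewrite addn2.
Qed.

End CoordinateTheory.

Lemma coordinate_root t u n : (0 < n)%N -> u ^+ n = t -> coordinate t -> coordinate u.
Proof.
move=> n0 ut tc; have uc a : u != c a.
  by apply/eqP => ua; have := coordinate_transcendental tc (a ^+ n); rewrite rmorphXn /= -ua ut eqxx.
have polyX P : polyval u (P \Po 'X^n) = polyval t P.
  rewrite /polyval /= /horner_eval map_comp_poly horner_comp map_polyXn hornerXn ut//.
split.
  move=> P; have [r ->] := closed_field_poly_normal P; rewrite -mul_polyC rmorphM rmorph_prod /=.
  rewrite polyvalC => /eqP; rewrite mulf_eq0 fmorph_eq0 => /orP[/eqP->|]; first by rewrite mul0r.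
  rewrite prodf_seq_eq0 => /hasP[z _]; rewrite rmorphB /= polyvalX polyvalC subr_eq0.
  by rewrite (negPf (uc z)).
move=> x; have [Q Q0 Qx] := tc.2 x.
exists (map_poly (comp_poly 'X^n) Q).
  apply: contra_neq Q0 => Q0; apply/polyP => i; rewrite coef0.
  apply: tc.1; rewrite -polyX; have := congr1 (fun q : {poly {poly k}} => q`_i) Q0.
  by rewrite coef_map /= coef0 => ->; rewrite rmorph0.
rewrite -map_poly_comp_id0 ?rmorph0//.
by rewrite (eq_map_poly (g := polyval t))// => P; rewrite /= polyX.
Qed.

End Coordinates.

(** * Places, their centers and the integral closure of k[t] *)

Section Places.

Variables (k Omega : closedFieldType) (c : {rmorphism k -> Omega}).
Implicit Types (t x y : Omega) (O : set Omega).

(** The trivial valuation ring is allowed; a nontrivial place is one that misses some element. *)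
Definition place O := valuation_ring O /\ forall a, O (c a).

Lemma place_ring O : place O -> subring_set O.
Proof. by move=> [/valuation_ring_subring]. Qed.

Lemma place_const_unit O a : place O -> max_ideal O (c a) -> a = 0.
Proof.
move=> [_ Oc] ma; apply/eqP; apply: contraT => a0; exfalso.
by apply: max_ideal_unit ma; rewrite -?fmorphV// fmorph_eq0.
Qed.

Lemma place_polyval O t P : place O -> O t -> O (polyval c t P).
Proof.
move=> OP Ot; rewrite polyvalE; apply: subring_sum => [|i _]; first exact: place_ring.
by apply: subringM; [exact: place_ring|exact: OP.2|apply: subringX => //; exact: place_ring].
Qed.

Lemma place_polyval_congr O t b P : place O -> O t -> max_ideal O (t - c b) ->
  max_ideal O (polyval c t P - c P.[b]).
Proof.
move=> OP Ot mt; have : root (P - P.[b]%:P) b by rewrite /root hornerD hornerN hornerC subrr.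
move=> /factor_theorem[R /(congr1 (polyval c t))]; rewrite rmorphM !rmorphB /= polyvalX !polyvalC => ->.
by apply: max_idealMl => //; [exact: OP.1|exact: place_polyval].
Qed.

Lemma place_preimage O (s : {rmorphism Omega -> Omega}) :
  place O -> (forall a, s (c a) = c a) -> place [set x | O (s x)].
Proof.
by move=> [Ov Oc] sc; split; [exact: valuation_ring_preimage|move=> a; rewrite /= sc].
Qed.

Section AtCoordinate.

Variables (t : Omega) (t_coord : coordinate c t).

(** Otherwise every t - z is a unit of O, hence so is every nonzero polynomial in t, and every
    element of Omega, being algebraic over k(t), would be integral over O. *)
Lemma place_center O : place O -> O t -> (exists x, ~ O x) -> exists b, max_ideal O (t - c b).
Proof.
move=> OP Ot [x nx]; apply: contrapT => nob.
have [Ov Oc] := OP; have Or := place_ring OP.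
have Ounit (z : k) : O (t - c z)^-1.
  have Otz : O (t - c z) by apply: subringB.
  by apply: (valuation_unit Ov Otz _).2 => mz; apply: nob; exists z.
have Vunit P : P != 0 -> O (polyval c t P)^-1.
  have [r ->] := closed_field_poly_normal P => P0.
  rewrite -mul_polyC rmorphM rmorph_prod /= polyvalC invfM -fmorphV; apply: subringM => //.
  rewrite -prodfV; apply: subring_prod => // z _; rewrite rmorphB /= polyvalX polyvalC.
  exact: Ounit.
have [Q Q0 Qx] := t_coord.2 x.
have mQ0 : map_poly (polyval c t) Q != 0.
  apply: contra_neq Q0 => mQ0; apply/polyP => i; rewrite coef0; apply: t_coord.1.
  by rewrite -coef_map mQ0 coef0.
have lcE : lead_coef (map_poly (polyval c t) Q) = polyval c t (lead_coef Q).
  rewrite lead_coef_map_eq//; apply: contra_neq Q0 => l0; apply/eqP.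
  by rewrite -lead_coef_eq0; apply/eqP; apply: t_coord.1.
apply: nx; apply: (valuation_integral Ov (p := map_poly (polyval c t) Q)) => //.
  by move=> i; rewrite coef_map; apply: place_polyval.
by rewrite lcE; apply: Vunit; rewrite lead_coef_eq0.
Qed.

(** A relation for x that survives at t = b reduces to a nonzero polynomial over k; it splits, and
    one of its linear factors at x lies in the maximal ideal. *)
Lemma place_residue O b x : place O -> O t -> max_ideal O (t - c b) -> O x ->
  exists a, max_ideal O (x - c a).
Proof.
move=> OP Ot mt Ox; have [Ov Oc] := OP; have Or := place_ring OP.
have [Q Qx [j Qj]] := local_relation t_coord b x.
pose q := map_poly (horner_eval b) Q.
have q0 : q != 0.
  by apply: contra_neq Qj => q0; have := congr1 (fun p : {poly k} => p`_j) q0; rewrite coef_map coef0.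
have mq : max_ideal O (polyval c x q).
  rewrite (@polyval_wide _ _ _ _ _ (size Q)) ?size_poly//.
  have := subr0 (\sum_(i < size Q) c q`_i * x ^+ i); rewrite -[X in _ - X](rootP Qx) => <-.
  rewrite (@horner_coef_wide _ (size Q)) ?size_poly// -sumrB; apply: max_ideal_sum => // i _; rewrite !coef_map /= -mulrBl.
  apply: max_idealMr => //; last exact: subringX.
  by rewrite -opprB; apply: max_idealN => //; apply: place_polyval_congr.
have [r rE] := closed_field_poly_normal q.
move: mq; rewrite rE -mul_polyC rmorphM rmorph_prod /= polyvalC => mq.
have Oxz z : O (polyval c x ('X - z%:P)) by apply: place_polyval.
have [||mz|mp] := max_ideal_prime Ov _ _ mq => //.
- by apply: subring_prod.
- by have /eqP := place_const_unit OP mz; rewrite lead_coef_eq0 (negPf q0).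
have [|z _] := max_ideal_prod_prime Ov _ mp => //.
by rewrite rmorphB /= polyvalX polyvalC; exists z.
Qed.

(** The integral closure of k[t] in Omega, described as an intersection of valuation rings. *)
Definition coordinate_ring : set Omega := [set x | forall O, place O -> O t -> O x].

Local Notation B := coordinate_ring.

Lemma coordinate_ring_subring : subring_set B.
Proof.
split => [O OP _|x y Bx By O OP Ot|x y Bx By O OP Ot]; first exact: subring1 (place_ring OP).
  by apply: subringB; [exact: place_ring|exact: Bx|exact: By].
by apply: subringM; [exact: place_ring|exact: Bx|exact: By].
Qed.

Lemma coordinate_ring_polyval P : B (polyval c t P).
Proof. by move=> O OP Ot; exact: place_polyval. Qed.

Lemma coordinate_ring_const a : B (c a).
Proof. by move=> O [_ Oc] _. Qed.

Lemma coordinate_ring_gen : B t.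
Proof. by move=> O. Qed.

Lemma coordinate_ring_aut (s : {rmorphism Omega -> Omega}) x :
  (forall a, s (c a) = c a) -> s t = t -> B x -> B (s x).
Proof.
move=> sc st Bx O OP Ot; apply: (Bx [set x | O (s x)]); first exact: place_preimage.
by rewrite /= st.
Qed.

(* The fraction field property of the integral closure [B], local at [t = b]. *)
Lemma coordinate_ring_fraction O b x : place O -> O t -> max_ideal O (t - c b) ->
  exists be, [/\ B be, B (be * x) & O x -> ~ max_ideal O be].
Proof.
move=> OP Ot mt; have [Ov Oc] := OP; have Or := place_ring OP.
have [->|x0] := eqVneq x 0.
  exists 1; split; [exact: subring1 coordinate_ring_subring| |by move=> _; exact: max_ideal1].
  by rewrite mulr0; exact: subring0 coordinate_ring_subring.
have [Q Qx [j0 Qj0]] := local_relation t_coord b x.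
have ex : exists j, (Q`_j).[b] != 0 by exists j0.
have ub j : (Q`_j).[b] != 0 -> (j <= size Q)%N.
  by rewrite leqNgt; apply: contraNN => /ltnW sj; rewrite nth_default// horner0.
(* [j] is the last index whose coefficient does not vanish at b. The upper part of the relation,
   from [j] on, divided by x^j gives [be]; minus the lower part gives [be * x]. When x is in O, [be]
   is congruent to a_j, a unit. *)
case: (ex_maxnP ex ub) => j Qj jmax {ex ub j0 Qj0}.
pose a i := polyval c t Q`_i.
pose n := (size Q - j)%N.
have jQ : (j < size Q)%N.
  by rewrite ltnNge; apply: contraNN Qj => sj; rewrite nth_default// horner0.
pose be := \sum_(i < n) a (j + i)%N * x ^+ i.
have beE : be * x = - \sum_(i < j) a i * x^-1 ^+ (j - i.+1) * 1.
  apply: (mulIf (expf_neq0 j x0)); rewrite mulNr.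
  have := rootP Qx; rewrite (@horner_coef_wide _ (size Q)) ?size_poly//.
  rewrite -(subnKC (ltnW jQ)) -/n big_split_ord /= => /eqP.
  rewrite addrC addr_eq0 => /eqP H; rewrite mulrAC -[LHS](_ : (\sum_(i < n) (map_poly (polyval c t) Q)`_(j + i) * x ^+ (j + i)) * x = _).
    rewrite H mulNr !mulr_suml; congr (- _); apply: eq_bigr => i _.
    rewrite coef_map /= -/(a i) mulr1 -!mulrA; congr (_ * _).
    have -> : x ^+ j = x ^+ (j - i.+1) * x ^+ i.+1 by rewrite -exprD subnK.
    by rewrite exprVn mulrA mulVf ?mul1r ?expf_neq0// -exprSr.
  congr (_ * _); rewrite mulr_suml; apply: eq_bigr => i _.
  by rewrite coef_map /= -mulrA -exprD addnC.
have Oa O' i : place O' -> O' t -> O' (a i) by move=> *; apply: place_polyval.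
have key O' : place O' -> O' t -> O' be /\ O' (be * x).
  move=> OP' Ot'; have Or' := place_ring OP'.
  have [O'x|O'x] := valuation_ring_total OP'.1 x.
    have Ob : O' be.
      by apply: subring_sum => // i _; apply: subringM => //; [exact: Oa|exact: subringX].
    by split => //; apply: subringM.
  have Ob : O' (be * x).
    rewrite beE; apply: subringN => //; apply: subring_sum => // i _.
    apply: subringM => //; last exact: subring1.
    by apply: subringM => //; [exact: Oa|exact: subringX].
  by split => //; rewrite -(mulfK x0 be); apply: subringM.
exists be; split; [by move=> O' h1 h2; case: (key O' h1 h2)|by move=> O' h1 h2; case: (key O' h1 h2)|].
move=> Ox; have maj i : (j < i)%N -> max_ideal O (a i).
  move=> ji; have := place_polyval_congr Q`_i OP Ot mt.
  have -> : (Q`_i).[b] = 0.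
    by apply/eqP; apply: contraT => /jmax; rewrite leqNgt ji.
  by rewrite rmorph0 subr0.
have [n' nE] : exists n', n = n'.+1 by exists n.-1; rewrite prednK// subn_gt0.
rewrite /be nE big_ord_recl /= addn0 expr0 mulr1 => mbe.
have : max_ideal O (a j).
  rewrite -[a j](addrK (\sum_(i < n') a (j + bump 0 i)%N * x ^+ bump 0 i)).
  apply: max_idealB => //; apply: max_ideal_sum => // i _.
  apply: max_idealMr => //; last exact: subringX.
  by apply: maj; rewrite /bump /= add1n addnS ltnS leq_addr.
move=> maj'; have : max_ideal O (c (Q`_j).[b]).
  rewrite -[X in max_ideal O X](subKr (a j)); apply: max_idealB => //.
  exact: place_polyval_congr.
by move=> /(place_const_unit OP)/eqP; rewrite (negPf Qj).
Qed.

(** For x in O write x = (be x) / be with be outside m, hence outside m': so O lies in O'.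
    Conversely let a be the residue of x at O'. If x - a were not in O, its inverse would be in O,
    hence in O', although x - a lies in m'. *)
Lemma place_eq O O' b b' : place O -> O t -> max_ideal O (t - c b) ->
    place O' -> O' t -> max_ideal O' (t - c b') ->
  (forall y, B y -> max_ideal O' y -> max_ideal O y) -> forall x, O x <-> O' x.
Proof.
move=> OP Ot mt OP' Ot' mt' H.
have OO' x : O x -> O' x.
  move=> Ox; have [be [Bb Bbx /(_ Ox) nm]] := coordinate_ring_fraction x OP Ot mt.
  have nm' : ~ max_ideal O' be by move=> /(H _ Bb).
  have [b0 Vb] := valuation_unit OP'.1 (Bb O' OP' Ot') nm'.
  by rewrite -(mulKf b0 x) mulrC; apply: subringM => //; [exact: place_ring|exact: Bbx].
move=> x; split; first exact: OO'.
move=> O'x; apply: contrapT => nx; have [Ov Oc] := OP; have Or := place_ring OP.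
have x0 : x != 0 by apply: contra_notN nx => /eqP->; exact: subring0.
have Ox : O x^-1 by case: (valuation_ring_total Ov x).
have [a ma] := place_residue OP' Ot' mt' O'x.
apply: nx; rewrite -(subrK (c a) x); apply: subringD => //.
have [->|xa0] := eqVneq (x - c a) 0; first exact: subring0.
apply: contrapT => nxa; have Oxa : O (x - c a)^-1 by case: (valuation_ring_total Ov (x - c a)).
exact: max_ideal_unit (OO' _ Oxa) xa0 ma.
Qed.

Section Conjugacy.

Variable U : set {rmorphism Omega -> Omega}.
Hypotheses (U_group : subgroup U) (U_closed : krull_closed U) (U_fin : finite_orbits U).
Hypotheses (U_const : forall s a, U s -> s (c a) = c a) (U_t : forall s, U s -> s t = t).

Theorem conjugate_places O O' b b' : place O -> O t -> max_ideal O (t - c b) ->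
    place O' -> O' t -> max_ideal O' (t - c b') ->
    (forall y, B y -> fixed_by U y -> max_ideal O' y -> max_ideal O y) ->
  exists2 s, U s & forall x, O (s x) <-> O' x.
Proof.
move=> OP Ot mt OP' Ot' mt' H; have [Ov Oc] := OP; have Or := place_ring OP.
have [res resP] : {res : Omega -> k & forall x, O x -> max_ideal O (x - c (res x))}.
  apply: (@choice _ _ (fun x a => O x -> max_ideal O (x - c a))) => x.
  have [Ox|nOx] := pselect (O x); last by exists 0.
  by have [a ma] := place_residue OP Ot mt Ox; exists a.
have Baut s x : U s -> B x -> B (s x).
  by move=> Us; apply: coordinate_ring_aut; [move=> a; exact: U_const|exact: U_t].
have [|s Us sP] := compactness U_group U_fin U_closed
    (R := fun x y => B x /\ max_ideal O' x -> max_ideal O y).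
  move=> S; pose X := [seq x <- S | `[< B x /\ max_ideal O' x >] ].
  have XB i : (i < size X)%N -> B X`_i /\ max_ideal O' X`_i.
    by move=> iX; have := mem_nth 0 iX; rewrite mem_filter => /andP[/asboolP].
  have [T [_ TP]] := orbit_vectors U_fin X.
  (* Its coefficients are residues at O; the value at a generic [a] is the residue of s y and
     decides whether they all vanish. *)
  pose pol (w : seq Omega) : {poly k} := \poly_(i < size X) res w`_i.
  have [a aP] := @generic_scalar k k idfun [seq pol w | w <- [seq w <- T | pol w != 0] ]
    ltac:(by move=> p /mapP[w]; rewrite mem_filter => /andP[? _] ->).
  pose y := \sum_(i < size X) c a ^+ i * X`_i.
  have Br := coordinate_ring_subring.
  have By : B y.
    apply: (subring_sum Br) => i _; apply: (subringM Br); last by have [] := XB i (ltn_ord i).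
    by apply: (subringX Br); exact: coordinate_ring_const.
  have m'y : max_ideal O' y.
    apply: max_ideal_sum => [|i _]; first exact: OP'.1.
    apply: max_idealMl => //; [exact: OP'.1| |by have [] := XB i (ltn_ord i)].
    by apply: subringX; [exact: place_ring|exact: OP'.2].
  have [l [ul lP]] := orbit_seq U_fin y.
  have lB z : z \in l -> B z by move=> /lP[s Us ->]; exact: Baut.
  have yl : y \in l by apply/lP; exists idfun => //; exact: subgroup_id.
  have mnu : max_ideal O (\prod_(z <- l) z).
    apply: H.
    - by apply: subring_prod.
    - move=> s Us; rewrite rmorph_prod -(big_map s xpredT id).
      by apply: perm_big; exact: (orbit_poly_fixed U_group ul lP).
    - rewrite (big_rem y)//=; apply: max_idealMr => //; first exact: OP'.1.
      apply: subring_prod => [|z /mem_rem/lB]; first exact: place_ring.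
      exact.
  have [z zl|z /lP[s Us ->] ms] := max_ideal_prod_prime Ov _ mnu; first exact: lB.
  exists s => // x xS [Bx m'x].
  have xX : x \in X by rewrite mem_filter xS andbT; apply/asboolP.
  have wT : map s X \in T by apply/TP; exists s.
  have Ow i : (i < size X)%N -> O (map s X)`_i.
    move=> iX; rewrite (nth_map 0)//; apply: (Baut s) => //; by have [] := XB i iX.
  have pw : pol (map s X) = 0.
    apply: contrapT => /eqP p0.
    have := aP (pol (map s X)); rewrite map_f ?mem_filter ?p0// => /(_ isT)/eqP; apply.
    apply: (place_const_unit OP).
    rewrite -[X in max_ideal O X](subKr (s y)); apply: max_idealB => //.
    rewrite horner_poly rmorph_sum /y rmorph_sum -sumrB; apply: max_ideal_sum => // i _.
    rewrite !rmorphM !rmorphXn /= U_const// [c (res _) * _]mulrC -mulrBr.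
    apply: max_idealMl => //; first exact: subringX.
    by have := resP _ (Ow i (ltn_ord i)); rewrite (nth_map 0).
  have ix : (index x X < size X)%N by rewrite index_mem.
  have := congr1 (fun p : {poly k} => p`_(index x X)) pw.
  rewrite coef_poly ix coef0 => res0.
  have := resP _ (Ow _ ix); rewrite res0 rmorph0 subr0 (nth_map 0)// nth_index//.
exists s => // x.
have sc a : s (c a) = c a by exact: U_const.
have sV := valuation_ring_preimage Ov s.
apply: (@place_eq [set x | O (s x)] O' b b') => //.
- exact: place_preimage.
- by rewrite /= U_t.
- by apply/max_ideal_preimage => //; rewrite rmorphB /= U_t// sc.
- by move=> y By m'y; apply/max_ideal_preimage => //; apply: sP.
Qed.

End Conjugacy.

End AtCoordinate.

Lemma polyval_root z P : P != 0 -> polyval c z P = 0 -> exists a, z = c a.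
Proof.
have [r ->] := closed_field_poly_normal P; rewrite -mul_polyC rmorphM rmorph_prod /= => P0.
rewrite polyvalC => /eqP; rewrite mulf_eq0 fmorph_eq0 => /orP[/eqP l0|].
  by rewrite l0 mul0r eqxx in P0.
rewrite prodf_seq_eq0 => /hasP[a _]; rewrite rmorphB /= polyvalX polyvalC subr_eq0 => /eqP->.
by exists a.
Qed.

(** Chevalley's theorem for k[z] and its ideal (z), which is proper since a nonconstant z satisfies
    no polynomial equation over k. *)
Lemma place_exists z : (forall a, z <> c a) -> exists2 O, place O & max_ideal O z.
Proof.
move=> zc; pose A : set Omega := [set y | exists P, y = polyval c z P].
have Ar : subring_set A.
  split; first by exists 1; rewrite rmorph1.
    by move=> _ _ [P ->] [Q ->]; exists (P - Q); rewrite rmorphB.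
  by move=> _ _ [P ->] [Q ->]; exists (P * Q); rewrite rmorphM.
have zA : [set z] `<=` A by move=> _ ->; exists 'X; rewrite polyvalX.
have [|O [Ov AO zO]] := chevalley_extension Ar zA.
  move=> [s [sP s1]].
  have [P PE] : exists P, \sum_(ab <- s) ab.1 * ab.2 = z * polyval c z P.
    elim: s sP {s1} => [|ab s IH] sP; first by exists 0; rewrite big_nil rmorph0 mulr0.
    have [ab'|P PE] := IH; first by move=> abs; apply: sP; rewrite inE abs orbT.
    have [abz [Q QE]] := sP ab (mem_head _ _).
    by exists (Q + P); rewrite big_cons PE rmorphD /= mulrDr -QE (abz : ab.1 = z).
  have [||a] := @polyval_root z (1 - 'X * P); last exact: zc.
    apply/eqP => /(congr1 (fun p : {poly k} => p.[0])); rewrite hornerD hornerN hornerM hornerX mul0r horner0 hornerC subr0.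
    by move=> /eqP; rewrite oner_eq0.
  by rewrite rmorphB rmorph1 rmorphM /= polyvalX -PE -s1 subrr.
exists O; last exact: zO.
by split => // a; apply: AO; exists a%:P; rewrite polyvalC.
Qed.

(** A nonconstant x has a pole, a place with 1/x in its maximal ideal, and that place contains t or
    its inverse. *)
Lemma chart_intersection x t :
  coordinate_ring t x -> coordinate_ring t^-1 x -> exists a, x = c a.
Proof.
move=> Bx B'x; apply: contrapT => nx.
have x0 : x != 0 by apply/eqP => x0; apply: nx; exists 0; rewrite rmorph0.
have [a xa|O OP mx] := @place_exists x^-1.
  by apply: nx; exists a^-1; rewrite fmorphV -xa invrK.
have Ox : O x by have [Ot|Ot] := valuation_ring_total OP.1 t; [exact: Bx|exact: B'x].
by apply: (max_ideal_unit _ _ mx); rewrite ?invrK ?invr_eq0.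
Qed.

End Places.

Lemma pcharB_exp (R : comNzRingType) p a (x y : R) : p \in [pchar R] ->
  (x - y) ^+ (p ^ a) = x ^+ (p ^ a) - y ^+ (p ^ a).
Proof.
move=> pR; elim: a => [|a IH]; first by rewrite !expr1.
by rewrite expnSr !exprM IH -!(pFrobenius_autE pR) rmorphB.
Qed.

Section CoordinateRings.

Variables (k Omega : closedFieldType) (c : {rmorphism k -> Omega}).
Implicit Types (t u x y : Omega) (O : set Omega).
Local Notation polyval := (polyval c).

Section OneCoordinate.

Variables (t : Omega) (t_coord : coordinate c t).

Lemma place_above_point b : exists O, [/\ place c O, O t & max_ideal O (t - c b)].
Proof.
have [a ta|O OP mt] := @place_exists k Omega c (t - c b).
  have /eqP := coordinate_transcendental t_coord (a + b); apply.
  by rewrite rmorphD /= -ta subrK.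
exists O; split => //; rewrite -(subrK (c b) t); apply: subringD; first exact: place_ring OP.
  exact: max_ideal_sub.
exact: OP.2.
Qed.

Definition ratfun : set Omega := [set x | exists P Q, polyval t Q != 0 /\ x = polyval t P / polyval t Q].

Lemma polyval_eq0 P : (polyval t P == 0) = (P == 0).
Proof. by apply/eqP/eqP => [/t_coord.1|->]; rewrite ?rmorph0. Qed.

(** k[t] is integrally closed: above a root of the denominator of a reduced fraction lies a place
    where the fraction is not integral. *)
Lemma ratfun_coordinate_ring f : ratfun f -> coordinate_ring c t f -> exists P, f = polyval t P.
Proof.
move=> [P0 [Q0 [Q00 ->]]] Bf; rewrite polyval_eq0 in Q00.
pose g := gcdp P0 Q0.
have [P PE] : exists P, P0 = P * g by apply/dvdpP; exact: dvdp_gcdl.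
have [Q QE] : exists Q, Q0 = Q * g by apply/dvdpP; exact: dvdp_gcdr.
have g0 : g != 0 by rewrite gcdp_eq0 (negPf Q00) andbF.
have cop : coprimep P Q.
  have := coprimep_div_gcd (p := P0) (q := Q0); rewrite Q00 orbT => /(_ isT).
  by rewrite -/g {1}PE {1}QE !mulpK.
have Qn0 : Q != 0 by apply: contra_neq Q00 => Qn; rewrite QE Qn mul0r.
have fE : polyval t P0 / polyval t Q0 = polyval t P / polyval t Q.
  by rewrite PE QE !rmorphM /= -mulf_div divff ?mulr1// polyval_eq0.
rewrite fE in Bf *.
have /size1_polyC Qc : (size Q <= 1)%N.
  rewrite leqNgt; apply/negP => sQ.
  have /closed_rootP[b Qb] : size Q != 1%N by rewrite neq_ltn sQ orbT.
  have [O [OP Ot mt]] := place_above_point b.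
  have Of := Bf O OP Ot.
  have mQ : max_ideal O (polyval t Q).
    have := place_polyval_congr Q OP Ot mt; by rewrite (rootP Qb) rmorph0 subr0.
  have mP : max_ideal O (polyval t P).
    rewrite -[polyval t P](divfK (_ : polyval t Q != 0)) ?polyval_eq0//.
    by apply: max_idealMl => //; exact: OP.1.
  have Pb : P.[b] = 0.
    apply: (place_const_unit OP).
    rewrite -[X in max_ideal O X](subKr (polyval t P)); apply: max_idealB => //; first exact: OP.1.
    exact: place_polyval_congr.
  have := root_gcd P Q b; rewrite /root Pb (rootP Qb) !eqxx.
  by move: cop; rewrite /coprimep => /size_poly1P[a a0 ->]; rewrite hornerC (negPf a0).
exists ((Q`_0)^-1 *: P); rewrite -mul_polyC rmorphM /= polyvalC Qc polyvalC fmorphV mulrC coefC /=.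
by [].
Qed.

Lemma coordinate_ring_denominator y : exists2 P, P != 0 & coordinate_ring c t (polyval t P * y).
Proof.
have [Q Q0 Qy] := t_coord.2 y; exists (lead_coef Q); first by rewrite lead_coef_eq0.
have l0 : polyval t (lead_coef Q) != 0 by rewrite polyval_eq0 lead_coef_eq0.
have lE : lead_coef (map_poly (polyval t) Q) = polyval t (lead_coef Q) by rewrite lead_coef_map_eq.
move=> O OP Ot; rewrite -lE; apply: (valuation_lead_coef OP.1) => //.
- by move=> i; rewrite coef_map; apply: place_polyval.
- by rewrite -lead_coef_eq0 lE.
Qed.

(** At a place containing t^-1 the element y is already integral. At the others t is in the maximal
    ideal, where a denominator of y is t^e times a unit. *)
Lemma other_chart y : coordinate_ring c t^-1 y -> exists e, coordinate_ring c t (t ^+ e * y).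
Proof.
move=> By; have [P P0 BP] := coordinate_ring_denominator y.
have [e [g [gr PE]]] : exists e g, ~~ root g 0 /\ P = g * 'X^e.
  have [e [g gr PE]] := multiplicity_XsubC P 0; exists e, g; split; last by rewrite PE subr0.
  by move: gr; rewrite P0.
exists e => O OP Ot; have [Ov Oc] := OP; have Or := place_ring OP.
have [Ot'|Ot'] := pselect (O t^-1); first by apply: subringM => //; [exact: subringX|exact: By].
have mt : max_ideal O (t - c 0).
  by rewrite rmorph0 subr0; split => //; right.
have ng : ~ max_ideal O (polyval t g).
  move=> mg; have : max_ideal O (c g.[0]).
    rewrite -[X in max_ideal O X](subKr (polyval t g)); apply: max_idealB => //.
    exact: place_polyval_congr.
  by move=> /(place_const_unit OP)/rootP; rewrite (negPf gr).
have [g0 Vg] := valuation_unit Ov (place_polyval g OP Ot) ng.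
have := BP O OP Ot; rewrite PE rmorphM rmorphXn /= polyvalX => H.
by rewrite -(mulKf g0 (t ^+ e * y)); apply: subringM => //; rewrite mulrA.
Qed.

Definition coordinate_aut : set {rmorphism Omega -> Omega} :=
  [set s | [/\ bijective s, s t = t & forall a, s (c a) = c a]].

Lemma coordinate_aut_group : subgroup coordinate_aut.
Proof.
split=> [s []//| | |].
- by split => //; exists id.
- by move=> s u [s1 s2 s3] [u1 u2 u3]; split => /= [| |a]; [exact: bij_comp|rewrite u2|rewrite u3].
- move=> s [s1 s2 s3]; have [h [hb sh hs]] := rmorphism_inverse s1; exists h => //.
  by split => // [|a]; [rewrite -{1}s2 hs|rewrite -{1}(s3 a) hs].
Qed.

Lemma coordinate_aut_polyval s P : coordinate_aut s -> s (polyval t P) = polyval t P.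
Proof.
move=> [_ st sc]; rewrite !polyvalE rmorph_sum; apply: eq_bigr => i _.
by rewrite rmorphM rmorphXn /= st sc.
Qed.

Lemma coordinate_aut_closed : krull_closed coordinate_aut.
Proof.
move=> s sb H; split => // [|a].
  by have [u [_ ut _] us] := H [:: t]; rewrite (us t) ?mem_head.
by have [u [_ _ uc] us] := H [:: c a]; rewrite (us (c a)) ?mem_head.
Qed.

Lemma coordinate_aut_finite : finite_orbits coordinate_aut.
Proof.
move=> x; have [Q Q0 Qx] := t_coord.2 x.
have [r rE] := closed_field_poly_normal (map_poly (polyval t) Q).
have mQ0 : lead_coef (map_poly (polyval t) Q) != 0.
  rewrite lead_coef_eq0; apply: contra_neq Q0 => mQ0; apply/polyP => i; rewrite coef0; apply: t_coord.1.
  by rewrite -coef_map mQ0 coef0.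
exists r => s sP; have : root (map_poly (polyval t) Q) (s x).
  have <- : map_poly s (map_poly (polyval t) Q) = map_poly (polyval t) Q.
    by apply/polyP => i; rewrite !coef_map /= coordinate_aut_polyval.
  by rewrite fmorph_root.
by rewrite rE rootZ// root_prod_XsubC.
Qed.

Lemma algebraic_over_polyval x (D : set Omega) : (forall P, D (polyval t P)) ->
  exists q : {poly Omega}, [/\ q != 0, root q x & forall i, D q`_i].
Proof.
move=> DP; have [Q Q0 Qx] := t_coord.2 x; exists (map_poly (polyval t) Q); split => //.
  apply: contra_neq Q0 => mQ0; apply/polyP => i; rewrite coef0; apply: t_coord.1.
  by rewrite -coef_map mQ0 coef0.
by move=> i; rewrite coef_map; exact: DP.
Qed.

(** Every root of the minimal polynomial of y is the image of y under an automorphism, so the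
    polynomial is (X - y)^n. Writing n = m q with q a power of p and m prime to p, its coefficient -
    m y^q is rational. *)
Theorem coordinate_aut_fixed p y : p \in [pchar k] -> fixed_by coordinate_aut y ->
  exists a, ratfun (y ^+ (p ^ a)).
Proof.
move=> pk yfix.
have pO : p \in [pchar Omega] by rewrite (fmorph_pchar c).
have [|||K [i iD]] := @subfield_as_field Omega ratfun.
- by exists 1, 1; rewrite !rmorph1 divr1 oner_neq0.
- move=> _ _ [P [Q [Q0 ->]]] [P' [Q' [Q0' ->]]]; exists (P * Q' - P' * Q), (Q * Q').
  rewrite rmorphB !rmorphM /= mulf_neq0//; split => //.
  by rewrite -[- (_ / _)]mulNr addf_div// mulNr.
- move=> _ _ [P [Q [Q0 ->]]] [P' [Q' [Q0' ->]]].
  have [P0|P0] := eqVneq (polyval t P') 0.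
    by exists 0, 1; rewrite P0 rmorph0 rmorph1 !mul0r invr0 mulr0 oner_neq0.
  by exists (P * Q'), (Q * P'); rewrite !rmorphM /= mulf_neq0// invf_div mulf_div.
have Kpol P : exists a, i a = polyval t P.
  have [|a aE] := (iD (polyval t P)).1; last by exists a.
  by exists P, 1; rewrite rmorph1 divr1 oner_neq0.
have [|P0 [sP Py Pdvd Pdvd']] := @minimal_polynomial K Omega i y.
  have [q [q0 qy qD]] := @algebraic_over_polyval y [set x | exists a, i a = x] Kpol.
  have [q' q'E] : {q' : nat -> K & forall j, i (q' j) = q`_j}.
    exact: (@choice _ _ (fun j a => i a = q`_j)).
  pose qK := \poly_(j < size q) q' j.
  have qKE : map_poly i qK = q.
    apply/polyP => j; rewrite coef_map coef_poly; case: ltnP => [_|sj]; first exact: q'E.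
    by rewrite nth_default //; exact: rmorph0.
  by exists qK; rewrite ?qKE//; apply: contra_neq q0 => qK0; rewrite -qKE qK0 rmorph0.
have only z : root (map_poly i P0) z -> z = y.
  move=> Pz; pose Gam := [set w : Omega * Omega | exists r : {poly K},
    w = ((map_poly i r).[y], (map_poly i r).[z])].
  have diag P : Gam (polyval t P, polyval t P).
    have [a aE] := Kpol P; exists a%:P; by rewrite !map_polyC !hornerC /= aE.
  have GP : partial_isomorphism Gam.
    split.
    - by exists 1; rewrite !rmorph1 !hornerC.
    - by move=> _ _ [r ->] [r' ->]; exists (r - r'); rewrite !rmorphB !hornerD !hornerN.
    - by move=> _ _ [r ->] [r' ->]; exists (r * r'); rewrite !rmorphM !hornerM.
    - move=> _ _ [r [-> ->]]; split=> /eqP.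
        by move=> /Pdvd/dvdpP[h ->]; rewrite rmorphM hornerM (rootP Pz) mulr0.
      by move=> /(Pdvd' _ _ _ _ Pz)/dvdpP[h ->]; rewrite rmorphM hornerM (rootP Py) mulr0.
  have [||s [sb sG]] := extend_automorphism GP.
  - by move=> x; apply: (@algebraic_over_polyval x [set x | exists b, Gam (x, b)]) => P; exists (polyval t P).
  - by move=> x; apply: (@algebraic_over_polyval x [set x | exists b, Gam (b, x)]) => P; exists (polyval t P).
  have sP0 : coordinate_aut s.
    split => // [|a]; first by rewrite -(polyvalX c t); apply: sG.
    by rewrite -(polyvalC c t); apply: sG.
  by rewrite -(yfix s sP0); apply/esym; apply: sG; exists 'X; rewrite !map_polyX !hornerX.
pose f := map_poly i P0.
have [r rE] := closed_field_poly_normal f.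
have P00 : P0 != 0 by rewrite -size_poly_gt0; lia.
have f0 : lead_coef f != 0 by rewrite lead_coef_eq0 map_poly_eq0.
pose n := (size r).
have rn : r = nseq n y.
  apply/all_pred1P/allP => z zr; apply/eqP/only; rewrite -/f rE rootZ// root_prod_XsubC//.
have fE : f = lead_coef f *: ('X - y%:P) ^+ n.
  rewrite {1}rE rn; congr (_ *: _); elim: n {rn} => [|j IH]; first by rewrite big_nil expr0.
  by rewrite /= big_cons IH exprS.
have n0 : (0 < n)%N.
  have : size f = n.+1.
    by rewrite fE size_scale// size_exp_XsubC.
  by rewrite /f size_map_poly => e; move: sP; rewrite e.
pose a := logn p n; pose q := (p ^ a)%N; pose m := (n %/ q)%N.
have pp : prime p := pcharf_prime pO.
have nE : n = (m * q)%N by rewrite /m divnK// pfactor_dvdnn.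
have m0 : (0 < m)%N by move: n0; rewrite nE muln_gt0 => /andP[].
have mp : ~~ (p %| m)%N.
  have := pfactor_coprime pp n0; case=> m' cm' nE'.
  have -> : m = m' by rewrite /m nE' mulnK// expn_gt0 prime_gt0.
  by rewrite -prime_coprime.
exists a; apply/iD.
have : exists b, i b = f`_(q * m.-1) / lead_coef f.
  by rewrite /f lead_coef_map coef_map /= -fmorph_div; eexists.
(* (X - y)^n = (X^q - y^q)^m, read off in degree q (m - 1). *)
have -> : f`_(q * m.-1) / lead_coef f = - y ^+ q *+ m.
  rewrite fE lead_coefZ lead_coef_exp lead_coefXsubC expr1n mulr1 coefZ mulrC mulKf//.
  rewrite nE mulnC exprM.
  have -> : ('X - y%:P) ^+ q = ('X - (y ^+ q)%:P) \Po 'X^q.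
    by rewrite rmorphB /= comp_polyX comp_polyC pcharB_exp ?pchar_poly// polyC_exp.
  rewrite -rmorphXn /= coef_comp_poly_Xn ?expn_gt0 ?prime_gt0// dvdn_mulr// mulKn ?expn_gt0 ?prime_gt0//.
  have := @coefPn_prod_XsubC _ (nseq m (y ^+ q)); rewrite size_nseq => H.
  have e : \prod_(z <- nseq m (y ^+ q)) ('X - z%:P) = ('X - (y ^+ q)%:P) ^+ m.
    by rewrite big_nseq -Monoid.iteropE.
  rewrite -e H; last by rewrite -lt0n.
  by rewrite big_nseq -Monoid.iteropE mulNrn.
move=> [b bE]; exists (- b / m%:R); rewrite fmorph_div rmorphN rmorph_nat bE /=.
have m0' : m%:R != 0 :> Omega by rewrite -(dvdn_pcharf pO).
by rewrite mulNrn opprK -[_ ^+ _ *+ _]mulr_natr mulfK.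
Qed.

End OneCoordinate.

(** The Frobenius of k as [phi] yields lifts of Frobenius; the identity yields inertia elements that
    move one root of t to another. *)
Theorem coordinate_transport (phi : {rmorphism k -> k}) u v : coordinate c u -> coordinate c v ->
    (forall a, exists b, phi b = a) ->
  exists s : {rmorphism Omega -> Omega}, [/\ bijective s, s u = v & forall a, s (c a) = c (phi a)].
Proof.
move=> uc vc surj.
pose Gam := [set w : Omega * Omega | exists P, w = (polyval u P, polyval v (map_poly phi P))].
have GP : partial_isomorphism Gam.
  split.
  - by exists 1; rewrite !rmorph1.
  - by move=> _ _ [r ->] [r' ->]; exists (r - r'); rewrite !rmorphB.
  - by move=> _ _ [r ->] [r' ->]; exists (r * r'); rewrite !rmorphM.
  - move=> _ _ [P [-> ->]]; split=> /eqP; rewrite polyval_eq0 ?map_poly_eq0// => /eqP->; by rewrite !rmorph0.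
have [||s [sb sG]] := extend_automorphism GP.
- move=> x; apply: (@algebraic_over_polyval u uc x [set x | exists b, Gam (x, b)]) => P.
  by exists (polyval v (map_poly phi P)), P.
- move=> x; apply: (@algebraic_over_polyval v vc x [set x | exists b, Gam (b, x)]) => P.
  have [f fE] := choice surj.
  exists (polyval u (map_poly f P)), (map_poly f P).
  have -> : map_poly phi (map_poly f P) = P.
    rewrite -map_poly_comp_id0; last exact: rmorph0.
    by apply: map_poly_id => a _; rewrite /= fE.
  by [].
exists s; split => // [|a].
  by apply: sG; exists 'X; rewrite map_polyX !polyvalX.
by apply: sG; exists a%:P; rewrite map_polyC !polyvalC.
Qed.

End CoordinateRings.

(** * The projective line is simply connected *)

Lemma pchar_sum_exp (R : comNzRingType) p a (I : Type) (r : seq I) (F : I -> R) : p \in [pchar R] ->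
  \sum_(i <- r) F i ^+ (p ^ a) = (\sum_(i <- r) F i) ^+ (p ^ a).
Proof.
move=> pR; elim: a => [|a IH]; first by rewrite expr1; apply: eq_bigr => i _; rewrite expr1.
rewrite expnSr exprM -IH -(pFrobenius_autE pR) rmorph_sum; apply: eq_bigr => i _.
by rewrite /= pFrobenius_autE exprM.
Qed.

(** * Galois coordinate systems of an unramified covering *)

Section GaloisSystems.

Variables (k Omega : closedFieldType) (c : {rmorphism k -> Omega}).
Variables (t : Omega) (t_coord : coordinate c t) (S : seq Omega).
Local Notation G := (coordinate_aut c t).
Hypothesis S_stable : forall s z, G s -> z \in S -> s z \in S.

Definition pointwise_stabilizer : set {rmorphism Omega -> Omega} :=
  [set s | G s /\ forall z, z \in S -> s z = z].
Local Notation U := pointwise_stabilizer.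

Let G_group := coordinate_aut_group c t.

Lemma pointwise_stabilizer_group : subgroup U.
Proof.
split=> [s [[]]//| | |].
- by split => //; exact: subgroup_id.
- move=> s u [Gs s1] [Gu u1]; split; first exact: subgroup_comp.
  by move=> z zS; rewrite /= u1// s1.
- move=> s [Gs s1]; have [u [Gu su us]] := subgroup_inv G_group Gs.
  by exists u => //; split => // z zS; rewrite -{1}(s1 z zS) us.
Qed.

Lemma pointwise_stabilizer_closed : krull_closed U.
Proof.
move=> s sb H; split.
  by apply: coordinate_aut_closed => // T; have [u [Gu _] us] := H T; exists u.
by move=> z zS; have [u [_ u1] us] := H [:: z]; rewrite us ?mem_head// u1.
Qed.

Lemma pointwise_stabilizer_finite : finite_orbits U.
Proof.
by move=> x; have [l lP] := coordinate_aut_finite t_coord x; exists l => s [Gs _]; exact: lP.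
Qed.

Local Notation M := (fixed_by U).

Lemma fixed_by_subring (H : set {rmorphism Omega -> Omega}) : subring_set (fixed_by H).
Proof.
split; first by move=> s _; rewrite rmorph1.
  by move=> x y Mx My s Us; rewrite rmorphB Mx// My.
by move=> x y Mx My s Us; rewrite rmorphM Mx// My.
Qed.

Lemma fixed_agree s s' y : G s -> G s' -> map s S = map s' S -> M y -> s y = s' y.
Proof.
move=> Gs Gs' ss' My; have [u [Gu s'u us']] := subgroup_inv G_group Gs'.
have Uus : U (u \o s).
  split; first exact: subgroup_comp.
  move=> z zS; rewrite /= -[RHS]us'; congr (u _).
  by move/(eq_map_agree S s s'): ss' => /(_ z zS).
rewrite -[s y]s'u; congr (s' _); exact: (My (u \o s) Uus).
Qed.

Lemma fixed_stable s y : G s -> M y -> M (s y).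
Proof.
move=> Gs My u [Gu u1]; have [v [Gv sv vs]] := subgroup_inv G_group Gs.
rewrite -[u (s y)]sv; congr (s _).
apply: (My (v \o (u \o s))); split.
  by apply: subgroup_comp => //; apply: subgroup_comp.
by move=> z zS; rewrite /= u1 ?vs// S_stable.
Qed.

(** The orbit [T] of the tuple [S] stands for the cosets of the pointwise stabilizer, and [g v]
    represents the coset taking [S] to [v]. *)
Lemma coset_representatives : exists (T : seq (seq Omega)) (g : seq Omega -> {rmorphism Omega -> Omega}),
  [/\ uniq T, S \in T, forall v, v \in T -> G (g v) /\ map (g v) S = v,
      forall s, G s -> map s S \in T & forall y, M y -> g S y = y].
Proof.
have [T [uT TP]] := orbit_vectors (coordinate_aut_finite t_coord) S.
have [g gP] : {g : seq Omega -> {rmorphism Omega -> Omega} &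
    forall v, v \in T -> G (g v) /\ map (g v) S = v}.
  apply: (@choice _ _ (fun v s => v \in T -> G s /\ map s S = v)) => v.
  have [/TP[s Gs ->]|_] := boolP (v \in T); last by exists idfun.
  by exists s.
have ST : S \in T by apply/TP; exists idfun; [exact: subgroup_id|rewrite map_id].
exists T, g; split => //; first by move=> s Gs; apply/TP; exists s.
move=> y My; have [Gg gS] := gP S ST.
by rewrite (@fixed_agree (g S) idfun)// ?map_id//; exact: subgroup_id.
Qed.

Section Representatives.

Variables (T : seq (seq Omega)) (g : seq Omega -> {rmorphism Omega -> Omega}).
Hypotheses (uT : uniq T) (ST : S \in T) (gP : forall v, v \in T -> G (g v) /\ map (g v) S = v).
Hypotheses (GT : forall s, G s -> map s S \in T) (gS : forall y, M y -> g S y = y).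

Definition trace y := \sum_(v <- T) g v y.

Lemma trace_fixed y : M y -> fixed_by G (trace y).
Proof.
move=> My s Gs; rewrite /trace rmorph_sum.
have comp v : v \in T -> s (g v y) = g (map s v) y.
  move=> vT; have [Gv gv] := gP vT.
  have sv : map (s \o g v) S = map s v by rewrite map_comp gv.
  have svT : map s v \in T by rewrite -sv; apply: GT; apply: subgroup_comp.
  rewrite -[s (g v y)]/((s \o g v) y); have [G' g'] := gP svT.
  by apply: fixed_agree => //; rewrite ?g'//; exact: subgroup_comp.
rewrite (eq_big_seq _ comp) -(big_map (map s) xpredT (fun v => g v y)).
have sT : {subset map (map s) T <= T}.
  move=> _ /mapP[v vT ->]; have [Gv <-] := gP vT.
  by rewrite -map_comp; apply: GT; apply: subgroup_comp.
apply: perm_big; apply: uniq_perm => //.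
  by rewrite map_inj_uniq//; apply: inj_map; exact: fmorph_inj.
have [] // := uniq_min_size (s1 := map (map s) T) (s2 := T); last by rewrite size_map.
by rewrite map_inj_uniq//; apply: inj_map; exact: fmorph_inj.
Qed.

(** Galois coordinates in the sense of Chase, Harrison and Rosenberg, over the chart of [tau]; their
    existence expresses that the covering is unramified there. *)
Definition galois_system (tau : Omega) (XY : seq (Omega * Omega)) :=
  (forall xy, xy \in XY -> [/\ coordinate_ring c tau xy.1, M xy.1, coordinate_ring c tau xy.2 & M xy.2])
  /\ forall v, v \in T -> \sum_(xy <- XY) xy.1 * g v xy.2 = (v == S)%:R.

(** The two halves of a Galois system are dual families for the trace form. *)
Lemma galois_system_dual tau XY y : galois_system tau XY -> M y ->
  y = \sum_(xy <- XY) xy.1 * trace (xy.2 * y).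
Proof.
move=> [_ sysP] My; rewrite -[LHS](gS My).
transitivity (\sum_(v <- T) (\sum_(xy <- XY) xy.1 * g v xy.2) * g v y).
  rewrite (bigD1_seq S)//= sysP// eqxx mul1r big1_seq ?addr0// => v /andP[vS vT].
  by rewrite sysP// (negPf vS) mul0r.
under eq_bigr do rewrite mulr_suml.
rewrite exchange_big; apply: eq_bigr => xy _; rewrite /trace mulr_sumr; apply: eq_bigr => v _.
by rewrite rmorphM mulrA.
Qed.

(** The relation with the halves exchanged comes from applying [g v] to the relation at the coset of
    its inverse. *)
Lemma galois_system_dual_sym tau XY y : galois_system tau XY -> M y ->
  y = \sum_(xy <- XY) xy.2 * trace (xy.1 * y).
Proof.
move=> [XYP sysP] My; rewrite -[LHS](gS My).
have sysP' v : v \in T -> \sum_(xy <- XY) xy.2 * g v xy.1 = (v == S)%:R.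
  move=> vT; have [Gv gv] := gP vT; have [u [Gu vu uv]] := subgroup_inv G_group Gv.
  have wT := GT Gu; have [Gw gw] := gP wT.
  have := congr1 (g v) (sysP _ wT); rewrite rmorph_nat rmorph_sum => e.
  rewrite (_ : (v == S) = (map u S == S)); last first.
    apply/eqP/eqP => [vS|uS].
      by rewrite -{2}(map_id S) -[in X in map u X]vS -gv -map_comp; apply: eq_map => z /=.
    by rewrite -gv -{1}uS -map_comp -[RHS]map_id; apply: eq_map => z /=.
  rewrite -[RHS]e; apply: eq_big_seq => xy /XYP[_ _ _ My2].
  rewrite rmorphM mulrC; congr (_ * _).
  by rewrite (fixed_agree Gw Gu gw My2) vu.
transitivity (\sum_(v <- T) (\sum_(xy <- XY) xy.2 * g v xy.1) * g v y).
  rewrite (bigD1_seq S)//= sysP'// eqxx mul1r big1_seq ?addr0// => v /andP[vS vT].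
  by rewrite sysP'// (negPf vS) mul0r.
under eq_bigr do rewrite mulr_suml.
rewrite exchange_big; apply: eq_bigr => xy _; rewrite /trace mulr_sumr; apply: eq_bigr => v _.
by rewrite rmorphM mulrA.
Qed.

Section Existence.

Hypothesis unramified : forall O, place c O -> (exists x, ~ O x) ->
  forall s, G s -> (forall x, O (s x) <-> O x) -> forall z, z \in S -> s z = z.

Variables (tau : Omega) (tau_coord : coordinate c tau) (G_tau : forall s, G s -> s tau = tau).
Local Notation B := (coordinate_ring c tau).

Let G_sub s : G s -> coordinate_aut c tau s.
Proof. by move=> Gs; split; [case: Gs|exact: G_tau|case: Gs]. Qed.

Let A : set Omega := [set x | B x /\ M x].

Let A_ring : subring_set A.
Proof.
have Br := @coordinate_ring_subring _ _ c tau; have Mr := fixed_by_subring U.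
split; first by split; [exact: (subring1 Br)|exact: (subring1 Mr)].
  by move=> x y [Bx Mx] [By My]; split; [exact: (subringB Br)|exact: (subringB Mr)].
by move=> x y [Bx Mx] [By My]; split; [exact: (subringM Br)|exact: (subringM Mr)].
Qed.

Let A_stable s x : G s -> A x -> A (s x).
Proof.
move=> Gs [Bx Mx]; split; last exact: fixed_stable.
by apply: coordinate_ring_aut => //; [case: Gs|exact: G_tau].
Qed.

(** Otherwise Chevalley's theorem gives a place O at which all b - g_v b vanish. Then O and its
    preimage under g_v agree on fixed elements, so some s in U makes g_v s stabilize O; being
    unramified there, g_v s fixes S, and so does g_v. *)
Lemma separating_pairs v : v \in T -> v != S -> exists s : seq (Omega * Omega),
  (forall ab, ab \in s -> A ab.1 /\ A ab.2) /\ \sum_(ab <- s) ab.1 * (ab.2 - g v ab.2) = 1.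
Proof.
move=> vT vS; have [Gv gv] := gP vT.
pose I : set Omega := [set x | exists2 b, A b & x = b - g v b].
have IA : I `<=` A by move=> _ [b Ab ->]; apply: (subringB A_ring) => //; exact: A_stable.
have [[s [sP s1]]|n1] := pselect (extended_ideal I A 1).
  have [f fP] : {f : Omega -> Omega & forall x, I x -> A (f x) /\ x = f x - g v (f x)}.
    apply: (@choice _ _ (fun x b => I x -> A b /\ x = b - g v b)) => x.
    have [[b Ab ->]|nI] := pselect (I x); [by exists b|by exists 0].
  exists [seq (ab.2, f ab.1) | ab <- s]; split.
    by move=> _ /mapP[ab /sP[/fP[? _] ?] ->].
  rewrite big_map s1; apply: eq_big_seq => ab /sP[/fP[_ <-] _]; exact: mulrC.
exfalso; have [O [Ov AO IO]] := chevalley_extension A_ring IA n1.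
have Ac a : A (c a) by split; [exact: coordinate_ring_const|move=> s [[_ _ sc] _]; exact: sc].
have OP : place c O by split => // a; apply: AO.
have At : A tau by split; [exact: coordinate_ring_gen|move=> s [Gs _]; exact: G_tau].
have Ot : O tau := AO _ At.
have [z zS gz] : exists2 z, z \in S & g v z != z.
  apply: contrapT => no; move/eqP: vS; apply; rewrite -gv -[RHS]map_id; apply/eq_in_map => z zS.
  by apply: contrapT => /eqP gz; apply: no; exists z.
(* A denominator brings z into [A]; the difference of P z and its image is a nonzero element of the
   maximal ideal, so the place is not trivial. *)
have [P P0 BP] := coordinate_ring_denominator tau_coord z.
have GvP : g v (polyval c tau P) = polyval c tau P.
  exact/coordinate_aut_polyval/G_sub.
have AP : A (polyval c tau P * z).
  split => // s [Gs s1]; by rewrite rmorphM (s1 z)// (coordinate_aut_polyval _ (G_sub Gs)).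
have nontriv : exists x, ~ O x.
  have Iw : I (polyval c tau P * z - g v (polyval c tau P * z)) by eexists; [exact: AP|].
  have [_ [w0|nw]] := IO _ Iw; last by eexists; exact: nw.
  move: gz; rewrite eq_sym -subr_eq0; move/eqP: w0; rewrite rmorphM GvP -mulrBr mulf_eq0.
  by rewrite polyval_eq0// (negPf P0) /= => ->.
have [b mb] := place_center tau_coord OP Ot nontriv.
have gc a : g v (c a) = c a by case: Gv.
have gt := G_tau Gv.
pose O' : set Omega := [set x | O (g v x)].
have OP' : place c O' := place_preimage OP gc.
have Ot' : O' tau by rewrite /O' /= gt.
have mb' : max_ideal O' (tau - c b) by apply/max_ideal_preimage => //; rewrite rmorphB /= gt gc.
have [|||s Us sO] := conjugate_places tau_coord pointwise_stabilizer_group pointwise_stabilizer_closed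
    pointwise_stabilizer_finite _ _ OP' Ot' mb' OP Ot mb _.
- by move=> s a [[]].
- by move=> s [Gs _]; exact: G_tau.
- move=> y By My my; apply/max_ideal_preimage => //.
  rewrite -[g v y](subKr y); apply: max_idealB => //; apply: IO; exists y; first by split.
  by [].
have := unramified OP nontriv (s := g v \o s); case: Us => Gs s1.
move=> /(_ (subgroup_comp G_group Gv Gs) sO z zS) /=; rewrite s1// => gz'.
by rewrite gz' eqxx in gz.
Qed.

(** For a single v, the extra pair (-d, 1) makes the sum 0 at v and 1 at the identity. Multiplying
    these systems over all v != S gives the result. *)
Lemma galois_system_exists : exists XY, galois_system tau XY.
Proof.
have [XY [XYP XY1 XY0]] : exists XY : seq (Omega * Omega), [/\
    forall xy, xy \in XY -> A xy.1 /\ A xy.2, \sum_(xy <- XY) xy.1 * xy.2 = 1 &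
    forall v, v \in [seq v <- T | v != S] -> \sum_(xy <- XY) xy.1 * g v xy.2 = 0].
  have sub : {subset [seq v <- T | v != S] <= [seq v <- T | v != S]} by [].
  elim: {1 3}[seq v <- T | v != S] sub => [|v L IH] sub.
    exists [:: (1, 1)]; split => //; last by rewrite big_seq1 mulr1.
    by move=> xy; rewrite inE => /eqP->; split; exact: subring1.
  have [w wL|XY [XYP XY1 XY0]] := IH; first by apply: sub; rewrite inE wL orbT.
  have := sub v (mem_head _ _); rewrite mem_filter => /andP[vS vT].
  have [s [sP s1]] := separating_pairs vT vS; have [Gv gv] := gP vT.
  pose d := \sum_(ab <- s) ab.1 * g v ab.2.
  have Ad : A d.
    apply: (subring_sum A_ring) => ab /sP[A1 A2]; apply: (subringM A_ring) => //.
    exact: A_stable.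
  pose s' := (- d, 1) :: s.
  have s'P ab : ab \in s' -> A ab.1 /\ A ab.2.
    rewrite inE => /orP[/eqP->|/sP//]; split; [exact: subringN|exact: subring1].
  have prod (h : {rmorphism Omega -> Omega}) :
      \sum_(xy <- [seq (ab.1 * xy.1, ab.2 * xy.2) | ab <- s', xy <- XY]) xy.1 * h xy.2 =
      (\sum_(ab <- s') ab.1 * h ab.2) * \sum_(xy <- XY) xy.1 * h xy.2.
    rewrite big_allpairs_dep mulr_suml; apply: eq_bigr => ab _; rewrite mulr_sumr.
    by apply: eq_bigr => xy _ /=; rewrite rmorphM mulrACA.
  exists [seq (ab.1 * xy.1, ab.2 * xy.2) | ab <- s', xy <- XY]; split.
  - move=> _ /allpairsP[[ab xy] /= [/s'P[a1 a2] /XYP[x1 x2] ->]]; split; exact: (subringM A_ring).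
  - have := prod idfun; rewrite /= => ->; rewrite XY1 mulr1 big_cons /= mulr1 -s1 /d addrC.
    by rewrite -sumrB; apply: eq_bigr => ab _; rewrite mulrBr.
  - move=> w; rewrite inE => /orP[/eqP->|wL]; rewrite prod; last by rewrite XY0// mulr0.
    by rewrite big_cons /= rmorph1 mulr1 addNr mul0r.
exists XY; split; first by move=> xy /XYP[[? ?] [? ?]].
move=> v vT; have [->|vS] := eqVneq v S; last by apply: XY0; rewrite mem_filter vS.
by rewrite -[RHS]XY1; apply: eq_big_seq => xy /XYP[_ [_ M2]]; rewrite gS.
Qed.

End Existence.

(** Serves to make the traces of products rational functions, whereas a priori they are only purely
    inseparable over k(t). *)
Lemma galois_system_frobenius tau XY p a : p \in [pchar k] -> galois_system tau XY ->
  galois_system tau [seq (xy.1 ^+ (p ^ a), xy.2 ^+ (p ^ a)) | xy <- XY].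
Proof.
move=> pk [XYP sysP].
have pO : p \in [pchar Omega] by rewrite (fmorph_pchar c).
have Br := @coordinate_ring_subring _ _ c tau; have Mr := fixed_by_subring U.
split.
  by move=> _ /mapP[xy /XYP[? ? ? ?] ->]; split; by [exact: (subringX Br)|exact: (subringX Mr)].
move=> v vT; rewrite big_map.
transitivity (\sum_(xy <- XY) (xy.1 * g v xy.2) ^+ (p ^ a)).
  by apply: eq_bigr => xy _; rewrite /= rmorphXn exprMn.
rewrite (pchar_sum_exp _ _ _ pO) sysP//; case: (v == S); rewrite ?expr1n// expr0n.
by rewrite -[(_ == 0)%N]negbK -lt0n expn_gt0 prime_gt0// (pcharf_prime pO).
Qed.

Lemma trace_frobenius p a y : p \in [pchar k] -> trace (y ^+ (p ^ a)) = trace y ^+ (p ^ a).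
Proof.
move=> pk; have pO : p \in [pchar Omega] by rewrite (fmorph_pchar c).
by rewrite /trace -(pchar_sum_exp _ _ _ pO); apply: eq_bigr => v _; rewrite rmorphXn.
Qed.

End Representatives.

End GaloisSystems.

(** * Duality between the two charts of the projective line *)

Section Duality.

Variables (k Omega : closedFieldType) (c : {rmorphism k -> Omega}).
Variables (t : Omega) (t_coord : coordinate c t).
Local Notation B := (coordinate_ring c t).
Local Notation B' := (coordinate_ring c t^-1).
Local Notation polyval := (polyval c).

Let t0 : t != 0 := coordinate_neq0 t_coord.
Let Br : subring_set B := @coordinate_ring_subring _ _ c t.
Let Br' : subring_set B' := @coordinate_ring_subring _ _ c t^-1.

(** The Cech coboundaries for the twist by minus infinity, whose sections are [B] on one chart and
    t^-1 [B'] on the other. *)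
Definition chart_sum : set Omega := [set x | exists b b', [/\ B b, B' b' & x = b + t^-1 * b']].

Lemma chart_sum_lin a x y : chart_sum x -> chart_sum y -> chart_sum (c a * x + y).
Proof.
move=> [b1 [b1' [B1 B1' ->]]] [b2 [b2' [B2 B2' ->]]].
exists (c a * b1 + b2), (c a * b1' + b2'); split.
- by apply: (subringD Br) => //; apply: (subringM Br) => //; exact: coordinate_ring_const.
- by apply: (subringD Br') => //; apply: (subringM Br') => //; exact: coordinate_ring_const.
- by rewrite !mulrDr addrACA mulrCA.
Qed.

Lemma chart_sum_left b : B b -> chart_sum b.
Proof. by move=> Bb; exists b, 0; split => //; [exact: (subring0 Br')|rewrite mulr0 addr0]. Qed.

Lemma chart_sum_right b : B' b -> chart_sum (t^-1 * b).
Proof. by move=> Bb; exists 0, b; split => //; [exact: (subring0 Br)|rewrite add0r]. Qed.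

Lemma chart_sum0 : chart_sum 0. Proof. by apply: chart_sum_left; exact: (subring0 Br). Qed.

Lemma chart_sumD x y : chart_sum x -> chart_sum y -> chart_sum (x + y).
Proof. by move=> Wx Wy; have := chart_sum_lin 1 Wx Wy; rewrite rmorph1 mul1r. Qed.

Lemma chart_sumN x : chart_sum x -> chart_sum (- x).
Proof. by move=> Wx; have := chart_sum_lin (-1) Wx chart_sum0; rewrite rmorphN rmorph1 mulN1r addr0. Qed.

Lemma chart_sum_sum (I : Type) (r : seq I) (P : pred I) (F : I -> Omega) :
  (forall i, P i -> chart_sum (F i)) -> chart_sum (\sum_(i <- r | P i) F i).
Proof. by move=> WF; elim/big_ind: _; [exact: chart_sum0|exact: chart_sumD|]. Qed.

(** Nonnegative powers of t times x lie in [B], and powers of t^-1 beyond N bring x into t^-1 [B'].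
    At most N terms remain, so the classes live in a finite-dimensional space. *)
Lemma chart_sum_pole_part N a x R : B x -> B' (t^-1 ^+ N * x) ->
  chart_sum (x * (t^-1 ^+ a.+1 * polyval t R) -
             \sum_(l < N | (l < a.+1)%N) c R`_(a - l) * (x * t^-1 ^+ l.+1)).
Proof.
move=> Bx B'x; pose m := size R.
rewrite (@polyval_wide _ _ c t R (a.+1 + m)); last exact: leq_addl.
rewrite big_split_ord /= 2!mulrDr addrAC; apply: chart_sumD; last first.
  apply: chart_sum_left; rewrite mulr_sumr mulr_sumr; apply: (subring_sum Br) => i _.
  rewrite exprD [t^-1 ^+ _ * _]mulrCA [t^-1 ^+ _ * _]mulrA -exprMn mulVf// expr1n mul1r.
  apply: (subringM Br) => //; apply: (subringM Br); first exact: coordinate_ring_const.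
  by apply: (subringX Br); exact: coordinate_ring_gen.
have tE l : (l <= a)%N -> t^-1 ^+ a.+1 * t ^+ (a - l) = t^-1 ^+ l.+1.
  by move=> la; rewrite -{1}(subnKC la) -addSn exprD -mulrA -exprMn mulVf// expr1n mulr1.
pose F l := c R`_(a - l) * (x * t^-1 ^+ l.+1).
have -> : x * (t^-1 ^+ a.+1 * \sum_(i < a.+1) c R`_i * t ^+ i) = \sum_(l < a.+1) F l.
  rewrite (reindex_inj rev_ord_inj) /= mulr_sumr mulr_sumr; apply: eq_bigr => l _.
  rewrite subSS /F -(tE l); last by rewrite -ltnS.
  by rewrite [t^-1 ^+ _ * (_ * _)]mulrCA [LHS]mulrCA.
rewrite (bigID (fun l : 'I_a.+1 => (l < N)%N)) /= addrAC.
have -> : \sum_(l < a.+1 | (l < N)%N) F l = \sum_(l < N | (l < a.+1)%N) F l.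
  rewrite (big_ord_widen_cond (a.+1 + N) (fun l => (l < N)%N) F) ?leq_addr//.
  rewrite (big_ord_widen_cond (a.+1 + N) (fun l => (l < a.+1)%N) F) ?leq_addl//.
  by apply: eq_bigl => l; rewrite andbC.
rewrite subrr add0r; apply: chart_sum_sum => l; rewrite -leqNgt => Nl.
have -> : F l = t^-1 * (c R`_(a - l) * (t^-1 ^+ (l - N) * (t^-1 ^+ N * x))).
  rewrite [t^-1 ^+ (_ - _) * _]mulrA -exprD subnK// /F exprS [RHS]mulrCA; congr (_ * _).
  by rewrite mulrC -mulrA.
apply: chart_sum_right; apply: (subringM Br'); first exact: coordinate_ring_const.
by apply: (subringM Br') => //; apply: (subringX Br'); exact: coordinate_ring_gen.
Qed.

(* [phi] below is a linear form on M / (B + t^-1 B'), the first cohomology group of a twist;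
   by residues it is the pairing with [cc = \sum_j Phi_j(t) y_j], which then extends to both
   charts with a zero at infinity and therefore vanishes. *)
Lemma laurent_duality J I (x y : 'I_J -> Omega) (x' y' : 'I_I -> Omega) e (Tp Up : 'I_J -> 'I_I -> {poly k}) :
  (forall j, B (x j)) -> (forall j, B (y j)) -> (forall i, B' (x' i)) -> (forall i, B' (y' i)) ->
  (0 < e)%N ->
  (forall i, x' i = \sum_j x j * (t^-1 ^+ e * polyval t (Tp j i))) ->
  (forall i, y' i = \sum_j x j * (t^-1 ^+ e * polyval t (Up j i))) ->
  (forall Phi : 'I_J -> {poly k}, \sum_j polyval t (Phi j) * y j =
    \sum_i y' i * (t^-1 ^+ e * polyval t (\sum_j Phi j * Tp j i))) ->
  (forall (Phi : 'I_J -> {poly k}) i, \sum_j polyval t (Phi j) * y j = 0 -> \sum_j Phi j * Up j i = 0) ->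
  forall i, chart_sum (y' i).
Proof.
move=> Bx By Bx' By' e0 x'E y'E ccE cc0 i0; apply: contrapT => nW.
have [N NP] : exists N, forall j, B' (t^-1 ^+ N * x j).
  have [f fP] : {f : 'I_J -> nat & forall j, B' (t^-1 ^+ f j * x j)}.
    apply: (@choice _ _ (fun j n => B' (t^-1 ^+ n * x j))) => j.
    by apply: other_chart; [exact: coordinateV|rewrite invrK].
  exists (\max_j f j)%N => j; rewrite -(subnK (leq_bigmax j)) exprD -mulrA.
  by apply: (subringM Br') => //; apply: (subringX Br'); exact: coordinate_ring_gen.
pose el (u : 'rV[k]_(J * N)) := \sum_j \sum_(l < N) c (u 0 (mxvec_index j l)) * (x j * t^-1 ^+ l.+1).
pose pole a (R : 'I_J -> {poly k}) : 'rV[k]_(J * N) :=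
  mxvec (\matrix_(j < J, l < N) if (l < a.+1)%N then (R j)`_(a - l) else 0).
have elP a R : chart_sum (\sum_j x j * (t^-1 ^+ a.+1 * polyval t (R j)) - el (pole a R)).
  rewrite -sumrB; apply: chart_sum_sum => j _.
  have := chart_sum_pole_part a (R j) (Bx j) (NP j); rewrite big_mkcond /=.
  congr (chart_sum (_ - _)); apply: eq_bigr => l _; rewrite mxvecE mxE.
  by case: ifP => //; rewrite rmorph0 mul0r.
have el_lin a u w : el (a *: u + w) = c a * el u + el w.
  rewrite /el mulr_sumr -big_split; apply: eq_bigr => j _; rewrite mulr_sumr -big_split.
  by apply: eq_bigr => l _ /=; rewrite !mxE rmorphD rmorphM mulrDl -mulrA.
have el0 : el 0 = 0.
  by rewrite /el big1 // => j _; rewrite big1 // => l _; rewrite mxE rmorph0 mul0r.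
have diffW u w : chart_sum (u - w) -> chart_sum u <-> chart_sum w.
  move=> uw; split=> [Wu|Ww]; last by rewrite -(subrK w u); exact: chart_sumD.
  by rewrite -(subKr u w); apply: chart_sumD => //; exact: chart_sumN.
have eE : e = e.-1.+1 by rewrite prednK.
have [|||phi [phi0 phi1]] :=
    @row_form_separation k _ (fun u => chart_sum (el u)) (pole e.-1 (Up^~ i0)) _ _ _.
- by rewrite el0; exact: chart_sum0.
- by move=> a u w Wu Ww; rewrite el_lin; exact: chart_sum_lin.
- move=> /(diffW _ _ (elP _ _)).2; rewrite -eE -y'E; exact: nW.
(* The coefficients of [phi] are packed into polynomials, so that [phi] becomes a coefficient of
   \sum_j Phi j * R j, that is, a residue. *)
pose Phi j := \sum_(l < N) phi (mxvec_index j l) *: 'X^l.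
have pairing a R : \sum_i pole a R 0 i * phi i = (\sum_j Phi j * R j)`_a.
  rewrite (reindex _ (curry_mxvec_bij J N)) /= coef_sum.
  rewrite (eq_bigr (fun jl : 'I_J * 'I_N => pole a R 0 (mxvec_index jl.1 jl.2) * phi (mxvec_index jl.1 jl.2))).
    rewrite -(pair_bigA _ (fun j l => pole a R 0 (mxvec_index j l) * phi (mxvec_index j l))) /=.
    apply: eq_bigr => j _; rewrite mulr_suml coef_sum; apply: eq_bigr => l _.
    rewrite -scalerAl coefZ coefXnM mxvecE mxE mulrC ltnS ltnNge.
    by case: (leqP l a).
  by case.
(* [phi] kills t^-1 [B'], which contains t^-1 t^-(a-e) x'_i; hence these products have degree below
   e. *)
have pole0 i a : (e <= a)%N -> (\sum_j Phi j * Tp j i)`_a = 0.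
  move=> ea; rewrite -pairing; apply: phi0; apply/(diffW _ _ (elP _ _)).1.
  have -> : \sum_j x j * (t^-1 ^+ a.+1 * polyval t (Tp j i)) = t^-1 * (t^-1 ^+ (a - e) * x' i).
    rewrite x'E 2!mulr_sumr; apply: eq_bigr => j _.
    by rewrite -{1}(subnK ea) exprS exprD -!mulrA mulrCA; congr (_ * _); rewrite mulrCA.
  apply: chart_sum_right; apply: (subringM Br') => //; apply: (subringX Br').
  exact: coordinate_ring_gen.
have coefB' (P : {poly k}) : (size P <= e)%N -> exists2 b, B' b & t^-1 ^+ e * polyval t P = t^-1 * b.
  move=> sP; exists (\sum_(s < e) c P`_s * t^-1 ^+ (e.-1 - s)).
    apply: (subring_sum Br') => s _; apply: (subringM Br'); first exact: coordinate_ring_const.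
    by apply: (subringX Br'); exact: coordinate_ring_gen.
  rewrite (polyval_wide _ _ sP) !mulr_sumr; apply: eq_bigr => s _; rewrite [LHS]mulrCA [RHS]mulrCA.
  congr (_ * _); have se : (s <= e.-1)%N by rewrite -ltnS -eE.
  by rewrite {1}eE exprS -{1}(subnK se) exprD -!mulrA -exprMn mulVf// expr1n mulr1.
pose cc := \sum_j polyval t (Phi j) * y j.
have Bcc : B cc.
  by apply: (subring_sum Br) => j _; apply: (subringM Br) => //; exact: coordinate_ring_polyval.
have [b' B'b' ccb] : exists2 b', B' b' & cc = t^-1 * b'.
  have [f fP] : {f : 'I_I -> Omega & forall i, B' (f i) /\
      t^-1 ^+ e * polyval t (\sum_j Phi j * Tp j i) = t^-1 * f i}.
    apply: (@choice _ _ (fun i b => B' b /\ t^-1 ^+ e * polyval t (\sum_j Phi j * Tp j i) = t^-1 * b)) => i.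
    have [|b Bb bE] := coefB' (\sum_j Phi j * Tp j i); last by exists b.
    by apply/leq_sizeP; exact: pole0.
  exists (\sum_i y' i * f i).
    by apply: (subring_sum Br') => i _; apply: (subringM Br') => //; case: (fP i).
  rewrite /cc ccE mulr_sumr; apply: eq_bigr => i _; rewrite (fP i).2 mulrCA; done.
have B'cc : B' cc by rewrite ccb; apply: (subringM Br') => //; exact: coordinate_ring_gen.
(* [cc] is integral on both charts, hence constant, and divisible by t^-1 at infinity, hence 0. This
   contradicts the value 1 of [phi] at the class of [y' i0]. *)
have [a ccE'] := chart_intersection Bcc B'cc.
have [O [OP Ot]] := place_above_point (coordinateV t_coord) 0; rewrite rmorph0 subr0 => mt.
have mcc : max_ideal O cc by rewrite ccb; apply: max_idealMr => //; [exact: OP.1|exact: B'b'].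
have cc00 : cc = 0.
  by rewrite ccE'; rewrite ccE' in mcc; rewrite (place_const_unit OP mcc) rmorph0.
have := pairing e.-1 (Up^~ i0); rewrite phi1 (cc0 _ _ cc00) coef0 => /eqP; by rewrite oner_eq0.
Qed.

End Duality.

(** * Unramified coverings of the projective line are trivial *)

Section SimplyConnected.

Variables (p : nat) (k Omega : closedFieldType) (c : {rmorphism k -> Omega}).
Variables (t : Omega) (t_coord : coordinate c t).
Hypothesis p_char : p \in [pchar k].
Local Notation G := (coordinate_aut c t).
Local Notation B := (coordinate_ring c t).
Local Notation B' := (coordinate_ring c t^-1).
Local Notation polyval := (polyval c).

Let t0 : t != 0 := coordinate_neq0 t_coord.
Let Br : subring_set B := @coordinate_ring_subring _ _ c t.
Let Br' : subring_set B' := @coordinate_ring_subring _ _ c t^-1.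

Lemma ratfunX x n : ratfun c t x -> ratfun c t (x ^+ n).
Proof.
move=> [P [Q [Q0 ->]]]; exists (P ^+ n), (Q ^+ n).
by rewrite !rmorphXn expf_neq0// expr_div_n.
Qed.

Lemma ratfunM_polyval x P : ratfun c t x -> ratfun c t (polyval t P * x).
Proof.
by move=> [P' [Q [Q0 ->]]]; exists (P * P'), Q; split => //; rewrite rmorphM /= mulrA.
Qed.

Lemma coordinate_aut_fixed_seq (l : seq Omega) : (forall y, y \in l -> fixed_by G y) ->
  exists a, forall y, y \in l -> ratfun c t (y ^+ (p ^ a)).
Proof.
elim: l => [|y l IH] H; first by exists 0%N.
have [z zl|a aP] := IH; first by apply: H; rewrite inE zl orbT.
have [b bP] := coordinate_aut_fixed t_coord p_char (H y (mem_head _ _)).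
exists (a + b)%N => z; rewrite inE => /orP[/eqP->|/aP H'].
  by rewrite addnC expnD exprM; exact: ratfunX.
by rewrite expnD exprM; exact: ratfunX.
Qed.

Variable S : seq Omega.
Hypothesis S_stable : forall s z, G s -> z \in S -> s z \in S.
Local Notation M := (fixed_by (pointwise_stabilizer c t S)).

Section Trace.

Variables (T : seq (seq Omega)) (g : seq Omega -> {rmorphism Omega -> Omega}).
Hypothesis gP : forall v, v \in T -> G (g v) /\ map (g v) S = v.

Lemma trace_linear (I : Type) (r : seq I) (P : I -> {poly k}) (F : I -> Omega) :
  trace T g (\sum_(i <- r) polyval t (P i) * F i) = \sum_(i <- r) polyval t (P i) * trace T g (F i).
Proof.
under [in RHS]eq_bigr do rewrite mulr_sumr; rewrite [RHS]exchange_big; apply: eq_big_seq => v vT.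
rewrite rmorph_sum; apply: eq_bigr => i _; have [Gv _] := gP vT.
by rewrite rmorphM /= coordinate_aut_polyval.
Qed.

Lemma trace_polyvalM P y : trace T g (polyval t P * y) = polyval t P * trace T g y.
Proof. by have := trace_linear [:: tt] (fun=> P) (fun=> y); rewrite !big_seq1. Qed.

Lemma trace_coordinate_ring y : B y -> B (trace T g y).
Proof.
move=> By; apply: (subring_sum Br) => v vT; have [[_ gt gc] _] := gP vT.
exact: coordinate_ring_aut.
Qed.

Lemma trace_pole e y z : B y -> B (t ^+ e * z) -> ratfun c t (trace T g (y * z)) ->
  exists P, trace T g (y * z) = t^-1 ^+ e * polyval t P.
Proof.
move=> By Bz rat.
have tE : polyval t 'X^e = t ^+ e by rewrite rmorphXn /= polyvalX.
have [||P PE] := ratfun_coordinate_ring t_coord (f := polyval t 'X^e * trace T g (y * z)).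
- exact: ratfunM_polyval.
- by rewrite -trace_polyvalM tE; apply: trace_coordinate_ring; rewrite mulrCA; exact: (subringM Br).
by exists P; rewrite -PE tE mulrA -exprMn mulVf// expr1n mul1r.
Qed.

End Trace.

Hypothesis unramified : forall O, place c O -> (exists x, ~ O x) ->
  forall s, G s -> (forall x, O (s x) <-> O x) -> forall z, z \in S -> s z = z.

(** If s moved a point of S, a Galois system at infinity would give 1 = sum_i x'_i (y'_i - g y'_i),
    with g the representative of its coset. By duality each y'_i is a constant modulo t^-1 [B'], so
    the right side vanishes at infinity. *)
Theorem unramified_fixed s z : G s -> z \in S -> s z = z.
Proof.
move=> Gs zS; apply: contrapT => /eqP sz.
have [T [g [uT ST gP GT gS]]] := coset_representatives t_coord S.
have Gt s' : G s' -> s' t = t by case.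
have Gt' s' : G s' -> s' t^-1 = t^-1 by move=> /Gt st; rewrite fmorphV st.
have [XY0 XY0P] := galois_system_exists t_coord S_stable gP gS unramified t_coord Gt.
have [XY0' XY0P'] := galois_system_exists t_coord S_stable gP gS unramified (coordinateV t_coord) Gt'.
have Mr := fixed_by_subring (pointwise_stabilizer c t S).
pose zs := map fst XY0' ++ map snd XY0'.
(* One exponent [a] for the finitely many traces between the two charts; both systems are then
   raised to the power p^a. *)
have [|a aP] := @coordinate_aut_fixed_seq [seq trace T g (xy.2 * z) | xy <- XY0, z <- zs].
  move=> _ /allpairsP[[xy z'] /= [/XY0P.1[_ _ _ My] z'P ->]].
  have Mz' : M z'; last exact: (trace_fixed uT gP GT (subringM Mr My Mz')).
  by move: z'P; rewrite mem_cat => /orP[]/mapP[xy' /XY0P'.1[_ M1 _ M2] ->].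
have XYP := galois_system_frobenius a p_char XY0P.
have XYP' := galois_system_frobenius a p_char XY0P'.
set XY := map _ XY0 in XYP; set XY' := map _ XY0' in XYP'.
have rat1 xy xy' : xy \in XY -> xy' \in XY' -> ratfun c t (trace T g (xy.2 * xy'.1)).
  move=> /mapP[u uX ->] /mapP[u' uX' ->] /=; rewrite -exprMn (trace_frobenius c)//; apply: aP.
  by apply/allpairsP; exists (u, u'.1); split => //=; rewrite mem_cat map_f.
have rat2 xy xy' : xy \in XY -> xy' \in XY' -> ratfun c t (trace T g (xy.2 * xy'.2)).
  move=> /mapP[u uX ->] /mapP[u' uX' ->] /=; rewrite -exprMn (trace_frobenius c)//; apply: aP.
  by apply/allpairsP; exists (u, u'.2); split => //=; rewrite mem_cat [X in _ || X]map_f ?orbT.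
clearbody XY XY'; move: {XY0 XY0P XY0' XY0P' zs aP} XYP XYP' rat1 rat2 => XYP XYP' rat1 rat2.
pose x j := (tnth (in_tuple XY) j).1; pose y j := (tnth (in_tuple XY) j).2.
pose x' i := (tnth (in_tuple XY') i).1; pose y' i := (tnth (in_tuple XY') i).2.
have xyP j : [/\ B (x j), M (x j), B (y j) & M (y j)] by apply: XYP.1; exact: mem_tnth.
have xyP' i : [/\ B' (x' i), M (x' i), B' (y' i) & M (y' i)] by apply: XYP'.1; exact: mem_tnth.
have [e [e0 eP]] : exists e, (0 < e)%N /\ forall i, B (t ^+ e * x' i) /\ B (t ^+ e * y' i).
  have [f fP] : {f : 'I_(size XY') -> nat & forall i, B (t ^+ f i * x' i) /\ B (t ^+ f i * y' i)}.
    apply: (@choice _ _ (fun i n => B (t ^+ n * x' i) /\ B (t ^+ n * y' i))) => i.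
    have [B1 _ B2 _] := xyP' i.
    have [a1 a1P] := other_chart t_coord B1; have [a2 a2P] := other_chart t_coord B2.
    exists (a1 + a2)%N; rewrite exprD; split; [rewrite -mulrA mulrCA|rewrite -mulrA];
      apply: (subringM Br) => //; apply: (subringX Br); exact: coordinate_ring_gen.
  exists (\max_i f i).+1; split => // i.
  have fi : (f i <= (\max_i f i).+1)%N by apply: leqW; exact: leq_bigmax.
  rewrite -(subnK fi) exprD -!mulrA; case: (fP i) => ? ?.
  by split; apply: (subringM Br) => //; apply: (subringX Br); exact: coordinate_ring_gen.
have [Tp TpP] : {Tp : 'I_(size XY) * 'I_(size XY') -> {poly k} &
    forall ji, trace T g (y ji.1 * x' ji.2) = t^-1 ^+ e * polyval t (Tp ji)}.
  apply: (@choice _ _ (fun ji P => trace T g (y ji.1 * x' ji.2) = t^-1 ^+ e * polyval t P)) => -[j i] /=.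
  by apply: trace_pole => //; [case: (xyP j)|case: (eP i)|apply: rat1; exact: mem_tnth].
have [Up UpP] : {Up : 'I_(size XY) * 'I_(size XY') -> {poly k} &
    forall ji, trace T g (y ji.1 * y' ji.2) = t^-1 ^+ e * polyval t (Up ji)}.
  apply: (@choice _ _ (fun ji P => trace T g (y ji.1 * y' ji.2) = t^-1 ^+ e * polyval t P)) => -[j i] /=.
  by apply: trace_pole => //; [case: (xyP j)|case: (eP i)|apply: rat2; exact: mem_tnth].
have dual z1 : M z1 -> z1 = \sum_j x j * trace T g (y j * z1).
  by move=> Mz1; rewrite {1}(galois_system_dual uT ST gS XYP Mz1) big_tnth.
have dual' z1 : M z1 -> z1 = \sum_i y' i * trace T g (x' i * z1).
  by move=> Mz1; rewrite {1}(galois_system_dual_sym uT ST gP GT gS XYP' Mz1) big_tnth.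
have trPhi (Phi : 'I_(size XY) -> {poly k}) z1 (R : 'I_(size XY) -> {poly k}) :
    (forall j, trace T g (y j * z1) = t^-1 ^+ e * polyval t (R j)) ->
    trace T g ((\sum_j polyval t (Phi j) * y j) * z1) = t^-1 ^+ e * polyval t (\sum_j Phi j * R j).
  move=> RP; rewrite mulr_suml; under eq_bigr do rewrite -mulrA; rewrite (trace_linear gP) rmorph_sum mulr_sumr.
  by apply: eq_bigr => j _; rewrite RP rmorphM /= mulrCA.
have y'W : forall i, chart_sum c t (y' i).
  apply: (laurent_duality t_coord (x := x) (y := y) (x' := x') (e := e)
    (Tp := fun j i => Tp (j, i)) (Up := fun j i => Up (j, i))) => //.
  - by move=> j; case: (xyP j).
  - by move=> j; case: (xyP j).
  - by move=> i; case: (xyP' i).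
  - by move=> i; case: (xyP' i).
  - move=> i; have [_ Mx _ _] := xyP' i; rewrite {1}(dual _ Mx); apply: eq_bigr => j _.
    by rewrite (TpP (j, i)).
  - move=> i; have [_ _ _ My] := xyP' i; rewrite {1}(dual _ My); apply: eq_bigr => j _.
    by rewrite (UpP (j, i)).
  - move=> Phi; rewrite [LHS]dual'.
      apply: eq_bigr => i _; rewrite [x' i * _]mulrC.
      by rewrite (trPhi _ _ (fun j => Tp (j, i)))// => j; exact: (TpP (j, i)).
    apply: (subring_sum Mr) => j _; have [_ _ _ My] := xyP j; apply: (subringM Mr) => // s' [Gs' _].
    exact: coordinate_aut_polyval.
  - move=> Phi i cc0; apply/eqP; rewrite -(polyval_eq0 t_coord); apply/eqP.
    apply: (mulfI (expf_neq0 e (invr_neq0 t0))); rewrite mulr0 -(trPhi _ (y' i)); last first.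
      by move=> j; exact: (UpP (j, i)).
    by rewrite cc0 mul0r /trace big1// => v _; rewrite rmorph0.
pose v := map s S; have vT : v \in T := GT _ Gs; have [Gv gv] := gP _ vT.
have vS : v != S.
  apply: contra_neq sz => vS; have := @eq_map_agree _ S s idfun; rewrite map_id => -[/(_ vS) H _].
  exact: H.
have [O [OP Ot]] := place_above_point (coordinateV t_coord) 0; rewrite rmorph0 subr0 => mt.
apply: (max_ideal1 OP.1).
have -> : 1 = \sum_i x' i * (y' i - g v (y' i)).
  transitivity (\sum_i x' i * y' i - \sum_i x' i * g v (y' i)); last first.
    by rewrite -sumrB; apply: eq_bigr => i _; rewrite mulrBr.
  have := XYP'.2 v vT; rewrite (negPf vS) big_tnth => ->; rewrite subr0.
  have := XYP'.2 S ST; rewrite eqxx big_tnth => H; rewrite -[LHS]/((true : nat)%:R) -[LHS]H; apply: eq_bigr => i _.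
  by have [_ _ _ My] := xyP' i; rewrite -/(y' i) gS.
apply: max_ideal_sum => [|i _]; first exact: OP.1.
have [b [b' [Bb B'b yE]]] := y'W i; have [Bx' _ By' _] := xyP' i.
apply: max_idealMl => //; [exact: OP.1|exact: Bx'|].
(* b = y' - t^-1 b' is integral on both charts. *)
have [d dE] : exists d, b = c d.
  apply: (chart_intersection Bb); rewrite -(addrK (t^-1 * b') b) -yE.
  apply: (subringB Br') => //; apply: (subringM Br') => //; exact: coordinate_ring_gen.
have [_ gt gc] := Gv.
rewrite yE dE rmorphD gc opprD addrACA subrr add0r rmorphM fmorphV gt -mulrBr.
apply: max_idealMr => //; first exact: OP.1.
apply: (subringB (place_ring OP)); first exact: B'b.
by apply: (coordinate_ring_aut gc _ B'b) => //; rewrite fmorphV gt.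
Qed.

End SimplyConnected.

(** * Tame ramification *)

Lemma subgroup_iter (Omega : closedFieldType) (G : set {rmorphism Omega -> Omega}) s n :
  subgroup G -> G s -> exists2 u, G u & forall x, u x = iter n s x.
Proof.
move=> G_group Gs; elim: n => [|n [u Gu uE]]; first by exists idfun; [exact: subgroup_id|].
by exists (s \o u); [exact: subgroup_comp|move=> x /=; rewrite uE].
Qed.

Lemma iter_return (Omega : closedFieldType) (s : {rmorphism Omega -> Omega}) (l : seq Omega) x :
  (forall n, iter n s x \in l) -> exists n, (0 < n <= size l)%N /\ iter n s x = x.
Proof.
move=> lP; have [i [j [ij jl E]]] : exists i j, [/\ (i < j)%N, (j <= size l)%N & iter i s x = iter j s x].
  apply: contrapT => no.
  have inj : injective (fun i : 'I_(size l).+1 => iter i s x).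
    move=> i j E; apply: val_inj; apply: contrapT => /eqP; rewrite neq_ltn => /orP[] ij; apply: no.
      by exists i, j; split => //; rewrite -ltnS.
    by exists j, i; split => //; rewrite -ltnS.
  have sub : {subset [seq iter (i : 'I_(size l).+1) s x | i <- enum 'I_(size l).+1] <= l}.
    by move=> _ /mapP[i _ ->].
  have := uniq_leq_size _ sub; rewrite size_map size_enum_ord ltnn map_inj_uniq// enum_uniq.
  by move=> /(_ isT).
exists (j - i)%N; split; first by rewrite subn_gt0 ij (leq_trans (leq_subr _ _)).
have inj : injective (iter i s) by elim: i {ij E} => //= i IH; exact: inj_comp (fmorph_inj s) IH.
by apply: inj; rewrite -iterD subnKC// ltnW.
Qed.

Lemma iter_mul_fixed (T : Type) (s : T -> T) y a b : iter a s y = y -> iter (b * a) s y = y.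
Proof. by move=> ay; elim: b => // b IH; rewrite mulSn iterD IH. Qed.

Lemma iter_period (Omega : closedFieldType) (G : set {rmorphism Omega -> Omega}) s (S : seq Omega) :
  subgroup G -> finite_orbits G -> G s ->
  exists2 n, (0 < n)%N & forall x, x \in S -> iter n s x = x.
Proof.
move=> G_group G_fin Gs; elim: S => [|x S [n n0 nP]]; first by exists 1%N.
have [l lP] := G_fin x.
have [|m [/andP[m0 _] mx]] := @iter_return _ s l x.
  by move=> i; have [u Gu <-] := subgroup_iter i G_group Gs; exact: lP.
exists (n * m)%N; first by rewrite muln_gt0 n0.
move=> y; rewrite inE => /orP[/eqP->|/nP ny]; first exact: iter_mul_fixed.
by rewrite mulnC; exact: iter_mul_fixed.
Qed.

Section LocalTheory.

Variables (p : nat) (k Omega : closedFieldType) (c : {rmorphism k -> Omega}).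
Hypothesis p_char : p \in [pchar k].
Variables (t : Omega) (t_coord : coordinate c t) (O : set Omega) (OP : place c O).

Definition decomposition : set {rmorphism Omega -> Omega} :=
  [set s | coordinate_aut c t s /\ forall x, O (s x) <-> O x].

(** The common kernel of the tame characters x |-> s x / x modulo the maximal ideal; when t or t^-1
    vanishes at O this is the wild inertia, by [tame_kernel_Sylow]. *)
Definition tame_kernel : set {rmorphism Omega -> Omega} :=
  [set s | decomposition s /\ forall x, x != 0 -> max_ideal O (s x / x - 1)].

Let Ov : valuation_ring O := OP.1.
Let Or : subring_set O := place_ring OP.
Local Notation m := (max_ideal O).
Let G_group := coordinate_aut_group c t.

Lemma decomposition_group : subgroup decomposition.
Proof.
split=> [s [[]]//| | |].
- by split => //; exact: subgroup_id.
- by move=> s u [Gs sO] [Gu uO]; split; [exact: subgroup_comp|move=> x; rewrite /= sO uO].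
- move=> s [Gs sO]; have [u [Gu su us]] := subgroup_inv G_group Gs.
  by exists u => //; split => // x; rewrite -sO su.
Qed.

Lemma decomposition_finite : finite_orbits decomposition.
Proof. by move=> x; have [l lP] := coordinate_aut_finite t_coord x; exists l => s [/lP]. Qed.

Lemma decomposition_closed : krull_closed decomposition.
Proof.
move=> s sb H; split; first by apply: coordinate_aut_closed => // S; have [u [Gu _] us] := H S; exists u.
by move=> x; have [u [_ uO] us] := H [:: x]; rewrite us ?mem_head.
Qed.

(** The residue field is k, which s fixes, so decomposition and inertia groups coincide. *)
Lemma decomposition_residue b s x : O t -> m (t - c b) -> decomposition s -> O x -> m (s x - x).
Proof.
move=> Ot mt [[_ _ sc] sO] Ox; have [a ma] := place_residue t_coord OP Ot mt Ox.
have mO (y : Omega) : m y -> m (s y).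
  move=> [Oy [->|ny]]; first by rewrite rmorph0; exact: max_ideal0.
  by split; [exact/sO|right; rewrite -fmorphV => /sO].
have := max_idealB Ov (mO _ ma) ma; rewrite rmorphB /= sc opprB addrA addrNK; exact.
Qed.

Section AtZero.

Hypothesis t_max : m t.

Let Ot : O t := max_ideal_sub t_max.
Let mt0 : m (t - c 0). Proof. by rewrite rmorph0 subr0. Qed.

Lemma decomposition_max s x : decomposition s -> m x -> m (s x).
Proof.
move=> Ds mx; rewrite -(subrK x (s x)); apply: max_idealD => //.
exact: decomposition_residue mt0 Ds (max_ideal_sub mx).
Qed.

(** Over a period of s, the conjugates of s x / x have product 1 by telescoping, which is impossible
    if this ratio or its inverse is in the maximal ideal. *)
Lemma decomposition_unit s x : decomposition s -> x != 0 -> O (s x / x) /\ ~ m (s x / x).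
Proof.
move=> Ds x0; have [n n0 nP] := iter_period [:: x] decomposition_group decomposition_finite Ds.
have nx : iter n s x = x by apply: nP; rewrite mem_head.
have sx0 : s x != 0 by rewrite fmorph_eq0.
have norm1 (v : Omega) : m v -> \prod_(i < n) iter i s v <> 1.
  move=> mv E; apply: (max_ideal1 Ov); rewrite -E.
  case: n n0 {nP nx E} => // n _; rewrite big_ord_recl; apply: max_idealMr => //.
  apply: subring_prod => // i _; have [u Gu <-] := subgroup_iter (bump 0 i) decomposition_group Ds.
  exact: (max_ideal_sub (decomposition_max Gu mv)).
have prodE : \prod_(i < n) iter i s (s x / x) = 1.
  rewrite (eq_bigr (fun i : 'I_n => iter i.+1 s x / iter i s x)); last first.
    move=> i _; have [u Gu uE] := subgroup_iter i decomposition_group Ds.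
    by rewrite -!uE rmorphM fmorphV /= uE -iterSr.
  rewrite -(big_mkord xpredT (fun i => iter i.+1 s x / iter i s x)) telescope_prodf//.
    by rewrite nx divff.
  by move=> i _; have [u Gu <-] := subgroup_iter i decomposition_group Ds; rewrite fmorph_eq0.
have nm : ~ m (s x / x) by move=> /norm1.
split => //; apply: contrapT => nO.
have /norm1 : m (s x / x)^-1 by apply: max_idealV => //; rewrite mulf_neq0 ?invr_eq0.
apply; transitivity (\prod_(i < n) (iter i s (s x / x))^-1); last by rewrite prodfV prodE invr1.
by apply: eq_bigr => i _; have [u Gu uE] := subgroup_iter i decomposition_group Ds; rewrite -!uE fmorphV.
Qed.

Definition tame_char (s : Omega -> Omega) x a := m (s x / x - c a).

Lemma tame_char_exists s x : decomposition s -> x != 0 -> exists a, tame_char s x a.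
Proof.
move=> Ds x0; have [Osx _] := decomposition_unit Ds x0; exact: place_residue mt0 Osx.
Qed.

Lemma tame_char_unique (s : Omega -> Omega) x a b : tame_char s x a -> tame_char s x b -> a = b.
Proof.
move=> sa sb; have := max_idealB Ov sb sa; rewrite opprB addrC addrA subrK -rmorphB.
by move=> /(place_const_unit OP)/eqP; rewrite subr_eq0 => /eqP.
Qed.

Lemma tame_charM s x y a b : decomposition s -> x != 0 ->
  tame_char s x a -> tame_char s y b -> tame_char s (x * y) (a * b).
Proof.
move=> Ds x0 sa sb; rewrite /tame_char rmorphM invfM mulrACA rmorphM.
have -> : s x / x * (s y / y) - c a * c b = s x / x * (s y / y - c b) + (s x / x - c a) * c b.
  by rewrite mulrBr mulrBl addrA subrK.
apply: max_idealD => //; first by apply: max_idealMl => //; case: (decomposition_unit Ds x0).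
by apply: max_idealMr => //; exact: OP.2.
Qed.

Lemma tame_charX s x a n : decomposition s -> x != 0 -> tame_char s x a -> tame_char s (x ^+ n) (a ^+ n).
Proof.
move=> Ds x0 sa; elim: n => [|n IH]; last by rewrite !exprS; exact: tame_charM.
by rewrite /tame_char rmorph1 divff ?oner_eq0// rmorph1 subrr; exact: max_ideal0.
Qed.

Lemma tame_char_fixed (s : {rmorphism Omega -> Omega}) x : x != 0 -> s x = x -> tame_char s x 1.
Proof. by move=> x0 sx; rewrite /tame_char sx divff// rmorph1 subrr; exact: max_ideal0. Qed.

Lemma tame_char_unit s x : decomposition s -> O x -> O x^-1 -> x != 0 -> tame_char s x 1.
Proof.
move=> Ds Ox OVx x0; rewrite /tame_char rmorph1 -(divff x0) -mulrBl; apply: max_idealMr => //.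
exact: decomposition_residue mt0 Ds Ox.
Qed.

Lemma tame_char_iter s x a n : decomposition s -> x != 0 -> tame_char s x a ->
  tame_char (iter n s) x (a ^+ n).
Proof.
move=> Ds x0 sa; elim: n => [|n IH].
  by rewrite /tame_char /= divff// rmorph1 subrr; exact: max_ideal0.
have [u Du uE] := subgroup_iter n decomposition_group Ds.
have y0 : iter n s x != 0 by rewrite -uE fmorph_eq0.
have [Oy ny] := decomposition_unit Du x0; have [q0 OVy] := valuation_unit Ov Oy ny.
have sy : tame_char s (iter n s x) a.
  rewrite -(mul1r a) -[iter n s x](divfK x0) -uE; apply: tame_charM => //; exact: tame_char_unit.
rewrite /tame_char iterS exprS.
have -> : s (iter n s x) / x = s (iter n s x) / iter n s x * (iter n s x / x).
  by rewrite mulrA divfK.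
have -> : s (iter n s x) / iter n s x * (iter n s x / x) - c (a * a ^+ n) =
   s (iter n s x) / iter n s x * (iter n s x / x - c (a ^+ n)) + (s (iter n s x) / iter n s x - c a) * c (a ^+ n).
  by rewrite mulrBr mulrBl rmorphM addrA subrK.
apply: max_idealD => //; first by apply: max_idealMl => //; case: (decomposition_unit Ds y0).
by apply: max_idealMr => //; exact: OP.2.
Qed.

Lemma tame_char_pchar (a : k) n : a ^+ (p ^ n) = 1 -> a = 1.
Proof.
move=> an; apply/eqP; rewrite -subr_eq0; have := pcharB_exp n a 1 p_char.
by rewrite an expr1n subrr => /eqP; rewrite expf_eq0 => /andP[].
Qed.

Lemma tame_kernelE s : tame_kernel s <-> decomposition s /\ forall x, x != 0 -> tame_char s x 1.
Proof. by split=> -[Ds H]; split => // x x0; have := H x x0; rewrite /tame_char rmorph1. Qed.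

Lemma tame_kernel_group : subgroup tame_kernel.
Proof.
split=> [s [[[]]]//| | |].
- by apply/tame_kernelE; split => [|x x0]; [exact: subgroup_id decomposition_group|exact: tame_char_fixed].
- move=> s u [Ds s1] [Du u1]; split; first exact: subgroup_comp decomposition_group _ _ _ _.
  move=> x x0 /=; have ux0 : u x != 0 by rewrite fmorph_eq0.
  have -> : s (u x) / x - 1 = s (u x) / u x * (u x / x - 1) + (s (u x) / u x - 1).
    by rewrite mulrBr mulr1 addrA subrK mulrA divfK.
  apply: max_idealD => //; last exact: s1.
  by apply: max_idealMl => //; [case: (decomposition_unit Ds ux0)|exact: u1].
- move=> s [Ds s1]; have [u [Du su us]] := subgroup_inv decomposition_group Ds.
  exists u => //; split => // x x0; have ux0 : u x != 0 by rewrite fmorph_eq0.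
  have -> : u x / x - 1 = - (u x / x * (s (u x) / u x - 1)).
    by rewrite su mulrBr mulr1 opprB mulrA divfK// divff.
  apply: max_idealN => //; apply: max_idealMl => //; last exact: s1.
  by case: (decomposition_unit Du x0).
Qed.

Lemma tame_kernel_closed : krull_closed tame_kernel.
Proof.
move=> s sb H; split.
  by apply: decomposition_closed => // S; have [u [Du _] us] := H S; exists u.
by move=> x x0; have [u [_ u1] us] := H [:: x]; rewrite us ?mem_head//; exact: u1.
Qed.

(* The averaging argument: an element of [m]-power order fixes [y] as soon as it acts trivially
   on the tame character of the difference of [y] with its average. *)
Lemma average_fixed s y n : decomposition s -> iter n s y = y -> n%:R != 0 :> k ->
  (forall w, w = y - (n%:R)^-1 * \sum_(i < n) iter i s y -> w != 0 -> tame_char s w 1) -> s y = y.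
Proof.
move=> Ds ny nk H; pose a := (n%:R : Omega)^-1 * \sum_(i < n) iter i s y.
have nO : n%:R != 0 :> Omega by rewrite -(rmorph_nat c) fmorph_eq0.
have sa : s a = a.
  rewrite rmorphM fmorphV rmorph_nat rmorph_sum; congr (_ * _).
  case: n ny {nk H a nO} => [|n] ny; first by rewrite !big_ord0.
  by rewrite big_ord_recr big_ord_recl /= -[s (iter n s y)]/(iter n.+1 s y) ny addrC.
suff /eqP : y - a = 0 by rewrite subr_eq0 => /eqP ->.
apply/eqP; apply: contraT => w0.
have s1 := H _ erefl w0.
have itera i : iter i s a = a by elim: i => //= i ->.
have sum0 : \sum_(i < n) iter i s (y - a) = 0.
  rewrite (eq_bigr (fun i : 'I_n => iter i s y - a)); last first.
    move=> i _; have [u Gu uE] := subgroup_iter i decomposition_group Ds.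
    by rewrite -uE rmorphB /= !uE itera.
  by rewrite sumrB sumr_const card_ord -[a *+ n]mulr_natl /a mulVKf// subrr.
(* The ratios are 1 modulo the maximal ideal, but they sum to 0; so n would vanish in the residue
   field. *)
have : m (\sum_(i < n) (iter i s (y - a) / (y - a) - 1)).
  apply: max_ideal_sum => // i _; have := tame_char_iter i Ds w0 s1.
  by rewrite /tame_char expr1n rmorph1.
rewrite sumrB -mulr_suml sum0 mul0r sub0r sumr_const card_ord -(rmorph_nat c) -rmorphN.
by move=> /(place_const_unit OP)/eqP; rewrite oppr_eq0 (negPf nk).
Qed.

End AtZero.

End LocalTheory.

Lemma pchar_natr_neq0 p (R : nzRingType) n : p \in [pchar R] -> coprime p n -> n%:R != 0 :> R.
Proof.
move=> pR; rewrite prime_coprime ?(pcharf_prime pR)// => pn; by rewrite -(dvdn_pcharf pR).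
Qed.

(** * Wild inertia and the tame quotient *)

Section TameQuotient.

Variables (p : nat) (k Omega : closedFieldType) (c : {rmorphism k -> Omega}).
Hypothesis p_char : p \in [pchar k].
Variables (t : Omega) (t_coord : coordinate c t) (O : set Omega) (OP : place c O).
Hypothesis t_max : max_ideal O t.
Local Notation D := (decomposition c t O).
Local Notation m := (max_ideal O).
Local Notation tame_kernel := (tame_kernel c t O).
Local Notation tame_char := (tame_char c O).
Local Notation polyval := (polyval c).

Let Ov : valuation_ring O := OP.1.
Let Or : subring_set O := place_ring OP.
Let Ot : O t := max_ideal_sub t_max.
Let mt0 : m (t - c 0). Proof. by rewrite rmorph0 subr0. Qed.
Let p_pr : prime p := pcharf_prime p_char.
Let t0 : t != 0 := coordinate_neq0 t_coord.

(** Raising s to the p-part of its period leaves a period prime to p and trivial tame characters, so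
    the averaging argument applies. *)
Lemma tame_kernel_pro_p : pro_p p tame_kernel.
Proof.
move=> s Ts S; have G_group := tame_kernel_group t_coord OP t_max.
have [|N N0 NP] := iter_period S G_group _ Ts.
  by move=> x; have [l lP] := coordinate_aut_finite t_coord x; exists l => u [[/lP]].
have [n' cop NE] := pfactor_coprime p_pr N0; exists (logn p N) => y yS /=.
have [u Tu uE] := subgroup_iter (p ^ logn p N)%N G_group Ts.
rewrite -uE; have [Du u1] := Tu.
apply: (average_fixed t_coord OP t_max Du (n := n')).
- by rewrite (eq_iter uE) -iterM -NE; exact: NP.
- exact: pchar_natr_neq0 p_char cop.
- by move=> w _ w0; have /tame_kernelE[_] := Tu; exact.
Qed.

(** The values of tame characters on [P] have p-power order, and 1 is the only such element of k. *)
Lemma pro_p_sub_tame_kernel P : P `<=` D -> pro_p p P -> P `<=` tame_kernel.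
Proof.
move=> PD Pp s Ps; have Ds := PD _ Ps; apply/tame_kernelE; split => // x x0.
have [a sa] := tame_char_exists t_coord OP t_max Ds x0.
have [n /(_ x (mem_head _ _)) /= nx] := Pp s Ps [:: x].
have sn := tame_char_iter t_coord OP t_max (p ^ n) Ds x0 sa.
have s1 : tame_char (iter (p ^ n) s) x 1.
  by rewrite /tame_char nx divff// rmorph1 subrr; exact: max_ideal0.
by have := tame_char_unique OP sn s1 => /(tame_char_pchar p_char) <-.
Qed.

Lemma tame_kernel_Sylow : pro_p_Sylow p D tame_kernel.
Proof.
split; first by move=> s [].
  split; [exact: tame_kernel_group|exact: tame_kernel_closed|exact: tame_kernel_pro_p].
by move=> P PD [_ _ Pp] _; exact: pro_p_sub_tame_kernel.
Qed.

Lemma Sylow_tame_kernel P : pro_p_Sylow p D P -> tame_kernel `<=` P.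
Proof.
move=> [PD [_ _ Pp] Pmax]; have [TD Tp _] := tame_kernel_Sylow.
by apply: Pmax => //; exact: pro_p_sub_tame_kernel.
Qed.

(** Take a nonzero term dividing all others. If no other term had the same valuation, the sum
    divided by it would be 1 modulo the maximal ideal. *)
Lemma unit_ratio n (F : 'I_n -> Omega) : \sum_i F i = 0 -> (exists i, F i != 0) ->
  exists i j : 'I_n, [/\ (i < j)%N, F i != 0, F j != 0, O (F i / F j) & O (F j / F i)].
Proof.
move=> F0 ne; have [i [i0 iP]] : exists i, F i != 0 /\ forall j, O (F j / F i).
  have [l lP] : exists l : seq 'I_n, forall i, i \in l by exists (enum 'I_n) => i; rewrite mem_enum.
  suff [i [_ i0 iP]] : exists i, [/\ i \in l, F i != 0 & forall j, j \in l -> O (F j / F i)].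
    by exists i; split => // j; exact: iP.
  have {ne lP} : exists2 i, i \in l & F i != 0 by case: ne => i; exists i.
  elim: l => [|a l IH]; first by case.
  have [a0|a0] := eqVneq (F a) 0.
    move=> [i]; rewrite inE => /orP[/eqP->|il i0]; first by rewrite a0 eqxx.
    have [|j [jl j0 jP]] := IH; first by exists i.
    exists j; split; rewrite ?inE ?jl ?orbT// => b; rewrite inE => /orP[/eqP->|]; last exact: jP.
    by rewrite a0 mul0r; exact: (subring0 Or).
  move=> _; have [ne|no] := pselect (exists2 i, i \in l & F i != 0); last first.
    exists a; rewrite mem_head; split => // b; rewrite inE => /orP[/eqP->|bl].
      by rewrite divff//; exact: (subring1 Or).
    have -> : F b = 0 by apply/eqP; apply: contraT => b0; case: no; exists b.
    by rewrite mul0r; exact: (subring0 Or).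
  have [j [jl j0 jP]] := IH ne.
  have [aj|ja] := valuation_ring_total Ov (F a / F j).
    by exists j; split; rewrite ?inE ?jl ?orbT// => b; rewrite inE => /orP[/eqP->|/jP].
  rewrite invf_div in ja; exists a; rewrite mem_head; split => // b; rewrite inE => /orP[/eqP->|bl].
    by rewrite divff//; exact: (subring1 Or).
  have -> : F b / F a = F b / F j * (F j / F a) by rewrite mulrA divfK.
  by apply: (subringM Or) => //; exact: jP.
have [j [ij j0 Oij]] : exists j, [/\ j != i, F j != 0 & O (F i / F j)].
  apply: contrapT => no; apply: (max_ideal1 Ov).
  have := congr1 (fun x => x / F i) F0; rewrite /= mul0r (bigD1 i)//= mulrDl divff// => /eqP.
  rewrite addr_eq0 => /eqP ->; apply: max_idealN => //; rewrite mulr_suml big_mkcond.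
  apply: max_ideal_sum => // j _; case: ifP => ji; last exact: max_ideal0.
  apply: contrapT => nm; apply: no; exists j.
  have [q0 Oq] := valuation_unit Ov (iP j) nm; rewrite invf_div in Oq; split => //.
  by apply: contra_neq q0 => ->; rewrite mul0r.
have [lt|lt|/val_inj E] := ltngtP (i : nat) j; last by rewrite E eqxx in ij.
  by exists i, j; split.
by exists j, i; split.
Qed.

Lemma polyval_order P : P != 0 -> exists l g, [/\ polyval t P = t ^+ l * g, O g & O g^-1].
Proof.
move=> P0; have [l [g [gr PE]]] : exists l g, ~~ root g 0 /\ P = g * 'X^l.
  have [l [g gr PE]] := multiplicity_XsubC P 0; exists l, g; split; last by rewrite PE subr0.
  by move: gr; rewrite P0.
exists l, (polyval t g).
have ng : ~ m (polyval t g).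
  move=> mg; have : m (c g.[0]).
    rewrite -[X in m X](subKr (polyval t g)); apply: max_idealB => //.
    exact: place_polyval_congr.
  by move=> /(place_const_unit OP)/rootP; rewrite (negPf gr).
have Og := place_polyval g OP Ot; have [_ Vg] := valuation_unit Ov Og ng.
by split => //; rewrite PE rmorphM rmorphXn /= polyvalX mulrC.
Qed.

(** Two terms of the relation have the same valuation, and their ratio is a power of w times a power
    of t, up to units. The bound on [e] bounds ramification by degree. *)
Lemma power_relation w (Q : {poly {poly k}}) : w != 0 -> Q != 0 -> root (map_poly (polyval t) Q) w ->
  exists e i j al, [/\ (0 < e < size Q)%N, O al, O al^-1, al != 0 & w ^+ e * t ^+ i = al * t ^+ j].
Proof.
move=> w0 Q0 Qw; have [||i [j [ij Fi Fj Oij Oji]]] := @unit_ratio (size Q) (fun i => polyval t Q`_i * w ^+ i).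
- have := rootP Qw; rewrite (@horner_coef_wide _ (size Q)) ?size_poly// => H; rewrite -[RHS]H.
  by apply: eq_bigr => i _; rewrite coef_map.
- have sQ : (0 < size Q)%N by rewrite lt0n size_poly_eq0.
  have lt : ((size Q).-1 < size Q)%N by rewrite prednK.
  exists (Ordinal lt); rewrite mulf_neq0 ?expf_neq0//= polyval_eq0// -lead_coefE lead_coef_eq0//.
have nz (h : 'I_(size Q)) : polyval t Q`_h * w ^+ h != 0 -> Q`_h != 0.
  by apply: contra_neq => ->; rewrite rmorph0 mul0r.
have [li [gi [EI Ogi OVgi]]] := polyval_order (nz _ Fi).
have [lj [gj [EJ Ogj OVgj]]] := polyval_order (nz _ Fj).
have gi0 : gi != 0.
  by move: Fi; apply: contra_neq => g0; rewrite EI g0 mulr0 mul0r.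
have gj0 : gj != 0.
  by move: Fj; apply: contra_neq => g0; rewrite EJ g0 mulr0 mul0r.
set Ti := (X in O (_ / X) ) in Oji; set Tj := (X in O (_ / X)) in Oij.
exists (j - i)%N, lj, li, (Tj / Ti * (gi / gj)); split.
- by rewrite subn_gt0 ij (leq_ltn_trans (leq_subr _ _)).
- by apply: (subringM Or) => //; exact: (subringM Or).
- by rewrite invfM !invf_div; apply: (subringM Or) => //; exact: (subringM Or).
- by apply: mulf_neq0; apply: mulf_neq0; rewrite ?invr_eq0.
have EJ' : Tj / gj = t ^+ lj * (w ^+ (j - i) * w ^+ i).
  by rewrite /Tj EJ mulrAC mulfK// -exprD subnK// ltnW.
have EI' : t ^+ li * gi / Ti = (w ^+ i)^-1.
  by rewrite /Ti EI invfM mulrA divff ?mul1r// mulf_neq0 ?expf_neq0.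
transitivity (Tj / gj * (t ^+ li * gi / Ti)).
  by rewrite EJ' EI' -mulrA mulfK ?expf_neq0// mulrC.
by rewrite mulrACA [gj^-1 * _]mulrC [t ^+ li * gi]mulrC [Tj * (_ * _)]mulrA [X in _ = X * _]mulrACA [RHS]mulrAC.
Qed.

Lemma valuation_root x n : (0 < n)%N -> O (x ^+ n) -> O x.
Proof.
have [->|x0] := eqVneq x 0; first by move=> _ _; exact: (subring0 Or).
case: n => // n _ On; apply: contrapT => nO; have mx := max_idealV Ov x0 nO.
apply: (max_ideal1 Ov); rewrite -(divff (expf_neq0 n.+1 x0)) -exprVn.
apply: max_idealMl => //; rewrite exprS; apply: max_idealMr => //.
by apply: (subringX Or); exact: max_ideal_sub.
Qed.

(** Let n be the prime-to-p part of e and u = tau^(r/n), an n-th root of t fixed by s. The n-th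
    power of w^(p^a) u^i / u^j is a unit, so this element is a unit and its tame character is
    trivial. Hence the character at w has p-power order, and is 1. *)
Lemma tame_char_root_fixed s w e i j al tau r : D s -> w != 0 -> (0 < e)%N ->
  O al -> O al^-1 -> al != 0 -> w ^+ e * t ^+ i = al * t ^+ j ->
  s tau = tau -> tau ^+ r = t -> (forall n, coprime p n -> n %| e -> n %| r)%N -> tame_char s w 1.
Proof.
move=> Ds w0 e0 Oal OVal al0 E stau taur H.
have [n cop eE] := pfactor_coprime p_pr e0; set a := logn p e in eE.
have /dvdnP[d rE] : (n %| r)%N by apply: H => //; rewrite eE dvdn_mulr.
pose u := tau ^+ d; have ut : u ^+ n = t by rewrite -exprM -rE.
have su : s u = u by rewrite rmorphXn stau.
have u0 : u != 0 by apply: contra_neq t0 => u0; rewrite -ut u0 expr0n; case: (n) cop => //; rewrite /coprime gcdn0; case: (p) p_pr => [|[]].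
have n0 : n != 0%N by apply/eqP => n0; rewrite eE n0 mul0n in e0.
pose be := w ^+ (p ^ a) * u ^+ i / u ^+ j.
have be0 : be != 0 by rewrite mulf_eq0 invr_eq0 mulf_eq0 (negPf (expf_neq0 i u0)) (negPf (expf_neq0 j u0)) (negPf (expf_neq0 _ w0)).
have uX l : (u ^+ l) ^+ n = t ^+ l by rewrite -exprM mulnC exprM ut.
have bn : be ^+ n = al.
  by rewrite /be expr_div_n exprMn !uX -exprM mulnC -eE E mulfK ?expf_neq0.
have Ob : O be by apply: (@valuation_root _ n); rewrite ?lt0n ?bn.
have OVb : O be^-1 by apply: (@valuation_root _ n); rewrite ?lt0n// exprVn bn.
have [x sx] := tame_char_exists t_coord OP t_max Ds w0.
have sb := tame_char_unit t_coord OP t_max Ds Ob OVb be0.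
have fixX l : tame_char s (u ^+ l) 1.
  by apply: (tame_char_fixed OP); [exact: expf_neq0|rewrite rmorphXn /= su].
have s1 := tame_charM t_coord OP t_max Ds be0 sb (fixX j); rewrite /be (divfK (expf_neq0 j u0)) in s1.
have wa0 : w ^+ (p ^ a) != 0 by rewrite expf_neq0.
have s2 := tame_charM t_coord OP t_max Ds wa0 (tame_charX t_coord OP t_max (p ^ a) Ds w0 sx) (fixX i).
have := tame_char_unique OP s2 s1; rewrite !mulr1 => /(tame_char_pchar p_char) x1.
by rewrite -x1.
Qed.

Lemma root_period s x n : coordinate_aut c t s -> (0 < n)%N -> x ^+ n = t -> iter n s x = x.
Proof.
move=> [_ st sc] n0 xn; have x0 : x != 0.
  by apply: contra_neq t0 => x0; rewrite -xn x0 expr0n eqn0Ngt n0.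
have zn : (s x / x) ^+ n = 1 by rewrite expr_div_n -rmorphXn xn st divff.
have [||b zE] := @polyval_root _ _ c (s x / x) ('X^n - 1).
- by rewrite -size_poly_eq0 size_XnsubC.
- by rewrite rmorphB rmorphXn rmorph1 /= polyvalX zn subrr.
have sx : s x = c b * x by rewrite -zE divfK.
have sl l : iter l s x = c b ^+ l * x.
  by elim: l => [|l IH]; rewrite ?mul1r// iterS IH rmorphM rmorphXn sc sx mulrA exprSr.
by rewrite sl -zE zn mul1r.
Qed.

(** By compactness the powers s^(1 + q p^a) have a limit u fixing all roots of t of order prime to
    p. Such a u is in the wild inertia, so it fixes S, and s^(1 + q p^a) y = y for some q. Its n-th
    power and s^(n p^a) y = y give s^n y = y. *)
Lemma tame_part s (S : seq Omega) a n : D s -> coprime p n ->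
  (forall y, y \in S -> iter (n * p ^ a) s y = y) ->
  (forall u, tame_kernel u -> forall y, y \in S -> u y = y) ->
  forall y, y \in S -> iter n s y = y.
Proof.
move=> Ds cop sN TS.
have D_group := decomposition_group c t O.
have pgt0 h : coprime p h -> (0 < h)%N.
  by case: h => //; rewrite /coprime gcdn0 => /eqP p1; move: p_pr; rewrite p1.
have [|u Du uP] := compactness D_group (@decomposition_finite _ _ c t t_coord O)
  (@decomposition_closed _ _ c t O)
  (R := fun x y => ((exists2 h, coprime p h & x ^+ h = t) -> y = x) /\
                   (x \in S -> exists q, y = iter (1 + q * p ^ a) s x)).
  move=> L; have [h [h0 hp hP]] : exists h, [/\ (0 < h)%N, coprime p h & forall x, x \in L ->
      (exists2 h, coprime p h & x ^+ h = t) -> iter h s x = x].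
    elim: L => [|x L [h [h0 hp hP]]]; first by exists 1%N; rewrite coprimen1.
    have [[h' h'p xh']|no] := pselect (exists2 h, coprime p h & x ^+ h = t); last first.
      by exists h; split => // y; rewrite inE => /orP[/eqP-> /no//|]; exact: hP.
    exists (h * h')%N; rewrite muln_gt0 h0 pgt0// coprimeMr hp h'p; split => // y.
    rewrite inE => /orP[/eqP-> _|yL yr].
      by apply: iter_mul_fixed; apply: root_period => //; [case: Ds|exact: pgt0].
    by rewrite mulnC; apply: iter_mul_fixed; exact: hP.
  (* As h is prime to p, some 1 + u2 p^a is a multiple of h. *)
  have : coprime h (p ^ a) by rewrite coprime_sym; apply: coprimeXl.
  move/(coprimeP _ h0) => [[u1 u2] /= uu].
  have uE : (1 + u2 * p ^ a = u1 * h)%N by lia.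
  have [v Dv vE] := subgroup_iter (1 + u2 * p ^ a) D_group Ds.
  exists v => // x xL; rewrite vE; split=> [xr|_]; last by exists u2.
  by rewrite uE; apply: iter_mul_fixed; exact: hP.
have Tu : tame_kernel u.
  apply/tame_kernelE; split => // w w0; have [Q Q0 Qw] := t_coord.2 w.
  have [e [i [j [al [/andP[e0 _] Oal OVal al0 E]]]]] := power_relation w0 Q0 Qw.
  have [n' cop' eE] := pfactor_coprime p_pr e0.
  have [x xn] : exists x : Omega, x ^+ n' = t.
    have /closed_rootP[x] : size ('X^n' - t%:P : {poly Omega}) != 1%N.
      by rewrite size_XnsubC ?pgt0// eqSS -lt0n pgt0.
    by rewrite /root !hornerE subr_eq0 => /eqP; exists x.
  apply: (tame_char_root_fixed (tau := x) (r := n') Du w0 e0 Oal OVal al0 E _ xn).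
    by apply: (uP x).1; exists n'.
  by move=> h hp; rewrite eE Gauss_dvdl//; apply: coprimeXr; rewrite coprime_sym.
move=> y yS; have [q] := (uP y).2 yS; rewrite TS// => qE.
have yq : iter (n + n * p ^ a * q) s y = y.
  have -> : (n + n * p ^ a * q = n * (1 + q * p ^ a))%N by lia.
  by apply: iter_mul_fixed.
rewrite -[RHS]yq iterD; congr (iter n s _); symmetry.
by rewrite mulnC; apply: iter_mul_fixed; exact: sN.
Qed.

End TameQuotient.

(** The form used both at 0 and at infinity: [d] bounds the degrees of the averaged differences,
    hence their ramification, and [r] absorbs every prime-to-p index up to [d]. *)
Lemma tame_fixed p (k Omega : closedFieldType) (c : {rmorphism k -> Omega}) (t : Omega) (O : set Omega)
    s (S : seq Omega) a n r tau d :
  p \in [pchar k] -> coordinate c t -> place c O -> max_ideal O t ->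
  decomposition c t O s -> coprime p n ->
  (forall y, y \in S -> iter (n * p ^ a) s y = y) ->
  (forall u, tame_kernel c t O u -> forall y, y \in S -> u y = y) ->
  s tau = tau -> tau ^+ r = t -> (forall h, coprime p h -> (0 < h <= d)%N -> h %| r)%N ->
  (forall y, y \in S -> exists Q : {poly {poly k}}, [/\ Q != 0, (size Q <= d.+1)%N &
     root (map_poly (polyval c t) Q) (y - (n%:R)^-1 * \sum_(i < n) iter i s y)]) ->
  forall y, y \in S -> s y = y.
Proof.
move=> pk t_coord OP mt Ds cop sN TS stau taur dr QP y yS.
have := tame_part pk t_coord OP mt Ds cop sN TS => /(_ y yS) ny.
apply: (average_fixed t_coord OP mt Ds ny (pchar_natr_neq0 pk cop)) => w wE w0.
have [Q [Q0 sQ Qw]] := QP y yS; rewrite -wE in Qw.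
have [e [i [j [al [/andP[e0 eQ] Oal OVal al0 E]]]]] := power_relation t_coord OP mt w0 Q0 Qw.
apply: (tame_char_root_fixed pk t_coord OP mt Ds w0 e0 Oal OVal al0 E stau taur) => h hp he.
have h0 : (0 < h)%N := dvdn_gt0 e0 he.
apply: dr => //; rewrite h0 (leq_trans (dvdn_leq e0 he))// -ltnS (leq_trans eQ)//.
Qed.

Section TameCover.

Variables (p : nat) (k Omega : closedFieldType) (c : {rmorphism k -> Omega}).
Variables (t : Omega) (t_coord : coordinate c t).
Hypothesis p_char : p \in [pchar k].
Local Notation G := (coordinate_aut c t).
Local Notation polyval := (polyval c).

Let t0 : t != 0 := coordinate_neq0 t_coord.
Let p_pr : prime p := pcharf_prime p_char.

Lemma coordinate_autV (s : {rmorphism Omega -> Omega}) : coordinate_aut c t^-1 s <-> G s.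
Proof.
split=> -[sb st sc]; split => //; last by rewrite fmorphV st.
by rewrite -[t]invrK fmorphV st.
Qed.

Lemma common_degree u (l : seq Omega) : coordinate c u -> exists d, forall w, w \in l ->
  exists Q : {poly {poly k}}, [/\ Q != 0, (size Q <= d.+1)%N & root (map_poly (polyval u) Q) w].
Proof.
move=> uc; elim: l => [|w l [d IH]]; first by exists 0%N.
have [Q Q0 Qw] := uc.2 w; exists (maxn (size Q) d) => z; rewrite inE => /orP[/eqP->|/IH[Q' [? ? ?]]].
  by exists Q; split => //; rewrite leqW ?leq_maxl.
by exists Q'; split => //; rewrite (leq_trans (_ : _ <= d.+1)%N)// ltnS leq_maxr.
Qed.

Variable K : set {rmorphism Omega -> Omega}.
Hypothesis K_normal : forall s s' u, G s -> G s' -> (forall x, s (s' x) = x) -> K u -> K (s' \o (u \o s)).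
Hypothesis K_unramified : forall (b : k) O s, b != 0 -> place c O -> max_ideal O (t - c b) ->
  decomposition c t O s -> K s.
Hypothesis K_zero : forall O s, place c O -> max_ideal O t -> tame_kernel c t O s -> K s.
Hypothesis K_infinity : forall O s, place c O -> max_ideal O t^-1 -> tame_kernel c t^-1 O s -> K s.

(* A covering of the multiplicative group which is tame at zero and at infinity
   is dominated by some [r]-th power map. *)
Theorem tame_cover x : fixed_by K x ->
  exists r, [/\ (0 < r)%N, coprime p r & forall tau, tau ^+ r = t ->
    forall s, G s -> s tau = tau -> s x = x].
Proof.
move=> Kx; have G_group := coordinate_aut_group c t; have G_fin := coordinate_aut_finite t_coord.
have [S [uS SP]] := orbit_seq G_fin x.
have KS z : z \in S -> fixed_by K z.
  move=> /SP[s Gs ->] u Ku; have [s' [Gs' ss' s's]] := subgroup_inv G_group Gs.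
  have := Kx _ (K_normal Gs Gs' ss' Ku) => /= H.
  by rewrite -[LHS]ss' H.
have GS s z : G s -> z \in S -> s z \in S.
  by move=> Gs /SP[u Gu ->]; apply/SP; exists (s \o u) => //; exact: subgroup_comp.
have iterS s i z : G s -> z \in S -> iter i s z \in S.
  by move=> Gs zS; elim: i => //= i; exact: GS.
(* Cycles in S have length at most [size S], so its factorial is a period of every automorphism on
   S; [n] is the prime-to-p part. *)
have [n cop NE] := pfactor_coprime p_pr (fact_gt0 (size S)); set a := logn p _ in NE.
have sN s z : G s -> z \in S -> iter (n * p ^ a) s z = z.
  move=> Gs zS; have [|h [/andP[h0 hS] hz]] := @iter_return _ s S z; first by move=> i; exact: iterS.
  have /dvdnP[q ->] : (h %| n * p ^ a)%N by rewrite -NE dvdn_fact// h0.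
  exact: iter_mul_fixed.
have [T [uT TP]] := orbit_vectors G_fin S.
have [g gP] : {g : seq Omega -> {rmorphism Omega -> Omega} &
    forall v, v \in T -> G (g v) /\ v = map (g v) S}.
  apply: (@choice _ _ (fun v s => v \in T -> G s /\ v = map s S)) => v.
  by have [/TP[s Gs ->]|_] := boolP (v \in T); [exists s|exists idfun].
pose w (s : Omega -> Omega) y := y - (n%:R)^-1 * \sum_(i < n) iter i s y.
(* The averaged differences depend on s only through its values on S, so there are finitely many;
   their degrees are bounded before [r] is chosen, and [r] does not depend on s. *)
pose ws := [seq w (g v) y | v <- T, y <- S].
have [d1 d1P] := common_degree ws t_coord.
have [d2 d2P] := common_degree ws (coordinateV t_coord).
pose d := maxn d1 d2.
have wsP s y : G s -> y \in S -> w s y \in ws.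
  move=> Gs yS; have sT : map s S \in T by apply/TP; exists s.
  apply/allpairsP; exists (map s S, y); split => //=; congr (_ - _ * _); apply: eq_bigr => i _.
  have [Gg gE] := gP _ sT; have sg := (eq_map_agree S s (g (map s S))).1 gE.
  elim: (i : nat) => //= h IH; rewrite -IH sg//; exact: iterS.
have [r copr dE] := pfactor_coprime p_pr (fact_gt0 d).
have r0 : (0 < r)%N.
  by rewrite lt0n; apply/eqP => r0; have := fact_gt0 d; rewrite dE r0 mul0n.
have dr h : coprime p h -> (0 < h <= d)%N -> (h %| r)%N.
  move=> hp hd; have := dvdn_fact hd; rewrite dE Gauss_dvdl//.
  by apply: coprimeXr; rewrite coprime_sym.
exists r; split => // tau taur s Gs stau.
have tau_coord := coordinate_root r0 taur t_coord.
have sub u : coordinate_aut c tau u -> G u.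
  by move=> [ub ut uc]; split => //; rewrite -taur rmorphXn /= ut.
have Ctau : coordinate_aut c tau s by case: Gs.
have xS : x \in S by apply/SP; exists idfun; [exact: subgroup_id|].
(* Over the tau-line the covering is unramified everywhere, the tame ramification at 0 and infinity
   having been absorbed by tau. *)
apply: (unramified_fixed tau_coord p_char (S := S)) => // {s Gs stau Ctau}.
  by move=> u z /sub; exact: GS.
move=> O OP nontriv s Cs sO z zS; have [_ stau _] := Cs; have Gs := sub _ Cs.
have [Ov Oc] := OP; have Ds : decomposition c t O s by [].
have [mt|nmt] := pselect (max_ideal O t).
  apply: (tame_fixed (d := d) p_char t_coord OP mt Ds cop (S := S) (a := a) _ _ stau taur dr) => //.
  - by move=> y; exact: sN.
  - by move=> u /(K_zero OP mt) Ku y /KS; exact.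
  - move=> y yS; have [Q [Q0 sQ Qw]] := d1P _ (wsP _ _ Gs yS).
    by exists Q; split => //; rewrite (leq_trans sQ)// ltnS leq_maxl.
have [Ot|nOt] := pselect (O t).
  have [b mb] := place_center t_coord OP Ot nontriv.
  have b0 : b != 0 by apply: contra_notN nmt => /eqP b0; rewrite b0 rmorph0 subr0 in mb.
  by apply: (KS z zS); exact: (K_unramified b0 OP mb Ds).
have mt := max_idealV Ov t0 nOt.
have DVs : decomposition c t^-1 O s by split => //; apply/coordinate_autV.
apply: (tame_fixed (d := d) (tau := tau^-1) p_char (coordinateV t_coord) OP mt DVs cop (S := S) (a := a) _ _ _ _ dr) => //.
- by move=> y; exact: sN.
- by move=> u /(K_infinity OP mt) Ku y /KS; exact.
- by rewrite fmorphV stau.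
- by rewrite exprVn taur.
- move=> y yS; have [Q [Q0 sQ Qw]] := d2P _ (wsP _ _ Gs yS).
  by exists Q; split => //; rewrite (leq_trans sQ)// ltnS leq_maxr.
Qed.

End TameCover.

(** * Zariski closures, continuity and cyclic quotients *)

Section PolynomialFunctions.

Variables (E : closedFieldType) (m : nat).
Implicit Types (f : 'M[E]_m -> E) (F : {mpoly E[m * m]}).

Definition polyfun f := exists F, forall h, f h = F.@[mxvec h 0].

Lemma polyfun_const a : polyfun (fun=> a).
Proof. by exists a%:MP => h; rewrite mevalC. Qed.

Lemma polyfun_entry i j : polyfun (fun h => h i j).
Proof. by exists 'X_(mxvec_index i j) => h; rewrite mevalXU mxvecE. Qed.

Lemma polyfunD f g : polyfun f -> polyfun g -> polyfun (fun h => f h + g h).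
Proof. by move=> [F FE] [F' FE']; exists (F + F') => h; rewrite mevalD -FE -FE'. Qed.

Lemma polyfunM f g : polyfun f -> polyfun g -> polyfun (fun h => f h * g h).
Proof. by move=> [F FE] [F' FE']; exists (F * F') => h; rewrite mevalM -FE -FE'. Qed.

Lemma polyfun_sum (I : Type) (r : seq I) (P : pred I) (f : I -> 'M[E]_m -> E) :
  (forall i, polyfun (f i)) -> polyfun (fun h => \sum_(i <- r | P i) f i h).
Proof.
move=> fP; elim: r => [|i r IH].
  by have [F FE] := polyfun_const 0; exists F => h; rewrite big_nil -FE.
have [F FE] : polyfun (fun h => (if P i then f i h else 0) + \sum_(i <- r | P i) f i h).
  by apply: polyfunD => //; case: (P i); [exact: fP|exact: polyfun_const].
by exists F => h; rewrite -FE big_cons; case: (P i); rewrite ?add0r.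
Qed.

Lemma polyfun_prod (I : Type) (r : seq I) (P : pred I) (f : I -> 'M[E]_m -> E) :
  (forall i, polyfun (f i)) -> polyfun (fun h => \prod_(i <- r | P i) f i h).
Proof.
move=> fP; elim: r => [|i r IH].
  by have [F FE] := polyfun_const 1; exists F => h; rewrite big_nil -FE.
have [F FE] : polyfun (fun h => (if P i then f i h else 1) * \prod_(i <- r | P i) f i h).
  by apply: polyfunM => //; case: (P i); [exact: fP|exact: polyfun_const].
by exists F => h; rewrite -FE big_cons; case: (P i); rewrite ?mul1r.
Qed.

Lemma polyfunX f e : polyfun f -> polyfun (fun h => f h ^+ e).
Proof.
move=> fP; have [F FE] := polyfun_prod (index_enum 'I_e) xpredT (f := fun=> f) (fun=> fP).
by exists F => h; rewrite -FE prodr_const card_ord.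
Qed.

Lemma polyfun_det r (phi : 'M[E]_m -> 'M[E]_r) : (forall i j, polyfun (fun h => phi h i j)) ->
  polyfun (fun h => \det (phi h)).
Proof.
move=> P; rewrite /determinant; apply: polyfun_sum => s; apply: polyfunM; first exact: polyfun_const.
by apply: polyfun_prod => i.
Qed.

Lemma polyfun_meval F (phi : 'M[E]_m -> 'M[E]_m) : (forall i j, polyfun (fun h => phi h i j)) ->
  polyfun (fun h => F.@[mxvec (phi h) 0]).
Proof.
move=> P; elim/mpoly_ring_ind: F => [a|i|p q [F FE] [F' FE']|p q [F FE] [F' FE']].
- by exists a%:MP => h; rewrite !mevalC.
- case/mxvec_indexP: i => i j; have [F FE] := P i j.
  by exists F => h; rewrite mevalXU mxvecE FE.
- by exists (F + F') => h; rewrite !mevalD FE FE'.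
- by exists (F * F') => h; rewrite !mevalM FE FE'.
Qed.

Lemma polyfun_adj i j : polyfun (fun h => (\adj h) i j).
Proof.
have [F FE] : polyfun (fun h => (-1) ^+ (j + i) * \det (row' j (col' i h))).
  apply: polyfunM; first exact: polyfun_const.
  apply: polyfun_det => a b; have [F FE] := polyfun_entry (lift j a) (lift i b).
  by exists F => h; rewrite -FE !mxE.
by exists F => h; rewrite -FE mxE.
Qed.

(** The entries of the inverse are those of the adjugate over the determinant; a power of the
    determinant clears the denominators of F. *)
Lemma polyfun_inv F : exists e F', forall h, h \in unitmx ->
  F'.@[mxvec h 0] = \det h ^+ e * F.@[mxvec (invmx h) 0].
Proof.
have detP e := polyfunX e (polyfun_det (phi := id) polyfun_entry).
elim/mpoly_ring_ind: F => [a|i|p q [e [F FE]] [e' [F' FE']]|p q [e [F FE]] [e' [F' FE']]].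
- by exists 0%N, a%:MP => h _; rewrite !mevalC expr0 mul1r.
- case/mxvec_indexP: i => i j; have [F FE] := polyfun_adj i j; exists 1%N, F => h hu.
  rewrite -FE mevalXU mxvecE expr1 /invmx hu !mxE mulrA divff ?mul1r//.
  by rewrite -unitfE -unitmxE.
- have [d dE] := detP e; have [d' dE'] := detP e'.
  exists (e + e')%N, (d' * F + d * F') => h hu.
  by rewrite !mevalD !mevalM FE// FE'// -dE -dE' exprD mulrDr !mulrA [X in X * _ + _]mulrC.
- exists (e + e')%N, (F * F') => h hu; rewrite !mevalM FE// FE'// exprD.
  by rewrite mulrACA.
Qed.

Local Notation zc := (@zariski_closure E m).

Lemma sub_zariski S : (forall h, S h -> h \in unitmx) -> S `<=` zc S.
Proof. by move=> Su h Sh; split; [exact: Su|move=> F; exact]. Qed.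

Lemma zariski_map (phi : 'M[E]_m -> 'M[E]_m) S T : (forall i j, polyfun (fun h => phi h i j)) ->
  (forall h, h \in unitmx -> phi h \in unitmx) -> (forall h, S h -> zc T (phi h)) ->
  forall g, zc S g -> zc T (phi g).
Proof.
move=> P Pu ST g [gu gS]; split; first exact: Pu.
move=> F FT; have [F' FE] := polyfun_meval F P; rewrite FE; apply: gS => h /ST[_ H].
by rewrite -FE; exact: H.
Qed.

Lemma zariski_idem S : zc (zc S) `<=` zc S.
Proof. by move=> g H; apply: (zariski_map (phi := id) (S := zc S)) => //; exact: polyfun_entry. Qed.

Lemma polyfun_mul (a b : 'M[E]_m) i j : polyfun (fun h : 'M[E]_m => (a *m h *m b) i j).
Proof.
have [F FE] : polyfun (fun h => \sum_l (\sum_r a i r * h r l) * b l j).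
  apply: polyfun_sum => l; apply: polyfunM; last exact: polyfun_const.
  by apply: polyfun_sum => r; apply: polyfunM; [exact: polyfun_const|exact: polyfun_entry].
by exists F => h; rewrite -FE mxE; apply: eq_bigr => l _; rewrite mxE.
Qed.

Lemma zariski_mul a b S T : a \in unitmx -> b \in unitmx -> (forall h, S h -> zc T (a *m h *m b)) ->
  forall g, zc S g -> zc T (a *m g *m b).
Proof.
move=> au bu; apply: zariski_map; first exact: polyfun_mul.
by move=> h hu; rewrite !unitmx_mul au hu.
Qed.

(** Products pass to the closure one factor at a time, the other being held fixed. *)
Lemma zariski_group S : matrix_subgroup S -> matrix_subgroup (zc S).
Proof.
move=> [Su S1 SM SV]; have u1 : 1%:M \in @unitmx E m by rewrite unitmx1.
have sub := sub_zariski Su.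
split; [by move=> g []|exact: sub| |].
- move=> g h Gg Gh; have [hu _] := Gh.
  rewrite -[g]mul1mx; apply: (zariski_mul (S := S)) => // a Sa.
  rewrite mul1mx -[a *m h]mulmx1; apply: (zariski_mul (S := S)) => // [|b Sb]; first exact: Su.
  by rewrite mulmx1; apply: sub; exact: SM.
- move=> g [gu gS]; split; first by rewrite unitmx_inv.
  move=> F FS; have [e [F' FE]] := polyfun_inv F.
  have : F'.@[mxvec g 0] = 0.
    by apply: gS => h Sh; rewrite FE ?Su// FS ?mulr0//; exact: SV.
  rewrite FE// => /eqP; rewrite mulf_eq0 expf_eq0 => /orP[/andP[_]|/eqP//].
  by rewrite -[_ == 0]negbK -unitfE -unitmxE gu.
Qed.

Lemma zariski_union S n (N : nat -> set 'M[E]_m) : (forall h, S h -> exists2 i, (i < n)%N & N i h) ->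
  (forall i, zc (N i) `<=` N i) -> forall g, zc S g -> exists2 i, (i < n)%N & N i g.
Proof.
move=> SN Ncl g [gu gS]; apply: contrapT => no.
have [F FP] : {F : nat -> {mpoly E[m * m]} & forall i, (i < n)%N ->
    (forall h, N i h -> (F i).@[mxvec h 0] = 0) /\ (F i).@[mxvec g 0] != 0}.
  apply: (@choice _ _ (fun i F => (i < n)%N ->
    (forall h, N i h -> F.@[mxvec h 0] = 0) /\ F.@[mxvec g 0] != 0)) => i.
  have [li|_] := ltnP i n; last by exists 0.
  apply: contrapT => no'; apply: no; exists i => //; apply: Ncl; split => // F FN.
  by apply: contrapT => /eqP Fg; apply: no'; exists F.
have prodE h : (\prod_(i < n) F i).@[mxvec h 0] = \prod_(i < n) (F i).@[mxvec h 0].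
  exact: rmorph_prod.
have := gS (\prod_(i < n) F i); rewrite prodE => H.
have /eqP : \prod_(i < n) (F i).@[mxvec g 0] = 0.
  apply: H => h /SN[i li Nh]; rewrite prodE (bigD1 (Ordinal li))//= ((FP i li).1 h Nh) mul0r//.
by apply/negP; apply/prodf_neq0 => i _; rewrite (FP i _).2.
Qed.

End PolynomialFunctions.

(** Representations take bundled morphisms as arguments, so composites that agree pointwise must be
    equal as records. *)
Lemma rmorphism_ext (R S : nzRingType) (s t : {rmorphism R -> S}) : s =1 t -> s = t.
Proof.
case: s t => [f [[mf] [mf']]] [g [[mg] [mg']]] /= /funext fg; subst g.
by rewrite (Prop_irrelevance mf mg) (Prop_irrelevance mf' mg').
Qed.

(** * Continuous representations and closed preimages *)

Section Continuity.

Variables (E : closedFieldType) (w : E -> rat) (w_val : is_valuation w).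

Let wM x y : x != 0 -> y != 0 -> w (x * y) = w x + w y. Proof. exact: w_val.1. Qed.

Lemma valuation1 : w 1 = 0.
Proof. by have := wM (oner_neq0 E) (oner_neq0 E); rewrite mulr1 -{1}[w 1]addr0 => /addrI. Qed.

Lemma valuationN x : w (- x) = w x.
Proof.
have [->|x0] := eqVneq x 0; first by rewrite oppr0.
have N1 : (-1 : E) != 0 by rewrite oppr_eq0 oner_neq0.
suff w1 : w (-1) = 0 by rewrite -mulN1r wM// w1 add0r.
have := wM N1 N1; rewrite mulrNN mulr1 valuation1 => /esym/eqP.
by rewrite -mulr2n mulrn_eq0 => /eqP.
Qed.

Lemma val_ge0 N : val_ge w N 0. Proof. by left. Qed.

Lemma val_geW N N' x : (N <= N')%N -> val_ge w N' x -> val_ge w N x.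
Proof. by move=> NN [->|wx]; [left|right; rewrite (le_trans _ wx)// ler_nat]. Qed.

Lemma val_geN N x : val_ge w N x -> val_ge w N (- x).
Proof. by move=> [->|wx]; [left; rewrite oppr0|right; rewrite valuationN]. Qed.

Lemma val_geD N x y : val_ge w N x -> val_ge w N y -> val_ge w N (x + y).
Proof.
move=> [->|wx] [->|wy]; rewrite ?addr0 ?add0r; [by left|by right|by right|].
have [->|x0] := eqVneq x 0; first by rewrite add0r; right.
have [->|y0] := eqVneq y 0; first by rewrite addr0; right.
have [->|xy0] := eqVneq (x + y) 0; [by left|right].
by rewrite (le_trans _ (w_val.2 x y x0 y0 xy0))// le_min wx.
Qed.

Lemma val_ge_sum (I : Type) (r : seq I) (F : I -> E) N :
  (forall i, val_ge w N (F i)) -> val_ge w N (\sum_(i <- r) F i).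
Proof. by move=> FN; elim/big_ind: _ => //; [exact: val_ge0|move=> x y; exact: val_geD]. Qed.

Lemma val_geM N x y : val_ge w N x -> val_ge w 0 y -> val_ge w N (x * y).
Proof.
move=> [->|wx] [->|wy]; rewrite ?mul0r ?mulr0; try by left.
have [->|x0] := eqVneq x 0; first by rewrite mul0r; left.
have [->|y0] := eqVneq y 0; first by rewrite mulr0; left.
by right; rewrite wM// -[N%:R]addr0 lerD.
Qed.

Lemma val_ge_scale a N : exists N', forall x, val_ge w N' x -> val_ge w N (a * x).
Proof.
have [->|a0] := eqVneq a 0; first by exists 0%N => x _; rewrite mul0r; left.
have [b bP] : exists b : nat, - w a <= b%:R.
  by exists (Num.Def.archi_bound (`|- w a|)); rewrite (le_trans (ler_norm _))// ltW// archi_boundP.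
exists (N + b)%N => x [->|wx]; first by rewrite mulr0; left.
have [->|x0] := eqVneq x 0; first by rewrite mulr0; left.
right; rewrite wM//; rewrite natrD in wx.
by rewrite -[N%:R](addrK b%:R) addrC lerD// lerNl.
Qed.

Lemma val_ge_eq0 x : (forall N, val_ge w N x) -> x = 0.
Proof.
move=> H; have [//|wx] := H (Num.Def.archi_bound `|w x|).
have := archi_boundP (normr_ge0 (w x)); rewrite ltNge (le_trans wx)//.
exact: ler_norm.
Qed.

(** Continuity at g along g M with M near the identity, the form in which [continuous_rep] supplies
    approximations. *)
Lemma meval_continuous m (F : {mpoly E[m * m]}) (g : 'M[E]_m) N : exists N', forall M : 'M[E]_m,
  (forall i j, val_ge w N' ((M - 1%:M) i j)) ->
  val_ge w N (F.@[mxvec (g *m M) 0] - F.@[mxvec g 0]).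
Proof.
elim/mpoly_ring_ind: F N => [a|i|p q IHp IHq|p q IHp IHq] N.
- by exists 0%N => M _; rewrite !mevalC subrr; left.
- case/mxvec_indexP: i => i j.
  have [f fP] : {f : 'I_m -> nat & forall l x, val_ge w (f l) x -> val_ge w N (g i l * x)}.
    by apply: (@choice _ _ (fun l n => forall x, val_ge w n x -> val_ge w N (g i l * x))) => l; exact: val_ge_scale.
  exists (\max_l f l)%N => M HM; rewrite !mevalXU !mxvecE.
  have -> : (g *m M) i j - g i j = (g *m (M - 1%:M)) i j by rewrite mulmxBr mulmx1 !mxE.
  rewrite mxE; apply: val_ge_sum => l; apply: fP; apply: val_geW (HM l j).
  exact: leq_bigmax.
- have [N1 H1] := IHp N; have [N2 H2] := IHq N; exists (maxn N1 N2) => M HM.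
  rewrite !mevalD opprD addrACA; apply: val_geD.
    by apply: H1 => i j; apply: val_geW (HM i j); exact: leq_maxl.
  by apply: H2 => i j; apply: val_geW (HM i j); exact: leq_maxr.
- have [Np Hp] := val_ge_scale p.@[mxvec g 0] N; have [Nq Hq] := val_ge_scale q.@[mxvec g 0] N.
  have [N1 H1] := IHp (maxn N Nq); have [N2 H2] := IHq Np; exists (maxn N1 N2) => M HM.
  have {}H1 : val_ge w (maxn N Nq) (p.@[mxvec (g *m M) 0] - p.@[mxvec g 0]).
    by apply: H1 => i j; apply: val_geW (HM i j); exact: leq_maxl.
  have {}H2 : val_ge w Np (q.@[mxvec (g *m M) 0] - q.@[mxvec g 0]).
    by apply: H2 => i j; apply: val_geW (HM i j); exact: leq_maxr.
  rewrite !mevalM; set a := p.@[_] in H1 *; set a0 := p.@[_] in H1 Hp *; set b := q.@[_] in H2 *; set b0 := q.@[_] in H2 Hq *.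
  have -> : a * b - a0 * b0 = (a - a0) * (b - b0) + a0 * (b - b0) + b0 * (a - a0).
    by rewrite -mulrDl subrK mulrBr [b0 * _]mulrBr [b0 * a]mulrC [b0 * a0]mulrC addrA subrK.
  apply: val_geD; last by apply: Hq; apply: val_geW H1; exact: leq_maxr.
  apply: val_geD; last exact: Hp.
  by apply: val_geM; [apply: val_geW H1; exact: leq_maxl|apply: val_geW H2].
Qed.

Variables (Omega : closedFieldType) (G : set {rmorphism Omega -> Omega}).
Variables (m : nat) (V : {rmorphism Omega -> Omega} -> 'M[E]_m).
Hypotheses (G_group : subgroup G) (V_rep : representation G V).

Lemma representation_inv s u : G s -> G u -> (forall x, s (u x) = x) -> V s *m V u = 1%:M.
Proof.
move=> Gs Gu su; rewrite -V_rep.2//; have -> : s \o u = idfun :> {rmorphism Omega -> Omega}.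
  exact: rmorphism_ext.
exact: V_rep.1.
Qed.

Lemma representation_unit s : G s -> V s \in unitmx.
Proof.
move=> Gs; have [u [Gu su _]] := subgroup_inv G_group Gs.
by have /mulmx1_unit[] := representation_inv Gs Gu su.
Qed.

Lemma representation_invmx s u : G s -> G u -> (forall x, s (u x) = x) -> V u = invmx (V s).
Proof.
move=> Gs Gu su; have Vs := representation_unit Gs.
by rewrite -[LHS](mulKmx Vs) (representation_inv Gs Gu su) mulmx1.
Qed.

(** Approximate s by elements u of the preimage: F(V u) = 0 is arbitrarily close to F(V s), which is
    therefore 0. *)
Lemma preimage_closed (N : set 'M[E]_m) : krull_closed G -> continuous_rep w G V ->
  zariski_closure N `<=` N -> krull_closed [set s | G s /\ N (V s)].
Proof.
move=> G_closed V_cont N_closed s sb H.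
have Gs : G s by apply: G_closed => // S; have [u [Gu _] us] := H S; exists u.
split => //; apply: N_closed; split; first exact: representation_unit.
move=> F FN; apply: val_ge_eq0 => n.
have [n' n'P] := meval_continuous F (V s) n.
have [S SP] := V_cont n'; have [u [Gu Nu] us] := H S.
have [s' [Gs' ss' s's]] := subgroup_inv G_group Gs.
pose v : {rmorphism Omega -> Omega} := s' \o u; have Gv : G v by exact: subgroup_comp.
have := n'P (V v) (SP v Gv _).
rewrite -V_rep.2// (_ : s \o v = u :> {rmorphism Omega -> Omega}); last first.
  by apply: rmorphism_ext => x /=; rewrite ss'.
rewrite (FN (V u))// sub0r => H'; rewrite -[F.@[_]]opprK; apply: val_geN; apply: H'.
by move=> x xS; rewrite /v /= -us// s's.
Qed.

End Continuity.

Section CyclicQuotient.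

Variables (E : closedFieldType) (r : nat).
Variables (G N : set 'M[E]_r.+1) (a : 'M[E]_r.+1) (n : nat).
Hypotheses (G_group : matrix_subgroup G) (N_group : matrix_subgroup N) (NG : N `<=` G).
Hypothesis N_normal : forall g x, G g -> N x -> N (g * x * g^-1).
Hypotheses (Ga : G a) (n0 : (0 < n)%N) (Nan : N (a ^+ n)).
Hypothesis cover : forall g, G g -> exists i x, N x /\ g = a ^+ i * x.

Let N1 : N 1. Proof. by case: N_group. Qed.
Let NM x y : N x -> N y -> N (x * y). Proof. by case: N_group => _ _ H _; exact: H. Qed.
Let NV x : N x -> N x^-1. Proof. by case: N_group => _ _ _ H; exact: H. Qed.
Let Gunit g : G g -> g \is a GRing.unit. Proof. by case: G_group => H _ _ _; exact: H. Qed.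
Let GX i : G (a ^+ i).
Proof. by case: G_group => _ G1 GM _; elim: i => [|i IH]; rewrite ?expr0// exprS; exact: GM. Qed.

(** [d.+1] is the order of [a] modulo N, and g = a^i x is sent to i modulo [d.+1]. *)
Lemma cyclic_quotient : exists gT : finGroupType,
  [/\ quotient_isomorphic G N gT, cyclic [set: gT]%G & (#|gT| %| n)%N].
Proof.
have ex : exists d, (0 < d)%N && `[< N (a ^+ d) >] by exists n; rewrite n0; apply/asboolP.
case: (ex_minnP ex) => -[//|d] /andP[_ /asboolP Nd] dmin.
have NdX i : N (a ^+ (i * d.+1)).
  by rewrite mulnC exprM; elim: i => [|i IH]; rewrite ?expr0// exprS; exact: NM.
have dvdN i : (d.+1 %| i)%N <-> N (a ^+ i).
  split=> [/dvdnP[q ->]//|Ni]; rewrite /dvdn; apply: contraT; rewrite -lt0n => lt.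
  have : (d.+1 <= i %% d.+1)%N.
    apply: dmin; rewrite lt; apply/asboolP.
    have aqu : a ^+ (i %/ d.+1 * d.+1) \is a GRing.unit by apply: Gunit.
    by rewrite -[a ^+ _](mulKr aqu) -exprD -divn_eq; apply: NM => //; exact: NV.
  by rewrite leqNgt ltn_pmod.
have [f fP] : {f : 'M[E]_r.+1 -> nat & forall g, G g -> N ((a ^+ f g)^-1 * g)}.
  apply: (@choice _ _ (fun g i => G g -> N ((a ^+ i)^-1 * g))) => g.
  have [/cover[i [x [Nx ->]]]|] := pselect (G g); last by exists 0%N.
  by exists i => _; rewrite mulKr//; exact: Gunit.
have uniq g i j : G g -> N ((a ^+ i)^-1 * g) -> N ((a ^+ j)^-1 * g) -> i = j %[mod d.+1].
  move=> Gg; wlog ij : i j / (i <= j)%N.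
    by move=> H Ni Nj; have [ij|/ltnW ji] := leqP i j; [exact: H|symmetry; exact: H].
  move=> Ni Nj; have := NM Ni (NV Nj).
  have ui := Gunit (GX i); have uj := Gunit (GX j).
  rewrite invrM ?unitrV ?Gunit// invrK mulrA mulrK ?Gunit//.
  rewrite -{1}(subnKC ij) exprD mulKr// => /dvdN.
  by move=> H; apply/esym/eqP; rewrite eqn_mod_dvd.
exists 'I_d.+1; split.
- split=> //; exists (fun g => inZp (f g)); split.
  + move=> g h Gg Gh; apply: val_inj; rewrite /= modnDm.
    have Ggh : G (g * h) by case: G_group => _ _ H _; exact: H.
    apply: (uniq _ _ _ Ggh (fP _ Ggh)); rewrite exprD invrM ?Gunit//.
    have uj := Gunit (GX (f h)).
    have -> : (a ^+ f h)^-1 / a ^+ f g * (g * h) =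
      ((a ^+ f h)^-1 * ((a ^+ f g)^-1 * g) * ((a ^+ f h)^-1)^-1) * ((a ^+ f h)^-1 * h).
      by rewrite invrK !mulrA mulrK.
    apply: NM; last exact: fP.
    by apply: N_normal; [case: G_group => _ _ _ H; exact: H|exact: fP].
  + move=> z; exists (a ^+ z) => //; apply: val_inj; rewrite /= -[RHS](modn_small (ltn_ord z)).
    by apply: (uniq _ _ _ (GX z) (fP _ (GX z))); rewrite mulVr ?Gunit.
  + move=> g Gg; split=> [/(congr1 val) /= f0|Ng].
      have /dvdN Nf : (d.+1 %| f g)%N by rewrite /dvdn f0.
      by have := NM Nf (fP g Gg); rewrite mulVKr// Gunit.
    apply: val_inj => /=; rewrite -(mod0n d.+1); apply: (uniq _ _ _ Gg (fP _ Gg)).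
    by rewrite expr0 invr1 mul1r.
- by rewrite /= Zp_cycle; exact: cycle_cyclic.
- by rewrite card_ord; apply/dvdN.
Qed.

End CyclicQuotient.

(** * Fundamental group of the punctured line *)

Lemma fraction_quotient (R : idomainType) (x : {fraction R}) : exists a b, b != 0 /\ x * tofrac b = tofrac a.
Proof.
pose r := generic_quotient.repr x; exists (frac r).1, (frac r).2; split; first exact: denom_ratioP.
rewrite -[x]generic_quotient.reprK -/r; unlock tofrac; rewrite -[LHS]FracField.pi_mul; apply/generic_quotient.eqmodP; rewrite /= FracField.equivfE /FracField.mulf.
by rewrite !numden_Ratio ?mulf_neq0 ?oner_neq0 ?denom_ratioP// !mulr1 mulrC.
Qed.

Lemma common_denominator (R : idomainType) (s : seq {fraction R}) :
  exists d, d != 0 /\ forall x, x \in s -> exists a, x * tofrac d = tofrac a.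
Proof.
elim: s => [|x s [d [d0 dP]]]; first by exists 1; rewrite oner_neq0.
have [a [b [b0 ab]]] := fraction_quotient x.
exists (b * d); rewrite mulf_neq0//; split => // y; rewrite inE => /orP[/eqP->|/dP[a' ya]].
  by exists (a * d); rewrite rmorphM mulrA ab rmorphM.
by exists (a' * b); rewrite !rmorphM mulrCA ya mulrC.
Qed.

Section FunctionField.

Variables (k Omega : closedFieldType) (iota : {rmorphism {fraction {poly k}} -> Omega}).

Definition const_morphism : {rmorphism k -> Omega} := iota \o (@tofrac {poly k} \o @polyC k).

Lemma polyval_iota P : polyval const_morphism (Defs.coord iota) P = iota (tofrac P).
Proof.
elim/poly_ind: P => [|P a IH]; first by rewrite !rmorph0.
by rewrite !rmorphD !rmorphM /= IH polyvalX polyvalC.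
Qed.

Lemma coordinate_iota : is_algebraic_closure iota -> coordinate const_morphism (Defs.coord iota).
Proof.
move=> alg; split=> [P|x].
  by rewrite polyval_iota => /eqP; rewrite fmorph_eq0 tofrac_eq0 => /eqP.
have [P P0 Px] := alg x; have [d [d0 dP]] := common_denominator P.
have [f fP] : {f : nat -> {poly k} & forall i, P`_i * tofrac d = tofrac (f i)}.
  apply: (@choice _ _ (fun i a => P`_i * tofrac d = tofrac a)) => i.
  have [li|si] := ltnP i (size P); first exact: dP (mem_nth _ li).
  by exists 0; rewrite nth_default// mul0r rmorph0.
have QE : map_poly (polyval const_morphism (Defs.coord iota)) (\poly_(i < size P) f i) =
    iota (tofrac d) *: map_poly iota P.
  apply/polyP => i; rewrite coefZ !coef_map coef_poly /=; case: ltnP => [_|si].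
    by rewrite polyval_iota -fP rmorphM mulrC.
  by rewrite nth_default// !rmorph0 mulr0.
exists (\poly_(i < size P) f i); last by rewrite QE rootE hornerZ (rootP Px) mulr0.
apply: contra_neq P0 => Q0; apply/eqP; rewrite -(map_poly_eq0 iota).
have /eqP := QE; rewrite Q0 rmorph0 eq_sym scaler_eq0 fmorph_eq0 tofrac_eq0 (negPf d0).
exact.
Qed.

Lemma Gal_coordinate_aut s : Gal iota setT s <-> coordinate_aut const_morphism (Defs.coord iota) s.
Proof. by split=> -[sb st sc]; split => // a; [exact: (sc a I)|move=> _; exact: sc]. Qed.

End FunctionField.

(** * Tame inertia and the action of Frobenius *)

Section Frobenius.

Variables (p : nat) (k Omega : closedFieldType) (c : {rmorphism k -> Omega}).
Hypothesis p_char : p \in [pchar k].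

Lemma frobenius_power f : exists phi : {rmorphism k -> k}, forall a, phi a = a ^+ (p ^ f).
Proof.
apply: rmorphism_of_fun => [a b||a b]; [exact: pcharB_exp|exact: expr1n|exact: exprMn].
Qed.

(** A fixed element of the integral closure is, after a power p^a, a polynomial in t; both places
    see its value at 0. *)
Lemma places_conjugate t O O' : coordinate c t -> place c O -> max_ideal O t ->
  place c O' -> max_ideal O' t -> exists2 s, coordinate_aut c t s & forall x, O (s x) <-> O' x.
Proof.
move=> t_coord OP mt OP' mt'.
have mt0 : max_ideal O (t - c 0) by rewrite rmorph0 subr0.
have mt0' : max_ideal O' (t - c 0) by rewrite rmorph0 subr0.
apply: (conjugate_places t_coord (coordinate_aut_group c t) (@coordinate_aut_closed _ _ c t)
  (coordinate_aut_finite t_coord) _ _ OP (max_ideal_sub mt) mt0 OP' (max_ideal_sub mt') mt0').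
- by move=> s a [].
- by move=> s [].
move=> y By yfix my.
have [a ya] := coordinate_aut_fixed t_coord p_char yfix.
have [P PE] := ratfun_coordinate_ring t_coord ya (subringX (coordinate_ring_subring c t) _ By).
have pa : (0 < p ^ a)%N by rewrite expn_gt0 prime_gt0// (pcharf_prime p_char).
have mX U z : place c U -> max_ideal U z -> max_ideal U (z ^+ (p ^ a)).
  move=> UP mz; case: (p ^ a)%N pa => // n _; rewrite exprS; apply: (max_idealMr UP.1 mz).
  by apply: (subringX (place_ring UP)); exact: max_ideal_sub mz.
have P0 : P.[0] = 0.
  apply: (place_const_unit OP'); rewrite -[X in max_ideal _ X](subKr (polyval c t P)).
  apply: max_idealB; [exact: OP'.1|by rewrite -PE; exact: mX|].
  exact: place_polyval_congr (max_ideal_sub mt') mt0'.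
have mya : max_ideal O (y ^+ (p ^ a)).
  have := place_polyval_congr P OP (max_ideal_sub mt) mt0; by rewrite P0 rmorph0 subr0 -PE.
have Oy : O y by exact: By OP (max_ideal_sub mt).
apply: contrapT => nmy; have [y0 OVy] := valuation_unit OP.1 Oy nmy.
apply: (max_ideal_unit _ _ mya); last exact: expf_neq0.
by rewrite -exprVn; apply: (subringX (place_ring OP)).
Qed.

(** Any transport pulls O back to a place where u vanishes; it is corrected by an automorphism
    fixing u that brings this place back to O. *)
Lemma stabilizing_transport (phi : {rmorphism k -> k}) u v O : coordinate c u -> coordinate c v ->
    (forall a, exists b, phi b = a) -> place c O -> max_ideal O u -> max_ideal O v ->
  exists s : {rmorphism Omega -> Omega},
    [/\ bijective s, s u = v, forall a, s (c a) = c (phi a) & forall x, O (s x) <-> O x].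
Proof.
move=> uc vc surj OP mu mv; have [s0 [s0b s0u s0c]] := coordinate_transport uc vc surj.
have OP0 : place c [set x | O (s0 x)].
  split; first exact: (valuation_ring_preimage OP.1 s0).
  by move=> a; rewrite /= s0c; exact: OP.2.
have m0 : max_ideal [set x | O (s0 x)] u by apply/max_ideal_preimage; rewrite s0u.
have [h [hb hu hc] hO] := places_conjugate uc OP mu OP0 m0.
have [h' [hb' hh' h'h]] := rmorphism_inverse hb.
exists (s0 \o h'); split; first exact: bij_comp.
- by rewrite /= -{1}hu h'h s0u.
- by move=> a; rewrite /= -{1}(hc a) h'h.
- by move=> x; have := hO (h' x); rewrite hh' /=; exact: iff_sym.
Qed.

(** [rho] and its multiple by [xi] are both coordinates vanishing at O; transport one to the other
    while stabilizing O. *)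
Lemma inertia_root_of_unity t O rho r xi : coordinate c t -> place c O -> max_ideal O t ->
  (0 < r)%N -> rho ^+ r = t -> xi ^+ r = 1 ->
  exists2 s, decomposition c t O s & s rho = c xi * rho.
Proof.
move=> t_coord OP mt r0 rhor xir; have rho_coord := coordinate_root r0 rhor t_coord.
have rho'r : (c xi * rho) ^+ r = t by rewrite exprMn -rmorphXn xir rmorph1 mul1r.
have rho'_coord := coordinate_root r0 rho'r t_coord.
have Or := place_ring OP.
have mroot z : z ^+ r = t -> max_ideal O z.
  move=> zr; have z0 : z != 0.
    by apply: contra_neq (coordinate_neq0 t_coord) => z0; rewrite -zr z0 expr0n eqn0Ngt r0.
  apply: contrapT => nmz; apply: (max_ideal_unit _ _ mt); last exact: (coordinate_neq0 t_coord).
  rewrite -zr -exprVn; apply: (subringX Or).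
  have [Oz|//] := valuation_ring_total OP.1 z; by have [] := valuation_unit OP.1 Oz nmz.
have [|s [sb su sc sO]] := @stabilizing_transport idfun rho (c xi * rho) O rho_coord rho'_coord _ OP (mroot _ rhor) (mroot _ rho'r).
  by move=> a; exists a.
exists s => //; split => //; split => //.
by rewrite -rhor rmorphXn su rho'r rhor.
Qed.

(** [v] is the inverse of s^q, so this is F s F^-1 = s^q modulo wild inertia. On residues F is the
    q-th power map, and it preserves valuations because it fixes t; hence it raises the tame
    character of s to the power q. *)
Lemma tame_frobenius t O (F F' : {rmorphism Omega -> Omega}) q s v : (0 < q)%N ->
  coordinate c t -> place c O -> max_ideal O t ->
  F t = t -> (forall a, F (c a) = c (a ^+ q)) -> (forall x, O (F x) <-> O x) ->
  (forall x, F (F' x) = x) -> (forall x, F' (F x) = x) ->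
  decomposition c t O s -> decomposition c t O v -> (forall x, iter q s (v x) = x) ->
  tame_kernel c t O (F \o (s \o (F' \o v))).
Proof.
move=> q0 t_coord OP mt Ft Fc FO FF' F'F Ds Dv sv.
have Ov := OP.1; have Or := place_ring OP.
have [[sb st sc] sO] := Ds; have [[vb vt vc] vO] := Dv.
have mF x : max_ideal O x -> max_ideal O (F x).
  move=> [Ox [->|nx]]; first by rewrite rmorph0; exact: max_ideal0.
  by split; [exact/FO|right; rewrite -fmorphV => /FO].
have Fb : bijective F by exists F'.
have Fb' : bijective F' by exists F.
split.
  split; first split.
  - by apply: bij_comp => //; apply: bij_comp => //; exact: bij_comp.
  - have F't : F' t = t by rewrite -{1}Ft F'F.
    by rewrite /= vt F't st Ft.
  - move=> a; rewrite /= vc; have [b bE] : exists b, F' (c a) = c b.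
      have [b /rootP] : exists b, root ('X^q - a%:P) b.
        by apply/closed_rootP; rewrite size_XnsubC// eqSS -lt0n.
      rewrite !hornerE => /eqP; rewrite subr_eq0 => /eqP ab; exists b.
      by rewrite -[RHS]F'F Fc ab.
    by rewrite bE sc -bE FF'.
  - move=> x /=; rewrite FO sO -(vO x) -{2}(FF' (v x)) FO; done.
move=> x x0; pose y := v x; pose z := F' y.
have y0 : y != 0 by rewrite fmorph_eq0.
have z0 : z != 0 by rewrite fmorph_eq0.
have Fz : F z = y by rewrite FF'.
have [a za] := tame_char_exists t_coord OP mt Ds z0.
(* y = F z and z satisfy the same power relation with t, up to units. *)
have yzu : O (y / z) /\ O (y / z)^-1.
  have [Q Q0 Qz] := t_coord.2 z.
  have [e [i [j [al [/andP[e0 _] Oal OVal al0 E]]]]] := power_relation t_coord OP mt z0 Q0 Qz.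
  have E' : y ^+ e * t ^+ i = F al * t ^+ j.
    by have := congr1 F E; rewrite !rmorphM !rmorphXn Ft Fz.
  have ti i' : t ^+ i' != 0 by apply: expf_neq0; exact: (coordinate_neq0 t_coord).
  have yz : (y / z) ^+ e = F al / al.
    have -> : (y / z) ^+ e = (F al * (t ^+ j / t ^+ i)) / (al * (t ^+ j / t ^+ i)).
      by rewrite expr_div_n !mulrA -E' -E !mulfK.
    by rewrite -mulf_div divff ?mulr1// mulf_neq0 ?invr_eq0.
  split; apply: (valuation_root OP e0); rewrite ?exprVn yz ?invf_div; apply: (subringM Or) => //.
    exact/FO.
  by rewrite -fmorphV; apply/FO.
have yz0 : y / z != 0 by rewrite mulf_neq0 ?invr_eq0.
have ya : tame_char c O s y a.
  rewrite -(divfK z0 y) -(mul1r a); apply: (tame_charM t_coord OP mt Ds yz0) => //.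
  exact: (tame_char_unit t_coord OP mt Ds yzu.1 yzu.2 yz0).
have sqy := tame_char_iter t_coord OP mt q Ds y0 ya; rewrite /tame_char sv in sqy.
have Fsz : max_ideal O (F (s z) / y - c (a ^+ q)).
  by have := mF _ za; rewrite rmorphB rmorphM fmorphV Fz Fc.
have xyu : max_ideal O (F (s z) / y - x / y).
  by have := max_idealB Ov Fsz sqy; rewrite opprB addrA subrK.
rewrite /= -/y -/z.
have -> : F (s z) / x - 1 = (F (s z) / y - x / y) * (y / x).
  by rewrite mulrBl !mulrA !divfK// divff.
apply: max_idealMr => //.
by have := decomposition_unit t_coord OP mt Dv x0; case.
Qed.

End Frobenius.

Lemma primitive_root_exists (k : closedFieldType) p n : p \in [pchar k] -> coprime p n -> (0 < n)%N ->
  exists z : k, n.-primitive_root z.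
Proof.
move=> pk cop n0; have nk : n%:R != 0 :> k := pchar_natr_neq0 pk cop.
have [r rE] := closed_field_poly_normal ('X^n - 1 : {poly k}).
rewrite (monicP (monicXnsubC 1 n0)) scale1r in rE.
have sep : separable_poly ('X^n - 1 : {poly k}).
  rewrite unlock derivB derivC subr0 derivXn -scaler_nat coprimepZr// coprimep_expr//.
  by rewrite coprimepX /root !hornerE expr0n eqn0Ngt n0 sub0r oppr_eq0 oner_neq0.
have ur : uniq r by rewrite -separable_prod_XsubC -rE.
have sr : size r = n.
  by have := size_XnsubC (1 : k) n0; rewrite rE size_prod_XsubC => -[].
have /hasP[z _ zp] : has n.-primitive_root r.
  apply: has_prim_root => //; last by rewrite sr.
  apply/allP => z zr; apply/unity_rootP; apply/eqP.
  have : root ('X^n - 1) z by rewrite rE root_prod_XsubC.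
  by rewrite /root !hornerE subr_eq0.
by exists z.
Qed.

Section NormalClosure.

Variables (E : closedFieldType) (m : nat) (G S : set 'M[E]_m).
Hypotheses (G_group : matrix_subgroup G) (SG : S `<=` G).
Local Notation nc := (normal_closure G S).

Lemma sub_normal_closure g s : G g -> S s -> nc (g *m s *m invmx g).
Proof. by move=> Gg Ss K _; exact. Qed.

Lemma normal_closure_sub : nc `<=` G.
Proof.
move=> h; apply => // g s Gg /SG Gs; have [_ _ GM GV] := G_group.
by apply: (GM); [exact: GM|exact: GV].
Qed.

Lemma normal_closure_group : matrix_subgroup nc.
Proof.
split=> [h /normal_closure_sub|K [_ K1 _ _] _ //|g h Hg Hh K Kg H|g Hg K Kg H].
- by have [Gu _ _ _] := G_group; exact: Gu.
- by have [_ _ KM _] := Kg; apply: (KM); [exact: Hg|exact: Hh].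
- by have [_ _ _ KV] := Kg; apply: (KV); exact: Hg.
Qed.

Lemma normal_closure_normal g h : G g -> nc h -> nc (g *m h *m invmx g).
Proof.
move=> Gg Hh K [Ku K1 KM KV] KS; have [Gu G1 GM GV] := G_group; have gu := Gu _ Gg.
have [] // : (h \in unitmx) /\ K (g *m h *m invmx g).
apply: (Hh [set h | h \in unitmx /\ K (g *m h *m invmx g)]); last first.
  move=> a s Ga Ss; split; first by rewrite !unitmx_mul unitmx_inv !Gu//; exact: SG.
  have := KS (g *m a) s (GM _ _ Gg Ga) Ss.
  have -> : invmx (g *m a) = invmx a *m invmx g.
    have au := Gu _ Ga; have gau : g *m a \in unitmx by rewrite unitmx_mul gu.
    have gai : g *m a *m (invmx a *m invmx g) = 1%:M by rewrite !mulmxA mulmxK// mulmxV.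
    by rewrite -[RHS](mulKmx gau) gai mulmx1.
  by rewrite !mulmxA.
split; first by move=> a [].
- by split; rewrite ?unitmx1// mulmx1 mulmxV.
- move=> a b [au Ka] [bu Kb]; split; first by rewrite unitmx_mul au.
  by have := KM _ _ Ka Kb; rewrite !mulmxA mulmxKV.
- move=> a [au Ka]; split; first by rewrite unitmx_inv.
  have ua := Ku _ Ka; have := KV _ Ka; congr K.
  have ai : g *m a *m invmx g *m (g *m invmx a *m invmx g) = 1%:M.
    by rewrite !mulmxA mulmxKV// mulmxK// mulmxV.
  by rewrite -[RHS](mulKmx ua) ai mulmx1.
Qed.

End NormalClosure.

(** * Normal subgroups containing the wild inertia *)

Section TameSubgroup.

Variables (p : nat) (k Omega : closedFieldType) (c : {rmorphism k -> Omega}).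
Variables (t : Omega) (t_coord : coordinate c t).
Hypothesis p_char : p \in [pchar k].
Local Notation G := (coordinate_aut c t).
Variable K : set {rmorphism Omega -> Omega}.
Hypotheses (K_group : subgroup K) (K_closed : krull_closed K) (KG : K `<=` G).
Hypothesis K_normal : forall s s' u, G s -> G s' -> (forall x, s (s' x) = x) -> K u -> K (s' \o (u \o s)).
Hypothesis K_unramified : forall (b : k) O s, b != 0 -> place c O -> max_ideal O (t - c b) ->
  decomposition c t O s -> K s.
Hypothesis K_zero : forall O s, place c O -> max_ideal O t -> tame_kernel c t O s -> K s.
Hypothesis K_infinity : forall O s, place c O -> max_ideal O t^-1 -> tame_kernel c t^-1 O s -> K s.

Lemma mem_fixed_by s : G s -> (forall x, fixed_by K x -> s x = x) -> K s.
Proof.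
move=> [sb st sc] sK; apply: (fixed_by_closed_subgroup (c := c) K_group _ _ K_closed) => //.
  by move=> x; have [l lP] := coordinate_aut_finite t_coord x; exists l => u /KG/lP.
by move=> u a /KG[].
Qed.

Lemma closed_root n (x : Omega) : (0 < n)%N -> exists y, y ^+ n = x.
Proof.
move=> n0; have /closed_rootP[y] : size ('X^n - x%:P) != 1%N by rewrite size_XnsubC// eqSS -lt0n.
by rewrite /root !hornerE subr_eq0 => /eqP; exists y.
Qed.

Lemma aut_root s tau r : G s -> (0 < r)%N -> tau ^+ r = t ->
  exists xi, xi ^+ r = 1 /\ s tau = c xi * tau.
Proof.
move=> [_ st sc] r0 taur; have t0 := coordinate_neq0 t_coord.
have tau0 : tau != 0 by apply: contra_neq t0 => x0; rewrite -taur x0 expr0n eqn0Ngt r0.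
have zr : (s tau / tau) ^+ r = 1 by rewrite expr_div_n -rmorphXn taur st divff.
have [||b zE] := @polyval_root _ _ c (s tau / tau) ('X^r - 1).
- by rewrite -size_poly_eq0 size_XnsubC.
- by rewrite rmorphB rmorphXn rmorph1 /= polyvalX zr subrr.
exists b; split; last by rewrite -zE divfK.
by apply: (fmorph_inj c); rewrite rmorphXn rmorph1 /= -zE.
Qed.

(** On an r-th root of t all automorphisms act by constant roots of unity, so they commute there. *)
Lemma commutator_mem s s' u u' : G s -> G s' -> G u -> G u' ->
  (forall x, s (s' x) = x) -> (forall x, u (u' x) = x) -> K (s \o (u \o (s' \o u'))).
Proof.
move=> Gs Gs' Gu Gu' ss' uu'; have G_group := coordinate_aut_group c t.
have Gc : G (s \o (u \o (s' \o u'))).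
  by apply: subgroup_comp => //; apply: subgroup_comp => //; exact: subgroup_comp.
apply: mem_fixed_by => // x Kx.
have [r [r0 _ rP]] := tame_cover t_coord p_char K_normal K_unramified K_zero K_infinity Kx.
have [tau taur] := closed_root t r0; apply: (rP tau taur) => //=.
have [a1 [_ sE]] := aut_root Gs r0 taur; have [a2 [_ sE']] := aut_root Gs' r0 taur.
have [b1 [_ uE]] := aut_root Gu r0 taur; have [b2 [_ uE']] := aut_root Gu' r0 taur.
have [_ _ sc] := Gs; have [_ _ sc'] := Gs'; have [_ _ uc] := Gu.
have ssE : c a2 * (c a1 * tau) = tau by rewrite -sE -sc -rmorphM -sE' ss'.
have uuE : c b2 * (c b1 * tau) = tau by rewrite -uE -uc -rmorphM -uE' uu'.
rewrite uE' rmorphM sc' sE' !rmorphM !uc uE !rmorphM !sc sE.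
by rewrite [c a2 * _]mulrCA ssE uuE.
Qed.

(** For x fixed by K, take its r from [tame_cover] and rho with rho^(r n) = t. As rho^r is a
    constant times tau, s fixes it, so s rho = xi rho with xi^r = 1. An inertia element j with j rho
    = ze rho, ze^n = xi, has an n-th power u in K agreeing with s at rho. Then u^-1 s fixes rho^n,
    an r-th root of t, hence fixes x. *)
Lemma root_kernel n O s tau : place c O -> max_ideal O t -> (0 < n)%N ->
  (forall s u, decomposition c t O s -> G u -> (forall x, u x = iter n s x) -> K u) ->
  tau ^+ n = t -> G s -> s tau = tau -> K s.
Proof.
move=> OP mt n0 nK taun Gs stau; have G_group := coordinate_aut_group c t.
apply: mem_fixed_by => // x Kx.
have [r [r0 _ rP]] := tame_cover t_coord p_char K_normal K_unramified K_zero K_infinity Kx.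
have rn0 : (0 < r * n)%N by rewrite muln_gt0 r0.
have [rho rhorn] := closed_root t rn0.
have [xi [xirn sxi]] := aut_root Gs rn0 rhorn.
have rhor0 : rho ^+ r != 0.
  by rewrite expf_neq0//; apply: contra_neq (coordinate_neq0 t_coord) => x0; rewrite -rhorn x0 expr0n eqn0Ngt rn0.
have xir : xi ^+ r = 1.
  have [||b bE] := @polyval_root _ _ c (rho ^+ r / tau) ('X^n - 1).
  - by rewrite -size_poly_eq0 size_XnsubC.
  - rewrite rmorphB rmorphXn rmorph1 /= polyvalX expr_div_n -exprM rhorn taun divff ?subrr//.
    exact: coordinate_neq0 t_coord.
  have tau0 : tau != 0.
    by apply: contra_neq (coordinate_neq0 t_coord) => x0; rewrite -taun x0 expr0n eqn0Ngt n0.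
  have srho : s (rho ^+ r) = rho ^+ r.
    have [_ _ sc] := Gs; by rewrite -[rho ^+ r](divfK tau0) rmorphM stau bE sc.
  have := srho; rewrite rmorphXn sxi exprMn -rmorphXn => /eqP.
  rewrite -subr_eq0 -{2}[rho ^+ r]mul1r -mulrBl mulf_eq0 (negPf rhor0) orbF subr_eq0 -(rmorph1 c).
  by move=> /eqP/(fmorph_inj c).
have [ze zen] : exists ze : k, ze ^+ n = xi.
  have /closed_rootP[y] : size ('X^n - xi%:P) != 1%N by rewrite size_XnsubC// eqSS -lt0n.
  by rewrite /root !hornerE subr_eq0 => /eqP; exists y.
have zern : ze ^+ (r * n) = 1 by rewrite mulnC exprM zen.
have [j Dj jrho] := inertia_root_of_unity p_char t_coord OP mt rn0 rhorn zern.
have [Gj _] := Dj; have [u Gu uE] := subgroup_iter n G_group Gj.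
have [_ _ jc] := Gj.
have urho : u rho = s rho.
  rewrite sxi uE -zen; elim: (n) => [|i IH]; first by rewrite expr0 rmorph1 mul1r.
  by rewrite iterS IH rmorphM /= jc jrho exprSr rmorphM mulrA.
have [u' [Gu' uu' u'u]] := subgroup_inv G_group Gu.
have := rP (rho ^+ n) _ (u' \o s) (subgroup_comp G_group Gu' Gs) _.
rewrite -exprM mulnC rhorn rmorphXn /= -urho u'u => /(_ erefl erefl) H.
by rewrite -[LHS]uu' H (Kx u)//; exact: nK Dj Gu uE.
Qed.

End TameSubgroup.

Lemma irreducible_matrices n (k Omega : closedFieldType) (iota : {rmorphism {fraction {poly k}} -> Omega})
    (E : closedFieldType) (V : {rmorphism Omega -> Omega} -> 'M[E]_n.+1) :
  irreducible_sheaf iota V -> irreducible_set (V @` Gal iota setT).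
Proof.
move=> [_ irr] P P0 PD PV [v v0 Pv].
have [||U UP] := @vspace_of_prop _ _ (fun r : 'rV[E]_n.+1 => P r^T).
- by rewrite trmx0.
- by move=> a x y Px Py; rewrite linearD linearZ; exact: PD.
pose b := vbasis U.
have bU : (\dim U <= n.+1)%N by have := dimvS (subvf U); rewrite dimvf /dim /= mul1n.
pose M : 'M[E]_n.+1 := \matrix_(i < n.+1) b`_i.
have MP (r : 'rV_n.+1) : (r <= M)%MS <-> P r^T.
  split=> [/submxP[d ->]|/UP/coord_vbasis ->].
    apply/UP; rewrite mulmx_sum_row; apply: rpred_sum => i _; apply: rpredZ; rewrite rowK.
    have [li|gi] := ltnP i (\dim U); last by rewrite nth_default ?size_tuple// rpred0.
    by apply: vbasis_mem; rewrite mem_nth// size_tuple.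
  apply: summx_sub => i _; apply: scalemx_sub.
  have -> : b`_i = row (widen_ord bU i) M by rewrite rowK.
  exact: row_sub.
have [|r0|rf] := irr M.
- move=> s Gs; apply/row_subP => i; rewrite row_mul; apply/MP.
  rewrite trmx_mul trmxK; apply: PV; first by exists s.
  by apply/MP; exact: row_sub.
- have /MP : P (v^T)^T by rewrite trmxK.
  move/eqP: r0; rewrite mxrank_eq0 => /eqP->; rewrite submx0 trmx_eq0.
  by rewrite (negPf v0).
- move=> x; rewrite -[x]trmxK; apply/MP; apply: submx_full; by rewrite /row_full rf.
Qed.

Section Conversion.

Variables (p : nat) (k Omega : closedFieldType) (iota : {rmorphism {fraction {poly k}} -> Omega}).
Hypothesis Omega_closure : is_algebraic_closure iota.
Hypothesis p_char : p \in [pchar k].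
Local Notation c := (const_morphism iota).
Local Notation t := (Defs.coord iota).

Let t_coord : coordinate c t := coordinate_iota Omega_closure.

Lemma Gal_setE : Gal iota setT = coordinate_aut c t.
Proof. by apply/seteqP; split => s /Gal_coordinate_aut. Qed.

Lemma inertia_point b O : place_above iota (Some b) O -> inertia iota setT O = decomposition c t O.
Proof.
move=> [Ov Oc mt]; have OP : place c O by [].
have Ot : O t.
  rewrite -(subrK (const iota b) t); apply: (subringD (place_ring OP)) => //; exact: max_ideal_sub mt.
apply/seteqP; split=> s; first by move=> [/Gal_coordinate_aut Gs sO _].
move=> Ds; have [Gs sO] := Ds; split => //; first exact/Gal_coordinate_aut.
by move=> x; apply: (decomposition_residue t_coord OP Ot (b := b)).
Qed.

Lemma decompositionV O : decomposition c t O = decomposition c t^-1 O.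
Proof. by apply/seteqP; split => s [Gs sO]; split => //; apply/coordinate_autV. Qed.

Lemma inertia_infinity O : place_above iota None O -> inertia iota setT O = decomposition c t^-1 O.
Proof.
move=> [Ov Oc mt]; have OP : place c O by [].
apply/seteqP; split=> s; first by move=> [/Gal_coordinate_aut Gs sO _]; rewrite -decompositionV.
move=> Ds; have := Ds; rewrite -decompositionV => -[Gs sO]; split => //; first exact/Gal_coordinate_aut.
move=> x; apply: (decomposition_residue (coordinateV t_coord) OP (max_ideal_sub mt) (b := 0)) => //.
by rewrite rmorph0 subr0.
Qed.

Lemma place_above_zero O : place_above iota (Some 0) O <-> place c O /\ max_ideal O t.
Proof.
have c0 : const iota 0 = 0 := rmorph0 c; rewrite /place_above /= c0 subr0.
by split=> [[Ov Oc mt]|[[Ov Oc] mt]].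
Qed.

Lemma wild_inertia_zero O : place c O -> max_ideal O t -> wild_inertia p iota O (tame_kernel c t O).
Proof.
move=> OP mt; rewrite /wild_inertia (inertia_point (b := 0)); last exact/place_above_zero.
exact: (tame_kernel_Sylow p_char t_coord OP mt).
Qed.

Lemma wild_inertia_infinity O P : place_above iota None O -> wild_inertia p iota O P ->
  tame_kernel c t^-1 O `<=` P.
Proof.
move=> OP; rewrite /wild_inertia (inertia_infinity OP); have [Ov Oc mt] := OP.
by apply: (Sylow_tame_kernel p_char (coordinateV t_coord)).
Qed.

End Conversion.

Section Representations.

Variables (Omega E : closedFieldType) (G : set {rmorphism Omega -> Omega}).
Variables (m : nat) (V : {rmorphism Omega -> Omega} -> 'M[E]_m.+1).
Hypotheses (G_group : subgroup G) (V_rep : representation G V).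

Lemma representation_iter s (u : {rmorphism Omega -> Omega}) n : G s -> (forall x, u x = iter n s x) -> V u = V s ^+ n.
Proof.
move=> Gs; elim: n u => [|n IH] u uE.
  by rewrite (_ : u = idfun) ?V_rep.1//; exact: rmorphism_ext.
have [v Gv vE] := subgroup_iter n G_group Gs.
rewrite (_ : u = s \o v); last by apply: rmorphism_ext => x; rewrite uE /= vE.
by rewrite V_rep.2// exprS (IH v vE).
Qed.

Lemma representation_image : matrix_subgroup (V @` G).
Proof.
split=> [_ [s Gs <-]||_ _ [s Gs <-] [u Gu <-]|_ [s Gs <-]].
- exact: representation_unit V_rep _ Gs.
- by exists idfun; [exact: subgroup_id|exact: V_rep.1].
- by exists (s \o u); [exact: subgroup_comp|exact: V_rep.2].
- have [u [Gu su _]] := subgroup_inv G_group Gs.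
  by exists u => //; exact: representation_invmx V_rep _ _ _ _ _.
Qed.

End Representations.

Lemma invmx_conj (E : fieldType) n (g x : 'M[E]_n.+1) i : g \is a GRing.unit ->
  (g * x * g^-1) ^+ i = g * x ^+ i * g^-1.
Proof.
move=> gu; elim: i => [|i IH]; first by rewrite !expr0 mulr1 mulrV.
by rewrite !exprS IH !mulrA mulrVK.
Qed.

Section Monodromy.

Variables (p : nat) (k Omega : closedFieldType) (iota : {rmorphism {fraction {poly k}} -> Omega}).
Hypotheses (Omega_closure : is_algebraic_closure iota) (p_char : p \in [pchar k]).
Variables (E : closedFieldType) (w : E -> rat).
Variables (n f : nat) (f0 : (0 < f)%N) (A H : {rmorphism Omega -> Omega} -> 'M[E]_n.+1).
Hypothesis A_lisse : lisse_on_Gm iota w (Fq (p ^ f)) A.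
Hypothesis A_tame : tame_at_zero p iota A.
Hypothesis AH : geom_isomorphic iota A H.
Local Notation c := (const_morphism iota).
Local Notation t := (Defs.coord iota).
Local Notation G := (Gal iota setT).
Local Notation Gq := (Gal iota (Fq (p ^ f))).

Let t_coord : coordinate c t := coordinate_iota Omega_closure.

Lemma Gal_Fq_group : subgroup Gq.
Proof.
split=> [s []//| | |].
- by split => //; exists id.
- by move=> s u [s1 s2 s3] [u1 u2 u3]; split => /= [| |a qa]; [exact: bij_comp|rewrite u2|rewrite u3// s3].
- move=> s [s1 s2 s3]; have [u [ub su us]] := rmorphism_inverse s1; exists u => //.
  by split => // [|a qa]; [rewrite -{1}s2 us|rewrite -{1}(s3 a qa) us].
Qed.

Lemma tame_kernel_trivial O s : place c O -> max_ideal O t -> tame_kernel c t O s -> A s = 1.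
Proof.
move=> OP mt; apply: A_tame (wild_inertia_zero Omega_closure p_char OP mt) _.
exact/place_above_zero.
Qed.

Lemma geom_isomorphic_conj : exists2 g, g \is a GRing.unit & forall s, G s -> H s = g * A s * g^-1.
Proof.
have [g gu gAH] := AH; exists g => // s Gs; apply/esym/(canLR (mulrK gu)).
exact: gAH.
Qed.

(** A lift F of Frobenius stabilizing O lies only in the arithmetic group, where A is a
    representation. Tameness at 0 gives A(F) A(s) A(F)^-1 = A(s)^q, and the conclusion is
    transported to H by the geometric isomorphism. *)
Lemma inertia_quasi_unipotent O s : place c O -> max_ideal O t -> decomposition c t O s ->
  (H s ^+ ((p ^ f) ^ (n.+1)`!).-1 - 1) ^+ n.+1 = 0.
Proof.
move=> OP mt Ds; set q := (p ^ f)%N.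
have q1 : (1 < q)%N by rewrite -(exp1n f) ltn_exp2r// prime_gt1// (pcharf_prime p_char).
have [A_rep _ _] := A_lisse; have Gq_group := Gal_Fq_group.
have [phi phiE] := frobenius_power p_char f.
have surj a : exists b, phi b = a.
  have /closed_rootP[b] : size ('X^q - a%:P) != 1%N by rewrite size_XnsubC ?eqSS -?lt0n// ltnW.
  by rewrite /root !hornerE subr_eq0 => /eqP ba; exists b; rewrite phiE.
have [F [Fb Ft Fc FO]] := stabilizing_transport p_char t_coord t_coord surj OP mt mt.
have [F' [Fb' FF' F'F]] := rmorphism_inverse Fb.
have GqF : Gq F by split => // a aq; rewrite (Fc a) phiE aq.
have GqF' : Gq F' by split => // [|a aq]; [rewrite -{1}Ft F'F|rewrite -[RHS]F'F (Fc a) phiE aq].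
have sub u : decomposition c t O u -> Gq u by move=> [[ub ut uc] _]; split => // a _; exact: uc.
have Gqs := sub s Ds.
have D_group := decomposition_group c t O.
have [u Du uE] := subgroup_iter q D_group Ds.
have [v [Dv uv _]] := subgroup_inv D_group Du.
have sv x : iter q s (v x) = x by rewrite -uE uv.
have Fc' a : F (c a) = c (a ^+ q) by rewrite Fc phiE.
have Th := tame_frobenius (ltnW q1) t_coord OP mt Ft Fc' FO FF' F'F Ds Dv sv.
have := tame_kernel_trivial OP mt Th; have Gqv := sub v Dv; have Gqu := sub u Du.
rewrite A_rep.2//; last by apply: subgroup_comp => //; exact: subgroup_comp.
rewrite A_rep.2//; last exact: subgroup_comp.
rewrite A_rep.2// => AF.
have FFi := representation_invmx Gq_group A_rep GqF GqF' FF'.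
have uvi := representation_inv A_rep Gqu Gqv uv.
have AuE := representation_iter Gq_group A_rep Gqs uE.
have Xs : A s \is a GRing.unit := representation_unit Gq_group A_rep Gqs.
have XF : A F \is a GRing.unit := representation_unit Gq_group A_rep GqF.
have rel : A F * A s * (A F)^-1 = A s ^+ q.
  have Xv : A v \is a GRing.unit := representation_unit Gq_group A_rep Gqv.
  apply: (mulIr Xv); rewrite -AuE; transitivity (1 : 'M[E]_n.+1); last by symmetry; exact: uvi.
  by rewrite -[RHS]AF FFi -!mulrA.
have := quasi_unipotent q1 Xs XF rel; set N := _.-1 => uni.
have [g gu gE] := geom_isomorphic_conj.
have Gs : G s by apply/Gal_coordinate_aut; case: Ds.
rewrite gE// invmx_conj//.
have -> : g * A s ^+ N * g^-1 - 1 = g * (A s ^+ N - 1) * g^-1 by rewrite mulrBr mulrBl mulr1 mulrV.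
by rewrite invmx_conj// uni mulr0 mul0r.
Qed.

End Monodromy.

Lemma tame_kernel_conj (k Omega : closedFieldType) (c : {rmorphism k -> Omega}) t O O'
    (s u u' : {rmorphism Omega -> Omega}) : place c O ->
  coordinate_aut c t u -> coordinate_aut c t u' -> (forall x, u (u' x) = x) -> (forall x, u' (u x) = x) ->
  (forall x, O (u x) <-> O' x) -> tame_kernel c t O' s -> tame_kernel c t O (u \o (s \o u')).
Proof.
move=> OP Gu Gu' uu' u'u uO [[Gs sO'] s1]; have G_group := coordinate_aut_group c t.
split; first split.
- by apply: subgroup_comp => //; exact: subgroup_comp.
- by move=> x /=; rewrite uO sO' -uO uu'.
move=> x x0; have x0' : u' x != 0 by rewrite fmorph_eq0.
have [H1 H2] := s1 _ x0'.
have -> : (u \o (s \o u')) x / x - 1 = u (s (u' x) / u' x - 1).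
  by rewrite rmorphB rmorph1 rmorphM fmorphV uu'.
split; first exact/uO.
case: H2 => [->|H2]; first by left; rewrite rmorph0.
by right; rewrite -fmorphV => /uO.
Qed.

Lemma matrix_subgroupI (E : closedFieldType) m (G N : set 'M[E]_m) :
  matrix_subgroup G -> matrix_subgroup N -> matrix_subgroup (G `&` N).
Proof.
move=> [Gu G1 GM GV] [Nu N1 NM NV]; split=> [g [/Gu]//|//|g h [? ?] [? ?]|g [? ?]].
  by split; [exact: GM|exact: NM].
by split; [exact: GV|exact: NV].
Qed.

(** * The quotient of the monodromy group *)

Section MonodromyQuotient.

Variables (p : nat) (k Omega : closedFieldType) (iota : {rmorphism {fraction {poly k}} -> Omega}).
Hypotheses (Omega_closure : is_algebraic_closure iota) (p_char : p \in [pchar k]).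
Variables (E : closedFieldType) (w : E -> rat) (E0 : [pchar E] =i pred0) (w_val : is_valuation w).
Variables (n f : nat) (f0 : (0 < f)%N) (A H : {rmorphism Omega -> Omega} -> 'M[E]_n.+1).
Hypothesis A_lisse : lisse_on_Gm iota w (Fq (p ^ f)) A.
Hypothesis A_tame : tame_at_zero p iota A.
Hypothesis AH : geom_isomorphic iota A H.
Hypothesis H_lisse : lisse_on_Gm iota w setT H.
Hypothesis H_irreducible : irreducible_sheaf iota H.
Variables (O_infty : set Omega) (P_infty : set {rmorphism Omega -> Omega}).
Hypothesis O_place : place_above iota None O_infty.
Hypothesis P_wild : wild_inertia p iota O_infty P_infty.
Local Notation c := (const_morphism iota).
Local Notation t := (Defs.coord iota).
Local Notation G := (coordinate_aut c t).
Local Notation Gg := (G_geom iota H).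
Local Notation nc := (normal_closure Gg (H @` P_infty)).
Local Notation N := (G_P iota H P_infty).

Let t_coord : coordinate c t := coordinate_iota Omega_closure.
Let G_group : subgroup G := coordinate_aut_group c t.

Let H_rep : representation G H. Proof. by rewrite -Gal_setE; case: H_lisse. Qed.
Let H_cont : continuous_rep w G H. Proof. by rewrite -Gal_setE; case: H_lisse. Qed.

Let image_group : matrix_subgroup (H @` G) := representation_image G_group H_rep.

Let Gg_group : matrix_subgroup Gg.
Proof. by apply: zariski_group; rewrite Gal_setE. Qed.

Let mem_Gg s : G s -> Gg (H s).
Proof.
move=> Gs; apply: sub_zariski; last by exists s => //; rewrite Gal_setE.
by rewrite Gal_setE; case: image_group.
Qed.

Let P_sub : H @` P_infty `<=` Gg.
Proof.
move=> _ [s Ps <-]; apply: mem_Gg; have [PI _ _] := P_wild.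
by have [/Gal_coordinate_aut] := PI _ Ps.
Qed.

Let nc_group : matrix_subgroup nc := normal_closure_group Gg_group P_sub.

Lemma G_P_group : matrix_subgroup N.
Proof. by apply: matrix_subgroupI => //; exact: zariski_group. Qed.

Lemma G_P_closed : zariski_closure N `<=` N.
Proof.
move=> g [gu gN]; split.
  apply: (@zariski_idem _ _ (H @` Gal iota setT)); split => // F FG; apply: gN => h [Gh _]; exact: FG.
by apply: (@zariski_idem _ _ nc); split => // F FG; apply: gN => h [_ Gh]; exact: FG.
Qed.

Lemma G_P_normal g x : Gg g -> N x -> N (g * x * g^-1).
Proof.
move=> Ggg [Ggx ncx]; have [Gu G1 GM GV] := Gg_group; split.
  by apply: (GM); [exact: GM|exact: GV].
have gu := Gu _ Ggg; apply: (zariski_mul (S := nc)) => //; first by rewrite unitmx_inv.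
move=> h nch; apply: sub_zariski; first by case: nc_group.
exact: normal_closure_normal.
Qed.

Definition wild_preimage : set {rmorphism Omega -> Omega} := [set s | G s /\ N (H s)].
Local Notation K := wild_preimage.

Let K_group : subgroup K.
Proof.
have [_ N1 NM NV] := G_P_group; split.
- by move=> s [[]].
- by split; [exact: subgroup_id|rewrite H_rep.1].
- by move=> s u [Gs Ns] [Gu Nu]; split; [exact: subgroup_comp|rewrite H_rep.2//; exact: NM].
- move=> s [Gs Ns]; have [u [Gu su us]] := subgroup_inv G_group Gs; exists u => //; split => //.
  by rewrite (representation_invmx G_group H_rep Gs Gu su); exact: NV.
Qed.

Let K_closed : krull_closed K.
Proof.
apply: (preimage_closed w_val G_group H_rep _ H_cont G_P_closed); exact: coordinate_aut_closed.
Qed.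

Let K_normal s s' u : G s -> G s' -> (forall x, s (s' x) = x) -> K u -> K (s' \o (u \o s)).
Proof.
move=> Gs Gs' ss' [Gu Nu]; have Gus : G (u \o s) by exact: subgroup_comp.
split; first exact: subgroup_comp.
rewrite H_rep.2// H_rep.2//; have E' := representation_invmx G_group H_rep Gs Gs' ss'.
have := G_P_normal (mem_Gg Gs') Nu; rewrite {2}E' -[_^-1]/(invmx (invmx (H s))) invmxK.
by rewrite -mulrA.
Qed.

Let K_unramified (b : k) O s : b != 0 -> place c O -> max_ideal O (t - c b) ->
  decomposition c t O s -> K s.
Proof.
move=> b0 OP mt Ds; split; first by case: Ds.
have Ob : place_above iota (Some b) O by case: OP.
have [_ _ H1] := H_lisse; rewrite (H1 b O b0 Ob); first by case: G_P_group.
by rewrite (inertia_point Omega_closure Ob).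
Qed.

Let K_zero O s : place c O -> max_ideal O t -> tame_kernel c t O s -> K s.
Proof.
move=> OP mt Ts; have Gs : G s by case: Ts => -[].
split => //; have [g gu gE] := geom_isomorphic_conj AH.
rewrite gE ?Gal_setE// (tame_kernel_trivial Omega_closure p_char A_tame OP mt Ts) mulr1 mulrV//.
by case: G_P_group.
Qed.

(** The wild inertia at another place above infinity is conjugate into [P_infty], and the normal
    closure is stable under conjugation. *)
Let K_infinity O s : place c O -> max_ideal O t^-1 -> tame_kernel c t^-1 O s -> K s.
Proof.
move=> OP mt Ts; have Gs : G s by apply/coordinate_autV; case: Ts => -[].
split => //; split; first exact: mem_Gg.
have [Ov Oc mt'] := O_place; have OP' : place c O_infty by [].
have [u Gu uO] := places_conjugate p_char (coordinateV t_coord) OP' mt' OP mt.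
have [u' [Gu' uu' u'u]] := subgroup_inv (coordinate_aut_group c t^-1) Gu.
have Tc := tame_kernel_conj OP' Gu Gu' uu' u'u uO Ts.
have Pc := wild_inertia_infinity Omega_closure p_char O_place P_wild Tc.
have {}Gu : G u by exact/coordinate_autV.
have {}Gu' : G u' by exact/coordinate_autV.
apply: sub_zariski; first by case: nc_group.
have -> : H s = H u' *m H (u \o (s \o u')) *m invmx (H u').
  rewrite -(representation_invmx G_group H_rep Gu' Gu u'u).
  have Gsu : G (s \o u') by exact: subgroup_comp.
  have Gusu : G (u \o (s \o u')) by exact: subgroup_comp.
  rewrite -H_rep.2// -H_rep.2//; last exact: subgroup_comp.
  by congr H; apply: rmorphism_ext => x /=; rewrite u'u u'u.
by apply: sub_normal_closure; [exact: mem_Gg|exists (u \o (s \o u'))].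
Qed.

Let KG : K `<=` G. Proof. by move=> s []. Qed.

Let q := (p ^ f)%N.
Let n0 := (q ^ (n.+1)`!).-1.

Let q_gt1 : (1 < q)%N.
Proof. by rewrite -(exp1n f) ltn_exp2r// prime_gt1// (pcharf_prime p_char). Qed.

Let qE : n0.+1 = (q ^ (n.+1)`!)%N.
Proof. by rewrite prednK// expn_gt0 ltnW. Qed.

Let n0_gt0 : (0 < n0)%N.
Proof. by rewrite -ltnS qE -(exp1n (n.+1)`!) ltn_exp2r// fact_gt0. Qed.

(** p divides n0 + 1, a power of q with positive exponent. *)
Let n0_coprime : coprime p n0.
Proof.
have cop : coprime n0.+1 n0 by exact: coprimeSn.
apply: coprime_dvdl cop; rewrite qE /q -expnM -{1}(expn1 p); apply: dvdn_exp2l.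
by rewrite muln_gt0 f0 fact_gt0.
Qed.

(** H(u) = H(s)^n0 is unipotent by the Frobenius relation, and its commutators with the image lie in
    N because K contains all commutators; [unipotent_in_closed_normal] concludes. *)
Let inertia_power O s u : place c O -> max_ideal O t -> decomposition c t O s ->
  G u -> (forall x, u x = iter n0 s x) -> K u.
Proof.
move=> OP mt Ds Gu uE; split => //; have Gs : G s by case: Ds.
have [Nu N1 NM NV] := G_P_group.
have HuE := representation_iter G_group H_rep Gs uE.
have irr : irreducible_set (H @` G) by rewrite -Gal_setE; exact: irreducible_matrices.
apply: (unipotent_in_closed_normal E0 image_group irr N1 NM).
- by move=> g gu gN; apply: G_P_closed.
- by exists u.
- by rewrite HuE; exact: (inertia_quasi_unipotent Omega_closure p_char f0 A_lisse A_tame AH OP mt Ds).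
move=> _ j [y Gy <-]; have [v Gv vE] := subgroup_iter j G_group Gu.
have HvE := representation_iter G_group H_rep Gu vE.
have [y' [Gy' yy' _]] := subgroup_inv G_group Gy; have [v' [Gv' vv' _]] := subgroup_inv G_group Gv.
have [_] := commutator_mem t_coord p_char K_group K_closed KG K_normal K_unramified K_zero K_infinity
  Gy Gy' Gv Gv' yy' vv'.
have Gyv : G (y' \o v') by exact: subgroup_comp.
have Gvyv : G (v \o (y' \o v')) by exact: subgroup_comp.
rewrite H_rep.2// H_rep.2// H_rep.2//.
rewrite (representation_invmx G_group H_rep Gy Gy' yy') (representation_invmx G_group H_rep Gv Gv' vv') HvE.
by rewrite exprVn -!mulrA.
Qed.

(** An inertia element h at 0 multiplies tau = t^(1/n0) by a primitive n0-th root of unity. Every s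
    acts on tau like some power of h, so s lies in h^i K by [root_kernel]; thus h generates the
    quotient, whose order divides n0. *)
Theorem monodromy_quotient : exists gT : finGroupType,
  [/\ quotient_isomorphic Gg N gT, cyclic [set: gT]%G & coprime #|gT| p].
Proof.
have [O [OP Ot mt]] := place_above_point t_coord 0; rewrite rmorph0 subr0 in mt.
have [tau taun] := closed_root t n0_gt0.
have [z zp] := primitive_root_exists p_char n0_coprime n0_gt0.
have zn : z ^+ n0 = 1 := prim_expr_order zp.
have [h Dh htau] := inertia_root_of_unity p_char t_coord OP mt n0_gt0 taun zn.
have [Gh _] := Dh; have [_ _ hc] := Gh.
have [Nu N1 NM NV] := G_P_group; have [Ggu _ GgM _] := Gg_group.
have hX i (s : {rmorphism Omega -> Omega}) : (forall x, s x = iter i h x) -> s tau = c (z ^+ i) * tau.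
  move=> ->; elim: i => [|i IH]; first by rewrite expr0 rmorph1 mul1r.
  by rewrite iterS IH (rmorphM h) hc htau exprSr (rmorphM c) mulrA.
have cover g : Gg g -> exists i x, N x /\ g = H h ^+ i * x.
  move=> Ggg; have HhX i : H h ^+ i \in unitmx.
    have [u Gu uE] := subgroup_iter i G_group Gh.
    by rewrite -(representation_iter G_group H_rep Gh uE); exact: representation_unit G_group H_rep _ Gu.
  (* The n0 translates of N are closed and cover the image, hence also its Zariski closure. *)
  have [||i _ Ni] := @zariski_union _ _ (H @` Gal iota setT) n0 (fun i => [set g | N ((H h ^+ i)^-1 * g)]) _ _ g Ggg.
  - move=> _ [s /Gal_coordinate_aut Gs <-]; have [xi [xin sxi]] := aut_root t_coord Gs n0_gt0 taun.
    have [i xiE] := prim_rootP zp xin; exists i => //=.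
    have [u Gu uE] := subgroup_iter i G_group Gh.
    have [u' [Gu' uu' u'u]] := subgroup_inv G_group Gu.
    rewrite -(representation_iter G_group H_rep Gh uE).
    have -> : (H u)^-1 = H u' by rewrite (representation_invmx G_group H_rep Gu Gu' uu').
    have Gus : G (u' \o s) by exact: subgroup_comp.
    have [_] : K (u' \o s).
      apply: (root_kernel t_coord p_char K_group K_closed KG K_normal K_unramified K_zero K_infinity
        OP mt n0_gt0 (fun s u => inertia_power OP mt) taun Gus).
      by rewrite /= sxi xiE -(hX i u uE) u'u.
    by rewrite H_rep.2.
  - move=> i g' zg'; apply: G_P_closed; rewrite -[_ * g']mulr1.
    apply: (zariski_mul (S := [set g | N ((H h ^+ i)^-1 * g)])) => //; [by rewrite unitmx_inv|by rewrite unitmx1|].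
    by move=> a Na; rewrite mulmx1; apply: sub_zariski.
  by exists i, ((H h ^+ i)^-1 * g); rewrite mulVKr.
have NG : N `<=` Gg by move=> x [].
have Nhn : N (H h ^+ n0).
  have [u Gu uE] := subgroup_iter n0 G_group Gh.
  rewrite -(representation_iter G_group H_rep Gh uE).
  by case: (inertia_power OP mt Dh Gu uE).
have [gT [iso cyc card]] := cyclic_quotient Gg_group G_P_group NG G_P_normal (mem_Gg Gh) n0_gt0 Nhn cover.
by exists gT; split => //; apply: coprime_dvdl card _; rewrite coprime_sym.
Qed.

End MonodromyQuotient.

Theorem theorem4p3
  (p ell : nat) (p_pr : prime p) (ell_pr : prime ell) (p_neq_ell : p <> ell)
  (k : closedFieldType) (i_k : {rmorphism 'F_p -> k})
  (k_closure : is_algebraic_closure i_k)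
  (Omega : closedFieldType)
  (iota : {rmorphism {fraction {poly k}} -> Omega})
  (Omega_closure : is_algebraic_closure iota)
  (Q_ell : fieldType) (v : Q_ell -> rat)
  (E : closedFieldType) (w : E -> rat) (i_E : {rmorphism Q_ell -> E})
  (E_closure : is_Q_ell_bar ell v w i_E)
  (D m : nat) (m_lt_D : (m < D)%N)
  (H : {rmorphism Omega -> Omega} -> 'M[E]_D)
  (H_lisse : lisse_on_Gm iota w setT H)
  (H_irreducible : irreducible_sheaf iota H)
  (H_hypergeometric : hypergeometric p iota w m H)
  (H_definable : exists2 f, (0 < f)%N & definable_over iota w (p ^ f) H)
  (O_infty : set Omega) (O_place : place_above iota None O_infty)
  (P_infty : set {rmorphism Omega -> Omega})
  (P_wild : wild_inertia p iota O_infty P_infty) :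
  exists gT : finGroupType,
    [/\ quotient_isomorphic (G_geom iota H) (G_P iota H P_infty) gT,
        cyclic [set: gT]%G
      & coprime #|gT| p].
Proof.
destruct D as [|n]; first by [].
have p_char : p \in [pchar k] by rewrite (fmorph_pchar i_k) pchar_Fp.
have [[Q0 _ _ _ _] _ w_val _] := E_closure.
have E0 : [pchar E] =i pred0 by move=> x; rewrite (fmorph_pchar i_E); exact: Q0.
have [f [psi [chi [rho [A [[f0 _ _ _] A_lisse _ [A_tame _] AH]]]]]] := H_hypergeometric.
exact: (monodromy_quotient Omega_closure p_char E0 w_val f0 A_lisse A_tame AH H_lisse
  H_irreducible O_place P_wild).
Qed.
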